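(* Let $U_r(\Sigma)$ be a Cantor algebra with $\Sigma$ valid and order preserving and $U_r(\Sigma)$ bounded, where $1\le r\le d$. Then the following conditions are equivalent: (i) $T_r(\Sigma)$ is of type quasi-$\underline{\mathrm{FP}}_\infty$. (ii) $T_l(\Sigma)$ is of (ordinary) type $\mathrm{FP}_\infty$ for every $1\le l\le d$ such that $\gcd(l,d)\mid r$.
   Context: Cantor algebras. Fix finitely many colours $\{1,\ldots,s\}$, each colour $i$ having an arity, an integer $n_i>1$; put $d=\gcd\{n_i-1: i=1,\ldots,s\}$. An $\Omega$-algebra is a set $U$ with, for each colour $i$, an $n_i$-ary operation $\lambda_i:U^{n_i}\to U$ and $n_i$ unary operations $\alpha_i^1,\ldots,\alpha_i^{n_i}:U\to U$ (operations act on the right); write $v\alpha_i=(v\alpha_i^1,\ldots,v\alpha_i^{n_i})$. For a subset $Y$, a simple expansion of colour $i$ replaces one element $y\in Y$ by the $n_i$ elements $y\alpha_i^1,\ldots,y\alpha_i^{n_i}$; a simple contraction of colour $i$ replaces $n_i$ distinct elements $a_1,\ldots,a_{n_i}$ of $Y$ by the single element $(a_1,\ldots,a_{n_i})\lambda_i$. Let $X$ be a finite set with $|X|=r$ and $W_\Omega(X)$ the free $\Omega$-algebra on $X$. A subset of $W_\Omega(X)$ (or of a quotient of it) is admissible if it is obtained from $X$ (or its image) by finitely many simple expansions and contractions. Let $\Sigma=\Sigma_1\cup\Sigma_2$, where $\Sigma_1$ consists of the laws $u\alpha_i\lambda_i=u$ and $(u_1,\ldots,u_{n_i})\lambda_i\alpha_i=(u_1,\ldots,u_{n_i})$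 for all colours $i$, and $\Sigma_2=\bigcup_{1\le i<i'\le s}\Sigma_2^{i,i'}$, where each $\Sigma_2^{i,i'}$ is either empty or is of the following form: for some maps $f:\{1,\ldots,n_i\}\to\{1,\ldots,s\}$ and $f':\{1,\ldots,n_{i'}\}\to\{1,\ldots,s\}$ put $\Lambda_i=\{\alpha_i^j\alpha_{f(j)}^k: 1\le j\le n_i,\,1\le k\le n_{f(j)}\}$ and $\Lambda_{i'}=\{\alpha_{i'}^j\alpha_{f'(j)}^k: 1\le j\le n_{i'},\,1\le k\le n_{f'(j)}\}$ (sets of length 2 sequences of descending operations), fix a bijection $\phi:\Lambda_i\to\Lambda_{i'}$, and let $\Sigma_2^{i,i'}$ be the set of laws $u\nu=u\phi(\nu)$, $\nu\in\Lambda_i$. The Cantor algebra $U_r(\Sigma)$ is the quotient of $W_\Omega(X)$ by the fully invariant congruence generated by $\Sigma$. $\Sigma$ (or $U_r(\Sigma)$) is valid if every admissible $Y\subseteq W_\Omega(X)$ has the same cardinality as its image in $U_r(\Sigma)$. In that case $U_r(\Sigma)$ is free on $X$ in the class of $\Omega$-algebras satisfying $\Sigma$, and every admissible subset is a basis. For admissible subsets $Y,Z$ of $U_r(\Sigma)$ write $Y\le Z$ if $Z$ is obtained from $Y$ by a finite number of simple expansions. $U_r(\Sigma)$ is bounded if for all admissible $B,C$ for which there is an admissible $A$ with $A\le B$ and $A\le C$, there is a unique least upper bound of $B$ and $C$, i.e. an admissible $T$ with $B\le T$, $C\le T$ and $T\le S$ for every admissible $S$ with $B\le S$, $C\le S$.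 $G_r(\Sigma)$ is the group of those $\Omega$-algebra automorphisms of $U_r(\Sigma)$ which are induced by a bijection $V\to W$ between admissible subsets of the same cardinality. Order. $\Sigma$ is order preserving if each bijection $\phi:\Lambda_i\to\Lambda_{i'}$ occurring in $\Sigma_2$ is order preserving, where the elements $\alpha_i^j\alpha_{f(j)}^k$ of $\Lambda_i$ are ordered lexicographically by $(j,k)$, and similarly for $\Lambda_{i'}$. Fix a total order on $X$. Then admissible subsets inherit an order: when $y$ is expanded, the elements $y\alpha_i^1<\cdots<y\alpha_i^{n_i}$ are placed consecutively, in this order, in the position of $y$ (this determines the order on all admissible sets $Y\ge X$). $T_r(\Sigma)\le G_r(\Sigma)$ is the subgroup of automorphisms induced by bijections preserving the cyclic order between ordered admissible subsets of the same cardinality (these subsets may be taken to be $\ge X$). For any integer $m\ge 1$, $T_m(\Sigma)$ denotes the group constructed in the same way, with the same colours, arities and laws, from an ordered generating set of cardinality $m$; validity and boundedness are understood to hold for these algebras too. Finiteness conditions. A group $G$ is of type $\mathrm{FP}_\infty$ if the trivial $\mathbb{Z}G$-module $\mathbb{Z}$ has a resolution by finitely generated projective modules. A group $G$ is of type quasi-$\underline{\mathrm{FP}}_\infty$ if for each finite subgroup $K$ of $G$ there are only finitely many conjugacy classes of subgroups isomorphic to $K$ and the Weyl group $WK=N_G(K)/K$ is of type $\mathrm{FP}_\infty$. *)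

(* Defs.v *)
From HB Require Import structures.
From mathcomp Require Import all_boot all_order all_algebra finmap.
From mathcomp.multinomials Require Import monalg.
From mathcomp Require Import boolp classical_sets functions cardinality.

Set Implicit Arguments.
Unset Strict Implicit.
Unset Printing Implicit Defensive.

Import GRing.Theory.

Local Open Scope classical_set_scope.
Local Open Scope quotient_scope.
Local Open Scope group_scope.

(* Subgroups of a possibly infinite group [G] are bundled predicates
   [K : groupClosed G]. *)

Section SubgroupType.
Variables (G : groupType) (K : groupClosed G).

Definition subgroup_type : Type := {x : G | x \in K}.

HB.instance Definition _ := SubChoice.on subgroup_type.

Lemma subgroup_type_closed : group_closed (fun x : G => x \in K).
Proof. by split=> [|x y xK yK]; [exact: gpred1 | exact: gpredF]. Qed.

HB.instance Definition _ :=
  SubChoice_isSubGroup.Build G (fun x => x \in K) subgroup_type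
    subgroup_type_closed.

End SubgroupType.

Definition isomorphic (G H : groupType) : Prop :=
  exists f : G -> H, bijective f /\ {morph f : x y / x * y}.

Section WeylGroup.
Variables (G : groupType) (K : groupClosed G).

(* [y ^ x = x^-1 * (y * x)]; the equivalence says K^x = K, not merely an
   inclusion, which matters when K is infinite. *)
Definition normaliser : {pred G} :=
  fun x => `[< forall y, (y ^ x \in K) = (y \in K) >].

Lemma normaliserP x :
  reflect (forall y, (y ^ x \in K) = (y \in K)) (x \in normaliser).
Proof. exact: asboolP. Qed.

Lemma normaliserM : mulg_closed normaliser.
Proof.
move=> x y /normaliserP Nx /normaliserP Ny; apply/normaliserP => z.
by rewrite conjgM Ny Nx.
Qed.

Lemma normaliser1 : 1 \in normaliser.
Proof. by apply/normaliserP => y; rewrite conjg1. Qed.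

Lemma normaliserV : invg_closed normaliser.
Proof.
move=> x /normaliserP Nx; apply/normaliserP => y.
by rewrite -(Nx (y ^ x^-1)) -conjgM mulVg conjg1.
Qed.

HB.instance Definition _ := isMulClosed.Build G normaliser normaliserM.
HB.instance Definition _ := isMul1Closed.Build G normaliser normaliser1.
HB.instance Definition _ := isInvClosed.Build G normaliser normaliserV.

Definition NK : groupType := subgroup_type normaliser.

Definition coset_rel : rel NK := fun x y => val (x^-1 * y) \in K.

Lemma coset_rel_equiv : equiv_class_of coset_rel.
Proof.
split=> [x|x y|y x z].
- by rewrite /coset_rel mulVg gpred1.
- by rewrite /coset_rel -[LHS]gpredV -gmulfV invgM invgK.
- rewrite /coset_rel => xy yz.
  have -> : x^-1 * z = (x^-1 * y) * (y^-1 * z) by rewrite !mulgA mulgK.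
  by rewrite gmulfM gpredM.
Qed.

Canonical coset_equiv := EquivRelPack coset_rel_equiv.

Definition weyl : Type := {eq_quot coset_rel}.

HB.instance Definition _ := Choice.on weyl.
HB.instance Definition _ := EqQuotient.on weyl.

Lemma coset_eqP (x y : NK) :
  reflect (\pi_weyl x = \pi_weyl y) (val (x^-1 * y) \in K).
Proof. exact: (@eqmodP _ coset_equiv). Qed.

Definition weyl_one : weyl := \pi_weyl 1.
Definition weyl_mul (a b : weyl) : weyl := \pi_weyl (repr a * repr b).
Definition weyl_inv (a : weyl) : weyl := \pi_weyl (repr a)^-1.

Lemma coset_repr (x : NK) : val (x^-1 * repr (\pi_weyl x)) \in K.
Proof. by apply/coset_eqP; rewrite reprK. Qed.

Lemma cosetM (x y : NK) : weyl_mul (\pi_weyl x) (\pi_weyl y) = \pi_weyl (x * y).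
Proof.
apply/esym/coset_eqP; set x' := repr _; set y' := repr _.
have -> : (x * y)^-1 * (x' * y') = (x^-1 * x') ^ y * (y^-1 * y').
  by rewrite /conjg invgM !mulgA mulgK.
have /normaliserP Ny := valP y.
by rewrite gmulfM gpredM ?coset_repr// gmulfJ Ny coset_repr.
Qed.

Lemma cosetV (x : NK) : weyl_inv (\pi_weyl x) = \pi_weyl x^-1.
Proof.
apply/esym/coset_eqP; rewrite invgK; set x' := repr _.
have -> : x * x'^-1 = (x'^-1 * x) ^ x'^-1.
  by rewrite /conjg invgK !mulgA mulgV mul1g.
have /normaliserP Ny := valP x'^-1.
rewrite gmulfJ Ny -gpredV -gmulfV invgM invgK.
exact: coset_repr.
Qed.

Lemma weylP (a : weyl) : exists x, a = \pi_weyl x.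
Proof. by exists (repr a); rewrite reprK. Qed.

Lemma weyl_mulA : associative weyl_mul.
Proof.
move=> a b c; have [x ->] := weylP a; have [y ->] := weylP b.
have [z ->] := weylP c.
by rewrite !cosetM mulgA.
Qed.

Lemma weyl_mul1 : left_id weyl_one weyl_mul.
Proof. by move=> a; have [x ->] := weylP a; rewrite cosetM mul1g. Qed.

Lemma weyl_1mul : right_id weyl_one weyl_mul.
Proof. by move=> a; have [x ->] := weylP a; rewrite cosetM mulg1. Qed.

Lemma weyl_mulV : left_inverse weyl_one weyl_inv weyl_mul.
Proof. by move=> a; have [x ->] := weylP a; rewrite cosetV cosetM mulVg. Qed.

Lemma weyl_Vmul : right_inverse weyl_one weyl_inv weyl_mul.
Proof. by move=> a; have [x ->] := weylP a; rewrite cosetV cosetM mulgV. Qed.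

HB.instance Definition _ :=
  isGroup.Build weyl weyl_mulA weyl_mul1 weyl_1mul weyl_mulV weyl_Vmul.

End WeylGroup.

(* Z on which every element of G acts as the identity. *)
Definition trivial_module (G : groupType) : Type := int.

HB.instance Definition _ (G : groupType) := GRing.Zmodule.on (trivial_module G).

Section GroupRing.
Local Open Scope fset_scope.
Local Open Scope ring_scope.
Variable G : groupType.

(* [monalg] makes the free abelian group [{malg int[G]}] a ring only when [G] is
   a monoid without nontrivial units, hence the product defined below. *)
Definition group_ring : Type := {malg int[G]}.

HB.instance Definition _ := GRing.Zmodule.on group_ring.

Implicit Types z : group_ring.

Definition zg_one : group_ring := << 1%g >>.
Definition zg_mul z1 z2 : group_ring :=
  \sum_(k1 <- msupp z1) \sum_(k2 <- msupp z2)
    << z1@_k1 * z2@_k2 *g (k1 * k2)%g >>.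

Lemma zg_mulw (d1 d2 : {fset G}) z1 z2 :
  msupp z1 `<=` d1 -> msupp z2 `<=` d2 ->
  zg_mul z1 z2 = \sum_(k1 <- d1) \sum_(k2 <- d2)
    << z1@_k1 * z2@_k2 *g (k1 * k2)%g >>.
Proof.
move=> le_d1 le_d2; rewrite /zg_mul (big_fset_incl _ le_d1) /=.
  apply/eq_bigr=> k1 _; apply/big_fset_incl => // k _ /mcoeff_outdom ->.
  by rewrite mulr0 monalgU0.
move=> k _ /mcoeff_outdom g1k.
by rewrite big1 => // k' _; rewrite g1k mul0r monalgU0.
Qed.

Lemma zg_mul0l : left_zero 0 zg_mul.
Proof. by move=> z; rewrite /zg_mul msupp0 big_seq_fset0. Qed.

Lemma zg_mul0r : right_zero 0 zg_mul.
Proof.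
by move=> z; rewrite /zg_mul msupp0 big1 // => k _; rewrite big_seq_fset0.
Qed.

Lemma zg_mulUl c k z :
  zg_mul << c *g k >> z = \sum_(k' <- msupp z) << c * z@_k' *g (k * k')%g >>.
Proof.
rewrite (zg_mulw msuppU_le (fsubset_refl _)) big_seq_fset1.
by apply/eq_bigr => k' _; rewrite mcoeffUU.
Qed.

Lemma zg_mulUr c k z :
  zg_mul z << c *g k >> = \sum_(k' <- msupp z) << z@_k' * c *g (k' * k)%g >>.
Proof.
rewrite (zg_mulw (fsubset_refl _) msuppU_le).
by apply/eq_bigr=> k' _; rewrite big_seq_fset1 mcoeffUU.
Qed.

Lemma zg_mulUU c1 c2 k1 k2 :
  zg_mul << c1 *g k1 >> << c2 *g k2 >> = << c1 * c2 *g (k1 * k2)%g >>.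
Proof. by rewrite (zg_mulw msuppU_le msuppU_le) !big_seq_fset1 !mcoeffUU. Qed.

Lemma zg_mulEl z1 z2 :
  zg_mul z1 z2 = \sum_(k1 <- msupp z1) zg_mul << z1@_k1 *g k1 >> z2.
Proof. by apply/eq_bigr=> k _; rewrite zg_mulUl. Qed.

Lemma zg_mulEr z1 z2 :
  zg_mul z1 z2 = \sum_(k2 <- msupp z2) zg_mul z1 << z2@_k2 *g k2 >>.
Proof.
by rewrite /zg_mul exchange_big; apply/eq_bigr=> k _; rewrite -zg_mulUr.
Qed.

Lemma zg_mul1l : left_id zg_one zg_mul.
Proof.
move=> z; rewrite zg_mulUl [RHS]monalgE.
by apply/eq_bigr=> k _; rewrite mul1r mul1g.
Qed.

Lemma zg_mul1r : right_id zg_one zg_mul.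
Proof.
move=> z; rewrite zg_mulUr [RHS]monalgE.
by apply/eq_bigr=> k _; rewrite mulr1 mulg1.
Qed.

Lemma zg_mulDl : left_distributive zg_mul +%R.
Proof.
move=> z1 z2 z.
rewrite (zg_mulw (msuppD_le _ _) (fsubset_refl _)).
rewrite (zg_mulw (fsubsetUl _ (msupp z2)) (fsubset_refl _)).
rewrite (zg_mulw (fsubsetUr (msupp z1) _) (fsubset_refl _)).
rewrite -big_split /=; apply/eq_bigr=> k1 _.
rewrite -big_split /=; apply/eq_bigr=> k2 _.
by rewrite mcoeffD mulrDl monalgUD.
Qed.

Lemma zg_mulDr : right_distributive zg_mul +%R.
Proof.
move=> z z1 z2.
rewrite (zg_mulw (fsubset_refl _) (msuppD_le _ _)).
rewrite (zg_mulw (fsubset_refl _) (fsubsetUl _ (msupp z2))).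
rewrite (zg_mulw (fsubset_refl _) (fsubsetUr (msupp z1) _)).
rewrite -big_split /=; apply/eq_bigr=> k1 _.
rewrite -big_split /=; apply/eq_bigr=> k2 _.
by rewrite mcoeffD mulrDr monalgUD.
Qed.

Lemma zg_mulA : associative zg_mul.
Proof.
move=> z1 z2 z3.
rewrite [RHS](big_morph (zg_mul^~ _) (fun _ _ => zg_mulDl _ _ _) (zg_mul0l _)).
rewrite zg_mulEl; apply/eq_bigr=> k1 _.
rewrite [LHS](big_morph (zg_mul _) (fun _ _ => zg_mulDr _ _ _) (zg_mul0r _)).
rewrite [RHS](big_morph (zg_mul^~ _) (fun _ _ => zg_mulDl _ _ _) (zg_mul0l _)).
apply/eq_bigr=> k2 _.
rewrite [LHS](big_morph (zg_mul _) (fun _ _ => zg_mulDr _ _ _) (zg_mul0r _)).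
by rewrite zg_mulEr; apply/eq_bigr=> k3 _; rewrite !zg_mulUU mulrA mulgA.
Qed.

Lemma zg_one_neq0 : zg_one != 0.
Proof. by rewrite monalgU_eq0. Qed.

HB.instance Definition _ := GRing.Zmodule_isNzRing.Build group_ring
  zg_mulA zg_mul1l zg_mul1r zg_mulDl zg_mulDr zg_one_neq0.

Definition augmentation z : int := \sum_(k <- msupp z) z@_k.

Lemma augmentationw (d : {fset G}) z :
  msupp z `<=` d -> augmentation z = \sum_(k <- d) z@_k.
Proof.
by move=> le; rewrite /augmentation (big_fset_incl _ le) // => x _
  /mcoeff_outdom.
Qed.

Lemma augmentationD z1 z2 :
  augmentation (z1 + z2) = augmentation z1 + augmentation z2.
Proof.
rewrite (augmentationw (msuppD_le _ _)) (augmentationw (fsubsetUl _ (msupp z2))).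
rewrite (augmentationw (fsubsetUr (msupp z1) _)) -big_split /=.
by apply: eq_bigr => k _; rewrite mcoeffD.
Qed.

Lemma augmentation0 : augmentation 0 = 0.
Proof. by rewrite /augmentation msupp0 big_seq_fset0. Qed.

Lemma augmentationU c k : augmentation << c *g k >> = c.
Proof. by rewrite (augmentationw msuppU_le) big_seq_fset1 mcoeffUU. Qed.

Lemma augmentationM z1 z2 :
  augmentation (z1 * z2) = augmentation z1 * augmentation z2.
Proof.
rewrite (big_morph _ augmentationD augmentation0) mulr_suml.
apply: eq_bigr => k1 _.
rewrite (big_morph _ augmentationD augmentation0) mulr_sumr.
by apply: eq_bigr => k2 _; rewrite augmentationU.
Qed.

Definition trivial_scale z (m : trivial_module G) : trivial_module G :=
  augmentation z * (m : int).

Lemma trivial_scaleA a b v :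
  trivial_scale a (trivial_scale b v) = trivial_scale (a * b) v.
Proof. by rewrite /trivial_scale augmentationM mulrA. Qed.

Lemma trivial_scale1 : left_id 1 trivial_scale.
Proof. by move=> v; rewrite /trivial_scale augmentationU mul1r. Qed.

Lemma trivial_scaleDr : right_distributive trivial_scale +%R.
Proof. by move=> a u v; rewrite /trivial_scale mulrDr. Qed.

Lemma trivial_scaleDl v : {morph trivial_scale^~ v : a b / a + b}.
Proof. by move=> a b; rewrite /trivial_scale augmentationD mulrDl. Qed.

HB.instance Definition _ := GRing.Zmodule_isLmodule.Build group_ring
  (trivial_module G) trivial_scaleA trivial_scale1 trivial_scaleDr trivial_scaleDl.

End GroupRing.

Section Modules.
Local Open Scope ring_scope.
Variable R : nzRingType.

Definition finitely_generated (M : lmodType R) : Prop :=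
  exists n (e : 'I_n -> M),
    forall m, exists c : 'I_n -> R, m = \sum_i c i *: e i.

Definition projective (P : lmodType R) : Prop :=
  forall (A B : lmodType R) (f : {linear A -> B}) (g : {linear P -> B}),
    set_surj setT setT f -> exists h : {linear P -> A}, forall x, f (h x) = g x.

Definition fg_projective_resolution (M : lmodType R) (P : nat -> lmodType R)
    (d : forall n, {linear P n.+1 -> P n}) (eps : {linear P 0%N -> M}) : Prop :=
  [/\ forall n, finitely_generated (P n) /\ projective (P n),
      set_surj setT setT eps,
      eps @^-1` [set 0] = range (d 0%N) &
      forall n, d n @^-1` [set 0] = range (d n.+1)].

End Modules.

Definition FPinfty (G : groupType) : Prop :=
  exists (P : nat -> lmodType (group_ring G))
         (d : forall n, {linear P n.+1 -> P n})
         (eps : {linear P 0 -> trivial_module G}),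
    fg_projective_resolution d eps.

Definition conj_class (G : groupType) (K : groupClosed G) : set (set G) :=
  [set [set y ^ x | y in [set` K]] | x in [set: G]].

Definition quasi_FPinfty (G : groupType) : Prop :=
  forall K : groupClosed G, finite_set [set` K] ->
    finite_set [set conj_class L | L in
      [set L : groupClosed G | isomorphic (subgroup_type L) (subgroup_type K)]]
    /\ FPinfty (weyl K).

Record signature := Signature {
  ncolours : nat;
  arity : 'I_ncolours -> nat;
  arity_gt1 : forall i, (1 < arity i)%N }.

Definition sig_gcd (O : signature) : nat :=
  \big[gcdn/0%N]_(i < ncolours O) (arity i).-1.

Record omega_algebra (O : signature) := OmegaAlgebra {
  carrier :> choiceType;
  alpha : forall i : 'I_(ncolours O), 'I_(arity i) -> carrier -> carrier;
  lambda : forall i : 'I_(ncolours O), ('I_(arity i) -> carrier) -> carrier }.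

Section Algebra.
Variables (O : signature) (A : omega_algebra O).
Implicit Types (Y Z : set A) (i : 'I_(ncolours O)).

Definition expansion Y Z : Prop :=
  exists i y, Y y /\ Z = (Y `\ y) `|` range (fun j : 'I_(arity i) => alpha j y).

Definition contraction Y Z : Prop :=
  exists i (a : 'I_(arity i) -> A),
    [/\ injective a, range a `<=` Y & Z = (Y `\` range a) `|` [set lambda a]].

Inductive admissible_from (X : set A) : set A -> Prop :=
| adm_start : admissible_from X X
| adm_expansion Y Z :
    admissible_from X Y -> expansion Y Z -> admissible_from X Z
| adm_contraction Y Z :
    admissible_from X Y -> contraction Y Z -> admissible_from X Z.

Inductive adm_le Y : set A -> Prop :=
| adm_le_refl : adm_le Y Y
| adm_le_step Z Z' : adm_le Y Z -> expansion Z Z' -> adm_le Y Z'.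

(* Sequences obtained from [X] by simple expansions, the [y alpha_i^j] being
   inserted consecutively at the position of [y]. *)
Inductive ordered_from (X : seq A) : seq A -> Prop :=
| ord_start : ordered_from X X
| ord_step (s1 s2 : seq A) y i :
    ordered_from X (s1 ++ y :: s2) ->
    ordered_from X
      (s1 ++ [seq alpha j y | j <- enum 'I_(arity i)] ++ s2).

(* The cyclic order induced by the linear order of the sequence [s]. *)
Definition cyclic_order (s : seq A) (x y z : A) : bool :=
  let lt a b := (index a s < index b s)%N in
  [|| lt x y && lt y z, lt y z && lt z x | lt z x && lt x y].

Definition algebra_morphism (f : A -> A) : Prop :=
  (forall i (j : 'I_(arity i)) u, f (alpha j u) = alpha j (f u)) /\
  (forall i (a : 'I_(arity i) -> A), f (lambda a) = lambda (f \o a)).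

Record automorphism := Automorphism {
  aut_fun :> A -> A;
  aut_inv : A -> A;
  aut_funK : cancel aut_fun aut_inv;
  aut_invK : cancel aut_inv aut_fun;
  aut_morph : algebra_morphism aut_fun }.

Lemma automorphism_eq (g h : automorphism) : g =1 h -> g = h.
Proof.
case: g h => [g g' gK g'K gm] [h h' hK h'K hm] /= /funext gh; subst h.
have e : g' = h' by apply: funext => x; rewrite -{1}(h'K x) gK.
by subst h'; congr Automorphism; exact: Prop_irrelevance.
Qed.

HB.instance Definition _ := gen_eqMixin automorphism.
HB.instance Definition _ := gen_choiceMixin automorphism.

Definition aut_one : automorphism.
Proof. by exists id id; split=> // i a; rewrite compidr. Defined.

(* Algebra maps act on the right: [g * h] is [g] followed by [h]. *)
Definition aut_mul (g h : automorphism) : automorphism.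
Proof.
exists (h \o g) (aut_inv g \o aut_inv h).
- exact: can_comp (@aut_funK h) (@aut_funK g).
- exact: can_comp (@aut_invK g) (@aut_invK h).
- have [ga gl] := aut_morph g; have [ha hl] := aut_morph h.
  by split=> [i j u|i a] /=; rewrite ?ga ?ha ?gl ?hl.
Defined.

Definition aut_opp (g : automorphism) : automorphism.
Proof.
exists (aut_inv g) g; [exact: aut_invK | exact: aut_funK |].
have [ga gl] := aut_morph g; have gI := can_inj (@aut_funK g).
split=> [i j u|i a]; apply: gI.
  by rewrite ga !aut_invK.
by rewrite gl aut_invK; congr lambda; apply: funext => j /=; rewrite aut_invK.
Defined.

Lemma aut_mulA : associative aut_mul.
Proof. by move=> *; exact: automorphism_eq. Qed.
Lemma aut_mul1 : left_id aut_one aut_mul.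
Proof. by move=> *; exact: automorphism_eq. Qed.
Lemma aut_1mul : right_id aut_one aut_mul.
Proof. by move=> *; exact: automorphism_eq. Qed.
Lemma aut_mulV : left_inverse aut_one aut_opp aut_mul.
Proof. by move=> g; apply: automorphism_eq => x; exact: aut_invK. Qed.
Lemma aut_Vmul : right_inverse aut_one aut_opp aut_mul.
Proof. by move=> g; apply: automorphism_eq => x; exact: aut_funK. Qed.

HB.instance Definition _ :=
  isGroup.Build automorphism aut_mulA aut_mul1 aut_1mul aut_mulV aut_Vmul.

End Algebra.

Inductive term (O : signature) (X : Type) : Type :=
| Gen of X
| Alpha (i : 'I_(ncolours O)) (j : 'I_(arity i)) of term O X
| Lambda (i : 'I_(ncolours O)) of 'I_(arity i) -> term O X.

Arguments Gen {O X}.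
Arguments Alpha {O X i}.
Arguments Lambda {O X i}.

HB.instance Definition _ O X := gen_eqMixin (term O X).
HB.instance Definition _ O X := gen_choiceMixin (term O X).

Definition free_algebra (O : signature) (X : Type) : omega_algebra O :=
  @OmegaAlgebra O (term O X) (@Alpha O X) (@Lambda O X).

(* A nonempty [Sigma_2^{i,i'}].  The word [alpha_i^j alpha_{f j}^k] is
   represented by the dependent pair [Tagged _ k] with tag [j]; distinct pairs
   are distinct words. *)
Record sigma2 (O : signature) (i i' : 'I_(ncolours O)) := Sigma2 {
  fst_colour : 'I_(arity i) -> 'I_(ncolours O);
  snd_colour : 'I_(arity i') -> 'I_(ncolours O);
  phi : {j : 'I_(arity i) & 'I_(arity (fst_colour j))} ->
        {j : 'I_(arity i') & 'I_(arity (snd_colour j))};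
  phi_bij : bijective phi }.

Arguments phi {O i i'} s _.

Definition laws (O : signature) : Type :=
  forall i i' : 'I_(ncolours O), (i < i')%N -> option (sigma2 i i').

Definition lex_lt n (m : 'I_n -> nat) (p q : {j : 'I_n & 'I_(m j)}) : bool :=
  (tag p < tag q)%N || (tag p == tag q) && (tagged p < tagged q)%N.

Definition order_preserving (O : signature) (S : laws O) : Prop :=
  forall (i i' : 'I_(ncolours O)) (lt : (i < i')%N) b, S i i' lt = Some b ->
    {homo phi b : p q / lex_lt p q}.

Section Cantor.
Variables (O : signature) (S : laws O).

(* [u nu] for the word [nu = alpha_i^j alpha_{c j}^k], operations acting on the
   right. *)
Definition descend (X : Type) (i : 'I_(ncolours O))
    (c : 'I_(arity i) -> 'I_(ncolours O)) (u : term O X)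
    (nu : {j : 'I_(arity i) & 'I_(arity (c j))}) : term O X :=
  Alpha (tagged nu) (Alpha (tag nu) u).

(* All instances of the laws are imposed, so that this congruence is fully
   invariant: see [cong_fully_invariant]. *)
Inductive cong (X : Type) : term O X -> term O X -> Prop :=
| cong_refl t : cong t t
| cong_sym t u : cong t u -> cong u t
| cong_trans t u v : cong t u -> cong u v -> cong t v
| cong_alpha i (j : 'I_(arity i)) t u :
    cong t u -> cong (Alpha j t) (Alpha j u)
| cong_lambda i (a b : 'I_(arity i) -> term O X) :
    (forall j, cong (a j) (b j)) -> cong (Lambda a) (Lambda b)
| cong_alpha_lambda i u :
    cong (Lambda (fun j : 'I_(arity i) => Alpha j u)) u
| cong_lambda_alpha i (a : 'I_(arity i) -> term O X) j :
    cong (Alpha j (Lambda a)) (a j)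
| cong_sigma2 (i i' : 'I_(ncolours O)) (lt : (i < i')%N) b u nu :
    @S i i' lt = Some b ->
    cong (@descend X i (fst_colour b) u nu)
         (@descend X i' (snd_colour b) u (phi b nu)).

Fixpoint subst (X Y : Type) (h : X -> term O Y) (t : term O X) : term O Y :=
  match t with
  | Gen x => h x
  | Alpha i j t => Alpha j (subst h t)
  | Lambda i a => Lambda (fun j => subst h (a j))
  end.

Lemma cong_fully_invariant (X Y : Type) (h : X -> term O Y) t u :
  cong t u -> cong (subst h t) (subst h u).
Proof.
elim=> /=; eauto using cong.
Qed.

Definition congb (X : Type) : rel (term O X) := fun t u => `[< cong t u >].

Lemma congb_equiv X : equiv_class_of (@congb X).
Proof.
split=> [t|t u|u t v].
- by apply/asboolP; exact: cong_refl.
- by apply/asboolP/asboolP; exact: cong_sym.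
- by move=> /asboolP tu /asboolP uv; apply/asboolP; exact: cong_trans tu uv.
Qed.

Canonical cong_equiv X := EquivRelPack (congb_equiv X).

(* [X] is taken to be ['I_r] with its usual order. *)
Definition cantor_type (r : nat) : Type := {eq_quot @congb 'I_r}.

HB.instance Definition _ r := Choice.on (cantor_type r).
HB.instance Definition _ r := EqQuotient.on (cantor_type r).

Definition cantor_proj r (t : term O 'I_r) : cantor_type r := \pi_(cantor_type r) t.

Definition cantor r : omega_algebra O :=
  @OmegaAlgebra O (cantor_type r)
    (fun i j u => cantor_proj (Alpha j (repr u)))
    (fun i a => cantor_proj (Lambda (fun j => repr (a j)))).

Lemma cantor_projP r (t u : term O 'I_r) :
  cantor_proj t = cantor_proj u <-> cong t u.
Proof.
split=> [|tu]; first by move=> /(@eqmodP _ (cong_equiv 'I_r)) /asboolP.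
by apply/(@eqmodP _ (cong_equiv 'I_r)); apply/asboolP.
Qed.

Lemma cantor_projK r (u : cantor r) : cantor_proj (repr u) = u.
Proof. exact: reprK. Qed.

Lemma cantor_proj_alpha r i (j : 'I_(arity i)) (t : term O 'I_r) :
  cantor_proj (Alpha j t) = alpha j (cantor_proj t : cantor r).
Proof.
by apply/cantor_projP/cong_alpha/cantor_projP; rewrite cantor_projK.
Qed.

Lemma cantor_proj_lambda r i (a : 'I_(arity i) -> term O 'I_r) :
  cantor_proj (Lambda a) = lambda (fun j => cantor_proj (a j) : cantor r).
Proof.
apply/cantor_projP/cong_lambda => j; apply/cantor_projP.
by rewrite cantor_projK.
Qed.

Definition free_generators r : set (free_algebra O 'I_r) := range Gen.

Definition generator r (x : 'I_r) : cantor r := cantor_proj (Gen x).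

Definition admissible r : set (cantor r) -> Prop :=
  admissible_from (range (@generator r)).

Definition ordered_admissible r : seq (cantor r) -> Prop :=
  ordered_from [seq generator x | x <- enum 'I_r].

Definition valid r : Prop :=
  forall Y : set (free_algebra O 'I_r), admissible_from (@free_generators r) Y ->
    (Y #= (@cantor_proj r) @` Y)%card.

Definition is_lub r (B C T : set (cantor r)) : Prop :=
  [/\ admissible T, adm_le B T, adm_le C T &
      forall Z, admissible Z -> adm_le B Z -> adm_le C Z -> adm_le T Z].

Definition bounded r : Prop :=
  forall B C : set (cantor r), admissible B -> admissible C ->
    (exists A, [/\ admissible A, adm_le A B & adm_le A C]) ->
    exists! T, is_lub B C T.

Definition induced_by r (V W : set (cantor r)) (g : automorphism (cantor r)) :
    Prop :=
  [/\ admissible V, admissible W & set_bij V W g].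

Definition thompson_G r : set (automorphism (cantor r)) :=
  [set g | exists V W, induced_by V W g].

(* Only a set at this point: its closure under composition depends on the
   validity, boundedness and order preservation of the laws. *)
Definition thompson_T r : set (automorphism (cantor r)) :=
  [set g | exists V W : seq (cantor r),
    [/\ ordered_admissible V, ordered_admissible W,
        induced_by [set` V] [set` W] g &
        {in V & &, forall x y z,
          cyclic_order W (g x) (g y) (g z) = cyclic_order V x y z}]].

Lemma thompson_T_sub_G r : @thompson_T r `<=` @thompson_G r.
Proof. by move=> g [V [W [_ _ VW _]]]; exists [set` V], [set` W]. Qed.

End Cantor.

(* Main.v *)
Require Import Defs.
From HB Require Import structures.
From mathcomp Require Import all_boot all_order all_algebra finmap zify.
From mathcomp.multinomials Require Import monalg.
From mathcomp Require Import boolp classical_sets functions cardinality.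

Set Implicit Arguments.
Unset Strict Implicit.
Unset Printing Implicit Defensive.

(** The proof rests on a description of the finite subgroups of T_r.

    A planar expansion ([pexp]) of a sequence replaces an entry by its children
    in order, and T_r consists of the automorphisms carrying one rotation of an
    ordered admissible sequence to another ([cyc_aut], [thompson_T_cyc]).
    Everything is about bases: a simple expansion of a basis is a basis
    ([basis_step]), so two bases of equal size are exchanged by a unique
    automorphism ([basis_aut], [basis_aut_eq]).

    For T_r to be a group, two ordered expansions of the same basis which agree
    as sets must agree as sequences ([pexp_order_unique]); together with least
    upper bounds this gives common ordered refinements ([OA_lub], [cyc_autM]).
    This is not immediate when some pair of colours carries no law, since an
    equality of admissible sets may then come from a long derivation.  The
    order is read off from a suitable model instead.  Let A and B be algebras
    satisfying the laws, with a charge on A in Z/2 which is additive: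
    the charge of u is the sum of the charges of its children.  On A * (B * B),
    let a descending operation exchange the two copies of B once for each unit
    of charge lying to its left.  Order preserving laws compare words with the
    same total charge on the left, so this twisted algebra satisfies the laws
    again ([models_twisted]), and evaluating a leaf in it reveals which leaves
    precede it ([order_unique_of_charge]).  A charged algebra is given by the
    finite sets of points of the boundary of U_1, the charge being the parity
    of the cardinal; boundedness provides the points ([exists_point]) and makes
    every colour cut the boundary into translates of itself
    ([prepend_surj], [prepend_inj]).

    Let K be a finite subgroup of T_r.  The least common refinement of the
    translates of a suitable ordered admissible sequence is K-invariant, and K
    rotates it ([invariant_basis]).  Hence K is cyclic, generated by some k of
    order p, and there is an ordered admissible sequence v, k v, ...,
    k^(p-1) v ([invariant_orbits]).  Up to conjugacy K is determined by p and by
    the size l of v modulo d ([orbit_form_conj]), where p l = r modulo d.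
    Sending k^a v_b to the b-th generator defines a projection from U_r to U_l;
    an element of the normaliser of K descends along it to an element of T_l,
    every element of T_l arises in this way, and the kernel is K
    ([normalises_descends], [normalises_lift], [normalises_kernel]).  So the
    Weyl group of K is T_l ([weyl_orbits]).  The case K = 1 shows that T_r only
    depends on r modulo d ([T_expansion], [T_congruent]).

    Finally the l occurring for some p are, modulo d, those for which gcd(l, d)
    divides r, and each of them occurs ([exists_orbit_form]); this turns the
    finiteness of the Weyl groups into the condition on the groups T_l. *)

Local Notation pexp := (@ordered_from _ _).

(** * Models of the laws, free algebras and bases *)

Section Models.
Variables (O : signature) (S : laws O).
Implicit Types A B V : omega_algebra O.

Definition models A : Prop :=
  [/\ forall (i : 'I_(ncolours O)) (u : A),
        lambda (fun j : 'I_(arity i) => alpha j u) = u,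
      forall (i : 'I_(ncolours O)) (a : 'I_(arity i) -> A) j,
        alpha j (lambda a) = a j &
      forall (i i' : 'I_(ncolours O)) (lt : (i < i')%N) b, S lt = Some b ->
        forall (u : A) nu,
          alpha (tagged nu) (alpha (tag nu) u) =
          alpha (tagged (phi b nu)) (alpha (tag (phi b nu)) u)].

Definition hom A B (f : A -> B) : Prop :=
  (forall (i : 'I_(ncolours O)) (j : 'I_(arity i)) u,
     f (alpha j u) = alpha j (f u)) /\
  (forall (i : 'I_(ncolours O)) (a : 'I_(arity i) -> A),
     f (lambda a) = lambda (f \o a)).

(** Both elements are the lambda of their children. *)
Lemma alpha_inj A (i : 'I_(ncolours O)) (u v : A) : models A ->
  (forall j : 'I_(arity i), alpha j u = alpha j v) -> u = v.
Proof.
case=> M1 _ _ uv; rewrite -(M1 i u) -(M1 i v); congr lambda.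
by apply: funext.
Qed.

(** Compatibility with lambda is automatic: compare the children of both sides. *)
Lemma hom_alpha A B (f : A -> B) : models A -> models B ->
  (forall (i : 'I_(ncolours O)) (j : 'I_(arity i)) u,
     f (alpha j u) = alpha j (f u)) -> hom f.
Proof.
move=> [_ MA _] MB fa; split=> // i a; apply: (@alpha_inj _ i) => // j.
by rewrite -fa MA; case: MB => _ ->.
Qed.

Lemma hom_id A : hom (@id A).
Proof. by split=> // i a; rewrite compidr. Qed.

Lemma hom_comp A B (C : omega_algebra O) (g : B -> C) (f : A -> B) :
  hom g -> hom f -> hom (g \o f).
Proof.
by move=> [ga gl] [fa fl]; split=> [i j u|i a] /=; rewrite ?fa ?ga ?fl ?gl.
Qed.

Lemma hom_aut A (g : automorphism A) : hom g.
Proof. exact: aut_morph. Qed.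

Fixpoint eval A (X : Type) (h : X -> A) (t : term O X) : A :=
  match t with
  | Gen x => h x
  | Alpha i j t => alpha j (eval h t)
  | Lambda i a => lambda (fun j => eval h (a j))
  end.

Lemma eval_cong A X (h : X -> A) t u :
  models A -> cong S t u -> eval h t = eval h u.
Proof.
case=> M1 M2 M3; elim=> //=.
- by move=> ? ? ? _ -> _ ->.
- by move=> ? ? ? ? _ ->.
- by move=> ? ? ? _ ab; congr lambda; apply: funext.
- by move=> i a j; rewrite M2.
- by move=> i i' lt b v nu Sb; exact: M3 Sb _ _.
Qed.

Lemma models_cantor m : models (cantor S m).
Proof.
split.
- move=> i u; rewrite -[in RHS](cantor_projK u) /=.
  apply/cantor_projP; refine (cong_trans _ (@cong_alpha_lambda _ S _ i (repr u))).
  apply: cong_lambda => j; apply/cantor_projP.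
  by rewrite cantor_projK.
- move=> i a j; rewrite -[in RHS](cantor_projK (a j)) /=.
  apply/cantor_projP; refine (cong_trans _ (@cong_lambda_alpha _ S _ i (fun j => repr (a j)) j)).
  by apply: cong_alpha; apply/cantor_projP; rewrite cantor_projK.
- move=> i i' lt b Sb u nu; rewrite -(cantor_projK u) -!cantor_proj_alpha.
  by apply/cantor_projP; exact: cong_sigma2.
Qed.

Definition free_hom A m (h : 'I_m -> A) (u : cantor S m) : A := eval h (repr u).

Lemma free_hom_proj A m (h : 'I_m -> A) t : models A ->
  free_hom h (cantor_proj S t) = eval h t.
Proof.
move=> MA; apply: eval_cong => //; apply/cantor_projP.
by rewrite cantor_projK.
Qed.

Lemma free_hom_gen A m (h : 'I_m -> A) x : models A ->
  free_hom h (generator S x) = h x.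
Proof. by move=> MA; rewrite /generator free_hom_proj. Qed.

Lemma hom_free_hom A m (h : 'I_m -> A) : models A -> hom (free_hom h).
Proof.
move=> MA; apply: hom_alpha => // [|i j u]; first exact: models_cantor.
by rewrite -(cantor_projK u) -cantor_proj_alpha !free_hom_proj.
Qed.

Lemma cantor_ind m (P : cantor S m -> Prop) :
  (forall x, P (generator S x)) ->
  (forall (i : 'I_(ncolours O)) (j : 'I_(arity i)) u, P u -> P (alpha j u)) ->
  (forall (i : 'I_(ncolours O)) (a : 'I_(arity i) -> cantor S m),
     (forall j, P (a j)) -> P (lambda a)) ->
  forall u, P u.
Proof.
move=> P0 Pa Pl u; rewrite -(cantor_projK u).
elim: (repr u) => [x|i j t IH|i a IH]; first exact: P0.
  by rewrite cantor_proj_alpha; exact: Pa.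
by rewrite cantor_proj_lambda; exact: Pl.
Qed.

Lemma hom_gen_eq A m (f g : cantor S m -> A) : hom f -> hom g ->
  (forall x, f (generator S x) = g (generator S x)) -> f =1 g.
Proof.
move=> [fa fl] [ga gl] fg; elim/cantor_ind => [//|i j u IH|i a IH].
  by rewrite fa ga IH.
by rewrite fl gl; congr lambda; apply: funext.
Qed.

(** Freeness among all models rather than freeness of the algebra as such, so
    that it can be tested on auxiliary models; distinctness is listed apart
    because extensions are stated for functions on elements. *)
Definition basis V (s : seq V) : Prop :=
  [/\ uniq s,
      forall A (b : V -> A), models A -> exists2 f : V -> A, hom f & {in s, f =1 b} &
      forall A (f g : V -> A), models A -> hom f -> hom g ->
        {in s, f =1 g} -> f =1 g].

Definition generators m : seq (cantor S m) :=
  [seq generator S x | x <- enum 'I_m].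

Definition children V (i : 'I_(ncolours O)) (y : V) : seq V :=
  [seq alpha j y | j <- enum 'I_(arity i)].

Inductive descendant V (u : V) : V -> Prop :=
| desc_refl : descendant u u
| desc_alpha v (i : 'I_(ncolours O)) (j : 'I_(arity i)) :
    descendant u v -> descendant u (alpha j v).

Lemma desc_trans V (u v w : V) :
  descendant u v -> descendant v w -> descendant u w.
Proof. by move=> uv; elim => // *; exact: desc_alpha. Qed.

Lemma desc_hom A B (f : A -> B) u v : hom f ->
  descendant u v -> descendant (f u) (f v).
Proof.
move=> [fa _]; elim=> [|w i j _ IH]; first exact: desc_refl.
by rewrite fa; exact: desc_alpha.
Qed.

Lemma desc_im A B (f : A -> B) u w : hom f ->
  descendant (f u) w -> exists2 v, descendant u v & w = f v.
Proof.
move=> [fa _]; elim=> [|{}w i j _ [v uv ->]]; first by exists u => //; exact: desc_refl.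
by exists (alpha j v); [exact: desc_alpha | rewrite fa].
Qed.

Lemma mem_children V (i : 'I_(ncolours O)) (y : V) z :
  z \in children i y -> exists j : 'I_(arity i), z = alpha j y.
Proof. by case/mapP=> j _ ->; exists j. Qed.

Lemma alpha_children V (i : 'I_(ncolours O)) (y : V) (j : 'I_(arity i)) :
  alpha j y \in children i y.
Proof. by apply/mapP; exists j; rewrite ?mem_enum. Qed.

Lemma size_children V (i : 'I_(ncolours O)) (y : V) :
  size (children i y) = arity i.
Proof. by rewrite size_map size_enum_ord. Qed.

Lemma map_children A B (f : A -> B) (i : 'I_(ncolours O)) y : hom f ->
  map f (children i y) = children i (f y).
Proof.
by move=> [fa _]; rewrite -map_comp; apply: eq_map => j /=; rewrite fa.
Qed.

Lemma pexp_trans V (s t u : seq V) : pexp s t -> pexp t u -> pexp s u.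
Proof. by move=> st; elim => // *; exact: ord_step. Qed.

Lemma pexp1 V (s1 s2 : seq V) y i :
  pexp (s1 ++ y :: s2) (s1 ++ children i y ++ s2).
Proof. by apply: ord_step; exact: ord_start. Qed.

Lemma pexp_cat V (s s' t t' : seq V) :
  pexp s t -> pexp s' t' -> pexp (s ++ s') (t ++ t').
Proof.
move=> st st'; apply: (@pexp_trans _ _ (t ++ s')).
- elim: st => [|t1 t2 y i _ IH]; first exact: ord_start.
  rewrite -!catA; apply: ord_step; by rewrite -catA in IH.
- elim: st' => [|t1 t2 y i _ IH]; first exact: ord_start.
  rewrite catA; apply: ord_step; by rewrite -catA.
Qed.

Lemma pexp_map A B (f : A -> B) s t : hom f -> pexp s t -> pexp (map f s) (map f t).
Proof.
move=> hf; elim=> [|s1 s2 y i _ IH]; first exact: ord_start.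
rewrite !map_cat map_children //; apply: ord_step.
by rewrite map_cat in IH.
Qed.

Lemma cat_cons_split (T : Type) (u1 u2 t1 t2 : seq T) y :
  u1 ++ y :: u2 = t1 ++ t2 ->
  (exists c, t1 = u1 ++ y :: c /\ u2 = c ++ t2) \/
  (exists c, u1 = t1 ++ c /\ t2 = c ++ y :: u2).
Proof.
elim: u1 t1 => [|x u1 IH] [|z t1] //=.
- by move=> <-; right; exists [::].
- by case=> <- ->; left; exists t1.
- by move=> <-; right; exists (x :: u1).
case=> <- /IH [[c [-> ->]]|[c [-> ->]]]; first by left; exists c.
by right; exists c.
Qed.

Lemma map_cat_cons (T T' : Type) (f : T -> T') u s1 s2 y :
  map f u = s1 ++ y :: s2 ->
  exists u1 x u2, [/\ u = u1 ++ x :: u2, s1 = map f u1, y = f x & s2 = map f u2].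
Proof.
elim: u s1 => [|x u IH] [|z s1] //=.
  by case=> <- <-; exists [::], x, u.
case=> <- /IH [u1 [x1 [u2 [-> -> -> ->]]]].
by exists (x :: u1), x1, u2.
Qed.

(** Expansions commute with homomorphisms, so an expansion of an image lifts to
    an expansion of the source. *)
Lemma pexp_map_im A B (f : A -> B) s t : hom f -> pexp (map f s) t ->
  exists2 u, pexp s u & t = map f u.
Proof.
move=> hf; elim=> [|s1 s2 y i _ [u su]]; first by exists s => //; exact: ord_start.
move=> E; have [u1 [x [u2 [uE -> -> ->]]]] := map_cat_cons (esym E).
exists (u1 ++ children i x ++ u2); last by rewrite !map_cat map_children.
by apply: pexp_trans su _; rewrite uE; exact: pexp1.
Qed.

Lemma pexp_cat_inv V (s1 s2 t : seq V) : pexp (s1 ++ s2) t ->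
  exists t1 t2, [/\ t = t1 ++ t2, pexp s1 t1 & pexp s2 t2].
Proof.
elim=> [|u1 u2 y i _ [t1 [t2 [E p1 p2]]]].
  by exists s1, s2; split=> //; exact: ord_start.
case: (cat_cons_split E) => -[c [cE c2E]]; subst.
  exists (u1 ++ children i y ++ c), t2; rewrite -!catA; split=> //.
  exact: ord_step.
exists t1, (c ++ children i y ++ u2); rewrite -!catA; split=> //.
exact: ord_step.
Qed.

Lemma pexp_nil V (t : seq V) : pexp [::] t -> t = [::].
Proof. by elim=> // -[|? ?] ? ? ? _ //=. Qed.

Lemma pexp_desc V (s t : seq V) : pexp s t ->
  forall z, z \in t -> exists2 y, y \in s & descendant y z.
Proof.
elim=> [|s1 s2 y i _ IH] z; first by exists z => //; exact: desc_refl.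
rewrite !mem_cat => /or3P [zs|/mem_children [j ->]|zs].
- by apply: IH; rewrite mem_cat zs.
- have [|x xs xy] := IH y; first by rewrite mem_cat mem_head orbT.
  by exists x => //; exact: desc_alpha.
- by apply: IH; rewrite mem_cat inE zs !orbT.
Qed.

Lemma arity_gt0 (i : 'I_(ncolours O)) : 0 < arity i.
Proof. exact: ltnW (arity_gt1 i). Qed.

Lemma pexp_size V (s t : seq V) : pexp s t -> size s <= size t.
Proof.
elim=> [//|s1 s2 y i _]; rewrite !size_cat size_children /=.
have := arity_gt0 i; lia.
Qed.

Lemma pexp_size_eq V (s t : seq V) : pexp s t -> size s = size t -> s = t.
Proof.
elim=> [//|s1 s2 y i /pexp_size + _]; rewrite !size_cat size_children /=.
have := arity_gt1 i; lia.
Qed.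

Lemma basis_generators m :
  injective (@generator O S m) -> basis (generators m).
Proof.
move=> gI; split.
- by rewrite map_inj_uniq ?enum_uniq.
- move=> A b MA; exists (free_hom (b \o @generator O S m)); first exact: hom_free_hom.
  by move=> _ /mapP [x _ ->]; rewrite free_hom_gen.
- move=> A f g MA hf hg fg; apply: hom_gen_eq => // x.
  by apply: fg; rewrite map_f ?mem_enum.
Qed.

(** A model with two elements is what separates the elements of a basis from
    the children of the others. *)
Definition nontrivial : Prop :=
  exists A : omega_algebra O, models A /\ exists o a : A, o <> a.

(** Prescribing values on the children of [y] amounts to prescribing on [y] the
    lambda of these values. *)
Lemma basis_step V (s1 s2 : seq V) y i : nontrivial -> models V ->
  basis (s1 ++ y :: s2) -> basis (s1 ++ children i y ++ s2).
Proof.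
move=> [N [MN [o [a oa]]]] MV [].
rewrite -cat1s uniq_catCA cat1s /= => /andP [yN u12] ext gen.
(* Homomorphisms that single out one child, for distinctness. *)
have sep (j : 'I_(arity i)) : exists f : V -> N,
    [/\ hom f, forall z, z \in s1 ++ s2 -> f z = o, f (alpha j y) = a &
      forall k, k != j -> f (alpha k y) = o].
  have [f hf fE] := ext N (fun z => if z == y then
    lambda (fun k : 'I_(arity i) => if k == j then a else o) else o) MN.
  have fy := fE y; rewrite mem_cat mem_head orbT eqxx in fy.
  have [fa _] := hf; have [_ MN2 _] := MN.
  exists f; split=> // [z zs||k kj].
  - rewrite fE; last by move: zs; rewrite !mem_cat inE => /orP [->//|->]; rewrite !orbT.
    by case: eqP => // zy; rewrite -zy zs in yN.
  - by rewrite fa fy // MN2 eqxx.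
  - by rewrite fa fy // MN2 (negbTE kj).
split.
- rewrite uniq_catCA cat_uniq u12 andbT; apply/andP; split.
    rewrite map_inj_uniq ?enum_uniq // => j k jk; apply/eqP; apply/negPn/negP => kj.
    have [f [_ _ fa fo]] := sep j; apply: oa; rewrite -fa jk fo //.
    by rewrite eq_sym.
  apply/hasPn => z zs; apply/negP => /= /mem_children [j zE].
  by have [f [_ fo fa _]] := sep j; apply: oa; rewrite -fa -zE fo.
- move=> A b MA; have [f hf fE] := ext A (fun z => if z == y then
    lambda (fun k : 'I_(arity i) => b (alpha k y)) else b z) MA.
  have fy := fE y; rewrite mem_cat mem_head orbT eqxx in fy.
  have [fa _] := hf; have [_ MA2 _] := MA.
  exists f => // z; rewrite !mem_cat orbCA => /orP [/mem_children [j ->]|zs].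
    by rewrite fa fy // MA2.
  rewrite fE; last by move: zs; rewrite !mem_cat inE => /orP [->//|->]; rewrite !orbT.
  by case: eqP => // zy; rewrite -zy mem_cat zs in yN.
- move=> A f g MA hf hg fg; apply: gen => // z.
  rewrite mem_cat inE => /or3P [zs|/eqP ->|zs]; try by apply: fg; rewrite !mem_cat zs ?orbT.
  apply: (@alpha_inj _ i) => // j.
  have [fa _] := hf; have [ga _] := hg.
  by rewrite -fa -ga fg // !mem_cat alpha_children orbT.
Qed.

Lemma basis_pexp V (s t : seq V) : nontrivial -> models V ->
  pexp s t -> basis s -> basis t.
Proof.
by move=> NT MV; elim=> // s1 s2 y i _ IH /IH; exact: basis_step.
Qed.

Lemma basis_rot V n (s : seq V) : basis s -> basis (rot n s).
Proof.
move=> [u ext gen]; split; first by rewrite rot_uniq.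
  move=> A b MA; have [f hf fE] := ext A b MA; exists f => // z.
  by rewrite mem_rot; exact: fE.
move=> A f g MA hf hg fg; apply: gen => // z zs; apply: fg.
by rewrite mem_rot.
Qed.

Lemma split_at (T : eqType) (s : seq T) z : z \in s ->
  exists s1 s2, s = s1 ++ z :: s2.
Proof. by case/splitPr => s1 s2; exists s1, s2. Qed.

(** Expanding along the path from [y] to [z] never touches [x]. *)
Lemma basis_desc V (s : seq V) y : nontrivial -> models V -> basis s ->
  y \in s -> forall z, descendant y z ->
  forall x, x \in s -> x != y ->
  exists t, [/\ basis t, z \in t, x \in t & z != x].
Proof.
move=> NT MV bs ys z; elim=> [|v i j yv IH] x xs xy.
  by exists s; rewrite eq_sym.
have [t [bt vt xt vx]] := IH x xs xy.
have [t1 [t2 tE]] := split_at vt; subst t.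
exists (t1 ++ children i v ++ t2).
have bt' := basis_step i NT MV bt.
have xt' : x \in t1 ++ t2.
  by move: xt; rewrite !mem_cat inE eq_sym (negbTE vx).
split=> //.
- by rewrite !mem_cat alpha_children orbT.
- by move: xt'; rewrite !mem_cat => /orP [->//|->]; rewrite !orbT.
- apply/eqP => E; have [] := bt'; rewrite uniq_catCA cat_uniq.
  case/and3P=> _ /hasPn /(_ x xt') /negP []; rewrite /= -E.
  exact: alpha_children.
Qed.

(** Distinct elements of a basis generate disjoint trees: expand first along
    one path, then along the other, and use that bases have no repetitions. *)
Lemma desc_disjoint V (s : seq V) x y z w : nontrivial -> models V -> basis s ->
  x \in s -> y \in s -> x != y -> descendant x z -> descendant y w -> z != w.
Proof.
move=> NT MV bs xs ys xy xz yw.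
have [t [bt wt xt wx]] := basis_desc NT MV bs ys yw xs xy.
have [|t' [_ _ _ //]] := basis_desc NT MV bt xt xz wt.
by [].
Qed.

(** The first entry of [t] serves as default value, hence the nonempty bases. *)
Lemma basis_hom V V' (s : seq V) (t : seq V') : models V' -> basis s ->
  0 < size s -> size s = size t -> exists2 f : V -> V', hom f & map f s = t.
Proof.
move=> MV' [us ext _]; case: t => [|t0 t]; first by move=> + s0; rewrite s0.
move=> _ st; have [f hf fE] := ext V' (fun z => nth t0 (t0 :: t) (index z s)) MV'.
exists f => //; apply: (@eq_from_nth _ t0); rewrite size_map // => k ks.
have [z0 _] : exists z, z \in s by case: (s) ks => // z ? _; exists z; rewrite mem_head.
by rewrite (nth_map z0) // fE ?mem_nth // index_uniq.
Qed.

Lemma basis_hom_eq V V' (s : seq V) (f g : V -> V') : models V' -> basis s ->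
  hom f -> hom g -> map f s = map g s -> f =1 g.
Proof. by move=> MV' [_ _ gen] hf hg /eq_in_map; exact: gen. Qed.

Lemma basis_iso V V' (s : seq V) (t : seq V') : models V -> models V' ->
  basis s -> basis t -> 0 < size s -> size s = size t ->
  exists (f : V -> V') (g : V' -> V),
    [/\ hom f, hom g, cancel f g, cancel g f & map f s = t].
Proof.
move=> MV MV' bs bt s0 st.
have [f hf fs] := basis_hom MV' bs s0 st.
have [g hg gt] : exists2 g : V' -> V, hom g & map g t = s.
  by apply: basis_hom => //; rewrite -st.
exists f, g; split=> //.
- apply: (basis_hom_eq MV bs (hom_comp hg hf) (hom_id V)).
  by rewrite map_comp fs gt map_id.
- apply: (basis_hom_eq MV' bt (hom_comp hf hg) (hom_id V')).
  by rewrite map_comp gt fs map_id.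
Qed.

Lemma basis_aut V (s t : seq V) : models V -> basis s -> basis t ->
  0 < size s -> size s = size t -> exists g : automorphism V, map g s = t.
Proof.
move=> MV bs bt s0 st.
have [f [g [hf hg fK gK fs]]] := basis_iso MV MV bs bt s0 st.
by exists (Automorphism fK gK hf).
Qed.

Lemma basis_aut_eq V (s : seq V) (g h : automorphism V) : models V -> basis s ->
  map g s = map h s -> g = h.
Proof.
move=> MV bs E; apply: automorphism_eq.
exact: basis_hom_eq MV bs (hom_aut g) (hom_aut h) E.
Qed.

End Models.

(** * The twisted algebra and the order of expansions *)

Section Lex.
Variables (n : nat) (m : 'I_n -> nat).
Implicit Types p q : {j : 'I_n & 'I_(m j)}.

Lemma lex_irr p : lex_lt p p = false.
Proof. by rewrite /lex_lt !ltnn andbF. Qed.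

Lemma lex_asym p q : lex_lt p q -> lex_lt q p = false.
Proof.
rewrite /lex_lt -!(inj_eq val_inj) /=; case: p q => [j k] [j' k'] /=.
by case: (ltngtP j j') => //= _; case: ltngtP.
Qed.

Lemma lex_total p q : lex_lt p q || (p == q) || lex_lt q p.
Proof.
case: p q => [j k] [j' k']; rewrite /lex_lt -!(inj_eq val_inj) /=.
have [lt|lt|/val_inj E] := ltngtP j j'; rewrite ?orbT //=; subst j'.
have [lt|lt|/val_inj E] := ltngtP k k'; rewrite ?orbT //; subst k'.
by rewrite eqxx.
Qed.

End Lex.

(** A homomorphism between total orders reflects the order. *)
Lemma lex_mono n (m : 'I_n -> nat) n' (m' : 'I_n' -> nat)
    (f : {j : 'I_n & 'I_(m j)} -> {j : 'I_n' & 'I_(m' j)}) :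
  {homo f : p q / lex_lt p q} -> {mono f : p q / lex_lt p q}.
Proof.
move=> fh p q; apply/idP/idP; last exact: fh.
have /orP [/orP [//|/eqP ->]|/fh qp pq] := lex_total p q.
  by rewrite !lex_irr.
by rewrite (lex_asym qp) in pq.
Qed.

Lemma big_enum_prefix n (F : 'I_n -> bool) (k1 k2 : seq 'I_n) (j : 'I_n) :
  enum 'I_n = k1 ++ j :: k2 ->
  \big[addb/false]_(k <- k1) F k = \big[addb/false]_(k < n | k < j) F k.
Proof.
move=> E; have := val_enum_ord n; rewrite E map_cat /= => vE.
have jE : size k1 = j.
  have := congr1 (nth 0 ^~ (size k1)) vE.
  rewrite nth_cat size_map ltnn subnn /= nth_iota //.
  by rewrite -[X in _ < X](size_enum_ord n) E size_cat /= -addSnnS leq_addr.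
have v1 : map val k1 = iota 0 j.
  have := congr1 (take j) vE; rewrite take_size_cat ?size_map // => ->.
  by rewrite take_iota; congr iota; apply/minn_idPl; rewrite ltnW.
have v2 : map val (j :: k2) = iota j (n - j).
  have := congr1 (drop j) vE; rewrite drop_size_cat ?size_map //= => ->.
  by rewrite drop_iota add0n.
have <- : \big[addb/false]_(k <- enum 'I_n | k < j) F k = \big[addb/false]_(k < n | k < j) F k.
  by rewrite big_enum_cond.
rewrite E big_cat /= [X in _ = X (+) _]big_seq_cond.
rewrite [X in _ = _ (+) X]big_seq_cond [X in _ = _ (+) X]big1 ?addbF; last first.
  move=> k /andP [/(map_f val)]; rewrite v2 mem_iota /= => /andP [jk _] kj.
  by rewrite ltnNge jk in kj.
rewrite big_seq; apply: eq_bigl => k; case kk: (k \in k1) => //=.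
by have := map_f val kk; rewrite v1 mem_iota add0n /= => ->.
Qed.

Lemma eq_of_index (T : eqType) (s t : seq T) : uniq s -> uniq t -> s =i t ->
  (forall x y, x \in s -> y \in s -> index y s < index x s -> index y t < index x t) ->
  s = t.
Proof.
move=> us ut st lt.
apply: (@irr_sorted_eq _ [rel x y | index x t < index y t]).
- by move=> y x z /=; apply: ltn_trans.
- by move=> x /=; rewrite ltnn.
- case sE: s => [|x0 s'] //; rewrite -sE; apply/(sortedP x0) => i i_s /=.
  have i_s' := ltnW i_s.
  by apply: lt; rewrite ?mem_nth ?index_uniq.
- case tE: t => [|x0 t'] //; rewrite -tE; apply/(sortedP x0) => i i_s /=.
  have i_s' := ltnW i_s.
  by rewrite !index_uniq.
- exact: st.
Qed.

Section Twist.
Variables (O : signature) (S : laws O).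
Hypothesis ordS : order_preserving S.
Variables (A B : omega_algebra O) (MA : models S A) (MB : models S B).
Variable charge : A -> bool.
Hypothesis chargeD : forall (i : 'I_(ncolours O)) u,
  charge u = \big[addb/false]_(j < arity i) charge (alpha j u).

Definition swap_if (T : Type) (c : bool) (p : T * T) : T * T :=
  if c then (p.2, p.1) else p.

Lemma swap_ifD T c c' (p : T * T) :
  swap_if c (swap_if c' p) = swap_if (c (+) c') p.
Proof. by case: p => x y; case: c; case: c'. Qed.

Definition left_charge n (c : 'I_n -> bool) (j : 'I_n) : bool :=
  \big[addb/false]_(k < n | k < j) c k.

Definition twisted_alpha (i : 'I_(ncolours O)) (j : 'I_(arity i))
    (u : A * (B * B)) : A * (B * B) :=
  (alpha j u.1, swap_if (left_charge (fun k => charge (alpha k u.1)) j)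
                  (alpha j u.2.1, alpha j u.2.2)).

(** The exchanges only depend on the charges of the arguments, which they do not
    affect, so they can be undone. *)
Definition twisted_lambda (i : 'I_(ncolours O))
    (a : 'I_(arity i) -> A * (B * B)) : A * (B * B) :=
  let b j := swap_if (left_charge (fun k => charge (a k).1) j) (a j).2 in
  (lambda (fun j => (a j).1),
   (lambda (fun j => (b j).1), lambda (fun j => (b j).2))).

Definition twisted : omega_algebra O :=
  @OmegaAlgebra O (A * (B * B))%type twisted_alpha twisted_lambda.

(** The words preceding [nu] lexicographically are those starting to the left
    of the first letter of [nu], whose charge is collected by additivity, and
    those with the same first letter and a smaller second one. *)
Lemma charge_lex (i : 'I_(ncolours O)) (c : 'I_(arity i) -> 'I_(ncolours O))
    (u : A) (nu : {j : 'I_(arity i) & 'I_(arity (c j))}) :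
  left_charge (fun k => charge (alpha k (alpha (tag nu) u))) (tagged nu) (+)
    left_charge (fun k => charge (alpha k u)) (tag nu) =
  \big[addb/false]_(mu : {j : 'I_(arity i) & 'I_(arity (c j))} | lex_lt mu nu)
    charge (alpha (tagged mu) (alpha (tag mu) u)).
Proof.
case: nu => [j k]; rewrite /left_charge /=; pose J h : finType := 'I_(arity (c h)).
rewrite [RHS](bigID (fun mu : {h : 'I_(arity i) & 'I_(arity (c h))} => tag mu < j)) /= addbC; congr addb.
- under eq_bigr => h _ do rewrite (chargeD (c h)).
  rewrite (@sig_big_dep _ _ _ _ J (fun h => h < j) (fun _ => predT)) /=.
  apply: eq_bigl => mu; rewrite andbT /lex_lt /=.
  by case: ltnP; rewrite ?andbF.
- transitivity (\big[addb/false]_(h < arity i | h == j)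
     \big[addb/false]_(l < arity (c h) | l < k) charge (alpha l (alpha h u))).
    by rewrite big_pred1_eq.
  rewrite (@sig_big_dep _ _ _ _ J (pred1 j) (fun h => [pred l : J h | l < k])) /=.
  apply: eq_bigl => -[h l]; rewrite /lex_lt /=.
  rewrite -!(inj_eq val_inj) /=.
  by case: (ltngtP h j) => _; rewrite ?andbT ?andbF.
Qed.

(** Along a word of length two the exchanges add up to the total charge of the
    words on its left, by [charge_lex]; an order preserving bijection maps these
    words to the words on the left of the image, which have the same values. *)
Lemma models_twisted : models S twisted.
Proof.
have [MA1 MA2 MA3] := MA; have [MB1 MB2 MB3] := MB; split.
- move=> i [u [v w]] /=; rewrite /twisted_lambda /= MA1; congr (_, (_, _)).
    rewrite -[RHS](MB1 i); congr lambda; apply: funext => j.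
    by rewrite swap_ifD addbb.
  rewrite -[RHS](MB1 i); congr lambda; apply: funext => j.
  by rewrite swap_ifD addbb.
- move=> i a j /=; rewrite /twisted_lambda /twisted_alpha /= !MA2 !MB2.
  rewrite -surjective_pairing swap_ifD.
  rewrite (_ : (fun k => _) = (fun k => charge (a k).1)); last first.
    by apply: funext => k; rewrite MA2.
  by rewrite addbb -surjective_pairing.
- move=> i i' lt b Sb [u [v w]] nu /=; rewrite /twisted_alpha /=.
  have homswap (C : omega_algebra O) c (i0 : 'I_(ncolours O)) (j : 'I_(arity i0)) (p : C * C) :
      (alpha j (swap_if c p).1, alpha j (swap_if c p).2) =
      swap_if c (alpha j p.1, alpha j p.2).
    by case: p => ? ?; case: c.
  rewrite !homswap !swap_ifD !charge_lex /= (MA3 _ _ _ _ Sb).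
  rewrite !(MB3 _ _ _ _ Sb); congr (_, swap_if _ _).
  rewrite [RHS](reindex (phi b)) /=; last exact/onW_bij/phi_bij.
  apply: eq_big => [mu|mu _]; last by rewrite (MA3 _ _ _ _ Sb).
  by rewrite (lex_mono (ordS Sb)).
Qed.

Section Evaluation.
Variables (V : omega_algebra O) (e1 : V -> A) (e2 e3 : V -> B).
Hypotheses (h1 : hom e1) (h2 : hom e2) (h3 : hom e3).

Definition seq_charge (s : seq V) := \big[addb/false]_(w <- s) charge (e1 w).

(** The values in the twisted algebra of an ordered basis: the charge on the left
    of each entry tells whether the two copies of [B] are exchanged. *)
Definition twisted_on (s : seq V) (e : V -> A * (B * B)) :=
  forall s1 z s2, s = s1 ++ z :: s2 ->
    e z = (e1 z, swap_if (seq_charge s1) (e2 z, e3 z)).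

(** The children of [y] have together the charge of [y], so entries to the right
    of [y] see no change; a child of [y] sees the entries to the left of [y] and
    its own left siblings. *)
Lemma twisted_on_pexp (s t : seq V) (e : V -> twisted) : hom e ->
  twisted_on s e -> pexp s t -> twisted_on t e.
Proof.
move=> [ea _] se; elim=> // t1 t2 y i _ IH s1 z s2 E.
have yE := IH _ _ _ erefl.
have [e1a _] := h1; have [e2a _] := h2; have [e3a _] := h3.
have chE : seq_charge (children i y) = charge (e1 y).
  rewrite /seq_charge big_map big_enum /= (chargeD i (e1 y)).
  by apply: eq_bigr => j _; rewrite e1a.
have [[c [t1E _]]|[c [s1E cE]]] := cat_cons_split (esym E).
  apply: (IH _ _ (c ++ y :: t2)); by rewrite t1E -catA.
have [[c' [chE' _]]|[c' [cE' t2E]]] := cat_cons_split (esym cE); last first.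
  rewrite (IH (t1 ++ y :: c') z s2) ?t2E -?catA //; congr (_, swap_if _ _).
  by rewrite s1E cE' /seq_charge !big_cat big_cons /=
    -[X in _ = _ (+) (X (+) _)]/(seq_charge (children i y)) chE.
have [k1 [j [k2 [enumE cE' zE _]]]] := map_cat_cons chE'.
rewrite s1E zE ea yE /= /twisted_alpha /= e1a e2a e3a; congr (_, _).
have -> : (alpha j (swap_if (seq_charge t1) (e2 y, e3 y)).1,
    alpha j (swap_if (seq_charge t1) (e2 y, e3 y)).2) =
    swap_if (seq_charge t1) (alpha j (e2 y), alpha j (e3 y)).
  by case: (seq_charge t1).
rewrite swap_ifD; congr swap_if; rewrite /seq_charge big_cat /= addbC; congr addb.
rewrite cE' big_map /left_charge -(big_enum_prefix _ enumE).
by apply: eq_bigr => k _; rewrite e1a.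
Qed.

End Evaluation.

(** Give charge to the single entry [w] and distinct values in the two copies of
    [B]: the value of [z] in the twisted algebra then says whether [w] precedes
    [z], and it does not depend on the expansion through which [z] is reached. *)
Lemma order_unique_of_charge (V : omega_algebra O) (s t t' : seq V) :
  nontrivial S -> models S V -> basis S s -> pexp s t -> pexp s t' -> t =i t' ->
  (exists o a : A, charge o = false /\ charge a) -> (exists b b' : B, b <> b') ->
  t = t'.
Proof.
move=> NT MV bs st st' tt' [o [a [oF aT]]] [b [b' bb']].
have bt := basis_pexp NT MV st bs; have bt' := basis_pexp NT MV st' bs.
have [ut ext _] := bt; have [ut' _ _] := bt'; have [us exts _] := bs.
apply: eq_of_index => // z w zt wt lt.
have [e1 h1 e1E] := ext A (fun v => if v == w then a else o) MA.
have [e2 h2 e2E] := ext B (fun v => b) MB.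
have [e3 h3 e3E] := ext B (fun v => b') MB.
have [e he eE] := exts twisted (fun v =>
  (e1 v, swap_if (seq_charge e1 (take (index v s) s)) (e2 v, e3 v))) models_twisted.
have on_s : twisted_on e1 e2 e3 s e.
  move=> s1 v s2 sE; rewrite eE; last by rewrite sE mem_cat mem_head orbT.
  rewrite sE index_cat; move: us; rewrite sE cat_uniq => /and3P [_ /hasPn /(_ v (mem_head _ _)) /= vs1 _].
  by rewrite (negbTE vs1) /= eqxx addn0 take_size_cat.
have chE u1 : uniq u1 -> {subset u1 <= t} -> seq_charge e1 u1 = (w \in u1).
  rewrite /seq_charge; elim: u1 => [|v u1 IH] /=; first by rewrite big_nil.
  move=> /andP [vu1 u1u] sub; rewrite big_cons IH //; last first.
    by move=> x xu; apply: sub; rewrite inE xu orbT.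
  rewrite e1E ?sub ?mem_head // inE eq_sym; case: eqP => [wv|_].
    by rewrite aT wv (negbTE vu1).
  by rewrite oF.
have sgn u1 u2 : uniq (u1 ++ z :: u2) -> {subset u1 <= t} ->
    twisted_on e1 e2 e3 (u1 ++ z :: u2) e ->
    (e z).2 = swap_if (w \in u1) (b, b').
  move=> u sub on; rewrite (on _ _ _ erefl) chE //; last by move: u; rewrite cat_uniq => /andP [].
  by rewrite e2E ?e3E.
have idx u1 u2 : uniq (u1 ++ z :: u2) -> w \in u1 ++ z :: u2 ->
    (index w (u1 ++ z :: u2) < index z (u1 ++ z :: u2)) = (w \in u1).
  rewrite cat_uniq !index_cat => /and3P [_ /hasPn /(_ z (mem_head _ _)) /= zu _] _.
  rewrite (negbTE zu) /= eqxx addn0; case: ifP; first by rewrite index_mem.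
  by rewrite ltnNge leq_addr.
have zt' : z \in t' by rewrite -tt'.
have wt' : w \in t' by rewrite -tt'.
have [t1 [t2 tE]] := split_at zt; have [t1' [t2' tE']] := split_at zt'.
have sub1 : {subset t1 <= t} by move=> x; rewrite tE mem_cat => ->.
have sub1' : {subset t1' <= t} by move=> x xt; rewrite tt' tE' mem_cat xt.
have on_t := twisted_on_pexp h1 h2 h3 he on_s st.
have on_t' := twisted_on_pexp h1 h2 h3 he on_s st'.
rewrite tE in ut on_t wt lt; rewrite tE' in ut' on_t' wt' *.
rewrite idx // in lt; rewrite idx //.
have := sgn _ _ ut sub1 on_t; rewrite (sgn _ _ ut' sub1' on_t') lt.
case: (w \in t1') => //= -[E _]; by case: bb'.
Qed.

End Twist.

(** * Validity, boundedness and common expansions *)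

Lemma surj_ord_inj m (h : 'I_m -> 'I_m) : (forall y, exists x, h x = y) -> injective h.
Proof.
move=> hs; have [k hk] := choice hs.
by apply: (can_inj (g := k)); apply: canF_sym.
Qed.

Section Valid.
Variables (O : signature) (S : laws O).

(** The bijection granted by validity induces a surjection of the finite set of
    generators onto itself, which identifies generators that are equal in the
    quotient. *)
Lemma valid_generator_inj m : valid S m -> injective (@generator O S m).
Proof.
move=> /(_ _ (adm_start _))/card_bijP [f [g fK gK]] x y xy.
have inA z : (Gen z : free_algebra O 'I_m) \in free_generators (O := O) (r := m).
  by apply/mem_set; exists z.
have inB z : generator S z \in (@cantor_proj O S m @` free_generators (O := O) (r := m))%classic.
  by apply/mem_set; exists (Gen z) => //; exists z.
pose h (z : 'I_m) := if val (g (exist _ (generator S z) (inB z))) is Gen z' then z' else z.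
have hE z : exists z', val (g (exist _ (generator S z) (inB z))) = Gen z'.
  by case: (g _) => /= v /set_mem [z' _ <-]; exists z'.
have : injective h.
  apply: surj_ord_inj => z.
  have [_ [z1 _ <-] z1E] := set_mem (valP (f (exist _ (Gen z) (inA z)))).
  exists z1; rewrite /h.
  have -> : exist _ (generator S z1) (inB z1) = f (exist _ (Gen z) (inA z)).
    exact: val_inj.
  by rewrite fK.
apply; rewrite /h.
suff -> : exist _ (generator S x) (inB x) = exist _ (generator S y) (inB y) :> set_type _.
  by case: (hE y) => z ->.
exact: val_inj.
Qed.

Lemma valid_nontrivial : valid S 2 -> nontrivial S.
Proof.
move=> /valid_generator_inj gI; exists (cantor S 2).
split; first exact: models_cantor.
by exists (generator S ord0), (generator S ord_max) => /gI.
Qed.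

Section Sets.
Variables (V : omega_algebra O).
Hypotheses (MV : models S V) (NT : nontrivial S).

Lemma set_step (s1 s2 : seq V) y i : uniq (s1 ++ y :: s2) ->
  [set` s1 ++ children i y ++ s2]%classic =
  ([set` (s1 ++ y :: s2)] `\ y `|` range (fun j : 'I_(arity i) => alpha j y))%classic.
Proof.
rewrite -cat1s uniq_catCA cat1s /= => /andP [yn _].
apply/seteqP; split=> z /=; rewrite !mem_cat.
- case/or3P=> [zs|/mem_children [j ->]|zs]; [left|by right; exists j|left].
    by split=> [/=|/= zy]; [rewrite zs | rewrite -zy mem_cat zs in yn].
  split=> [/=|/= zy]; first by rewrite inE zs !orbT.
  by rewrite -zy mem_cat zs orbT in yn.
- case=> [[]|[j _ <-]]; last by rewrite alpha_children orbT.
  by rewrite inE => /or3P [->|/eqP ->|->] //; rewrite !orbT.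
Qed.

Lemma expansion_seq (s : seq V) Z : basis S s -> expansion [set` s]%classic Z ->
  exists2 t, pexp s t & Z = [set` t]%classic.
Proof.
move=> [us _ _] [i [y [/= ys ->]]]; have [s1 [s2 sE]] := split_at ys; subst s.
by exists (s1 ++ children i y ++ s2); [exact: pexp1 | rewrite set_step].
Qed.

Lemma adm_le_pexp (s : seq V) Z : basis S s -> adm_le [set` s]%classic Z ->
  exists2 t, pexp s t & Z = [set` t]%classic.
Proof.
move=> bs; elim=> [|Z1 Z2 _ [t st ->]]; first by exists s => //; exact: ord_start.
move/(expansion_seq (basis_pexp NT MV st bs)) => [u tu ->].
by exists u => //; exact: pexp_trans tu.
Qed.

Lemma pexp_adm_le (s t : seq V) : basis S s -> pexp s t ->
  adm_le [set` s]%classic [set` t]%classic.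
Proof.
move=> bs; elim=> [|s1 s2 y i st IH]; first exact: adm_le_refl.
have [u _ _] := basis_pexp NT MV st bs.
apply: adm_le_step IH _; exists i, y; split; first by rewrite /= mem_cat mem_head orbT.
exact: set_step.
Qed.

Lemma adm_le_admissible (X : set V) Y Z : admissible_from X Y -> adm_le Y Z ->
  admissible_from X Z.
Proof. by move=> XY; elim=> // Z1 Z2 _ IH; exact: adm_expansion. Qed.

End Sets.

Lemma generators_set m : [set` generators S m]%classic = range (@generator O S m).
Proof.
apply/seteqP; split=> z /=; first by case/mapP=> x _ ->; exists x.
by case=> x _ <-; rewrite map_f ?mem_enum.
Qed.

Lemma basis_gen m : valid S m -> basis S (generators S m).
Proof. by move=> vm; exact/basis_generators/valid_generator_inj. Qed.

Lemma basis_OA m (s : seq (cantor S m)) : nontrivial S -> valid S m ->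
  ordered_admissible s -> basis S s.
Proof.
move=> NT vm os; apply: basis_pexp NT (models_cantor S m) os _.
exact: basis_gen.
Qed.

Lemma admissible_OA m (s : seq (cantor S m)) : nontrivial S -> valid S m ->
  ordered_admissible s -> admissible [set` s]%classic.
Proof.
move=> NT vm os; apply: adm_le_admissible (adm_start _) _.
rewrite -generators_set; apply: pexp_adm_le os => //; first exact: models_cantor.
exact: basis_gen.
Qed.

(** At this stage the two sequences are only known to have the same entries. *)
Lemma lub_OA m (s t : seq (cantor S m)) : nontrivial S -> valid S m -> bounded S m ->
  ordered_admissible s -> ordered_admissible t ->
  exists u u', [/\ pexp s u, pexp t u', u =i u' &
    is_lub [set` s]%classic [set` t]%classic [set` u]%classic].
Proof.
move=> NT vm bm os ot.
have [bs bt] := (basis_OA NT vm os, basis_OA NT vm ot).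
have bg := basis_gen vm; have MV := models_cantor S m.
have [|T [[aT sT tT lT] _]] := bm _ _ (admissible_OA NT vm os) (admissible_OA NT vm ot).
  exists [set` generators S m]%classic; split.
  - by rewrite generators_set; exact: adm_start.
  - exact: pexp_adm_le os.
  - exact: pexp_adm_le ot.
have [u su uE] := adm_le_pexp MV NT bs sT.
have [u' tu' u'E] := adm_le_pexp MV NT bt tT.
exists u, u'; split=> //; last by rewrite -uE; split.
move=> z; have : [set` u]%classic z = [set` u']%classic z by rewrite -uE u'E.
by move=> /= zE; apply/idP/idP; rewrite zE.
Qed.

End Valid.

(** * The charged algebra of finite sets of boundary points *)

Section FiniteSets.
Local Open Scope fset_scope.
Variables (O : signature) (S : laws O) (P : choiceType).
Variable beta : forall i : 'I_(ncolours O), 'I_(arity i) -> P -> P.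
Hypothesis beta_surj : forall i p, exists j q, p = @beta i j q.
Hypothesis beta_inj : forall i (j j' : 'I_(arity i)) q q',
  beta j q = beta j' q' -> j = j' /\ q = q'.
Hypothesis beta_laws : forall (i i' : 'I_(ncolours O)) (lt : (i < i')%N) b,
  S lt = Some b -> forall q nu,
  beta (tag nu) (beta (tagged nu) q) =
  beta (tag (phi b nu)) (beta (tagged (phi b nu)) q).

(** The decomposition of a boundary point by colour [i]: its first letter and what
    remains. *)
Definition tail (i : 'I_(ncolours O)) (p : P) : 'I_(arity i) * P :=
  let: exist j H := cid (beta_surj i p) in (j, sval (cid H)).

Lemma tailE i p : p = @beta i (tail i p).1 (tail i p).2.
Proof. by rewrite /tail; case: cid => j H /=; case: cid. Qed.

Lemma tail_beta i j q : tail i (@beta i j q) = (j, q).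
Proof.
by have /beta_inj [E1 E2] := tailE i (beta j q); rewrite [LHS]surjective_pairing -E1 -E2.
Qed.

Definition fset_alpha (i : 'I_(ncolours O)) (j : 'I_(arity i)) (F : {fset P}) :=
  [fset (tail i p).2 | p in [fset p in F | (tail i p).1 == j]].

Lemma in_fset_alpha (i : 'I_(ncolours O)) (j : 'I_(arity i)) F q :
  (q \in fset_alpha j F) = (beta j q \in F).
Proof.
apply/imfsetP/idP => /=.
  by case=> p; rewrite !inE => /andP [pF /eqP <-] ->; rewrite -tailE.
by move=> bF; exists (beta j q); rewrite ?inE ?tail_beta ?bF ?eqxx.
Qed.

Definition fset_lambda (i : 'I_(ncolours O)) (a : 'I_(arity i) -> {fset P}) :=
  \bigcup_(j <- enum 'I_(arity i)) [fset beta j q | q in a j].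

Lemma in_fset_lambda (i : 'I_(ncolours O)) (a : 'I_(arity i) -> {fset P}) p :
  (p \in fset_lambda a) = ((tail i p).2 \in a (tail i p).1).
Proof.
apply/bigfcupP/idP.
  by case=> j _ /imfsetP [q /= qa ->]; rewrite tail_beta.
move=> pa; exists (tail i p).1; first by rewrite mem_enum.
by apply/imfsetP; exists (tail i p).2 => //; exact: tailE.
Qed.

Definition finite_sets : omega_algebra O :=
  @OmegaAlgebra O {fset P} fset_alpha fset_lambda.

Lemma models_finite_sets : models S finite_sets.
Proof.
split.
- by move=> i u; apply/fsetP => p; rewrite in_fset_lambda in_fset_alpha -tailE.
- by move=> i a j; apply/fsetP => q; rewrite in_fset_alpha in_fset_lambda tail_beta.
- move=> i i' lt b Sb u nu; apply/fsetP => q.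
  by rewrite !in_fset_alpha (beta_laws Sb).
Qed.

(** The tails of the points of [F] starting with [j] form the [j]-th child. *)
Lemma parity_finite_sets (i : 'I_(ncolours O)) (F : finite_sets) :
  odd #|` F| = \big[addb/false]_(j < arity i) odd #|` fset_alpha j F|.
Proof.
have -> : #|` F| = \sum_(j < arity i) #|` fset_alpha j F|.
  rewrite card_fset_sum1.
  transitivity (\sum_(p <- F) \sum_(j < arity i) ((tail i p).1 == j : nat)).
    apply: eq_bigr => p _; rewrite (bigD1 (tail i p).1) //= eqxx big1 // => j.
    by rewrite eq_sym => /negbTE ->.
  rewrite exchange_big /=; apply: eq_bigr => j _.
  have -> : #|` fset_alpha j F| = #|` [fset p in F | (tail i p).1 == j]|.
    apply: card_in_imfset => p p'; rewrite !inE /= => /andP [_ /eqP E] /andP [_ /eqP E'] Ep.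
    by rewrite (tailE i p) (tailE i p') Ep E E'.
  rewrite card_fset_sum1 -(@big_fset_condE _ _ _ _ F) [RHS]big_mkcond /=.
  by apply: eq_bigr => p _; case: eqP.
by apply: (big_morph odd oddD).
Qed.

End FiniteSets.

Section Points.
Variables (O : signature) (S : laws O).
Hypotheses (NT : nontrivial S) (v1 : valid S 1) (b1 : bounded S 1).
Local Notation U := (cantor S 1).

Let MU : models S U := models_cantor S 1.
Let x : U := generator S ord0.
Implicit Types u v w z : U.

Lemma generators1 : generators S 1 = [:: x].
Proof.
rewrite /generators; have : size (enum 'I_1) = 1 by rewrite size_enum_ord.
by case: (enum _) => [//|k [|//]] _ /=; rewrite (ord1 k).
Qed.

Lemma desc_pexp z : descendant x z ->
  exists s1 s2, ordered_admissible (s1 ++ z :: s2).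
Proof.
elim=> [|v i j _ [s1 [s2 os]]].
  by exists [::], [::]; rewrite -generators1; exact: ord_start.
have [c1 [c2 cE]] := split_at (alpha_children v j).
exists (s1 ++ c1), (c2 ++ s2); rewrite -catA -cat_cons (catA c1) -cE.
exact: ord_step.
Qed.

(** A common expansion of a sequence through [z] and of the children of the
    generator exists by boundedness; take its part below [z]. *)
Lemma refine_generator z k : descendant x z ->
  exists2 t, pexp [:: z] t &
    forall w, w \in t -> exists h : 'I_(arity k), descendant (alpha h x) w.
Proof.
move=> /desc_pexp [s1 [s2 os]].
have ox : ordered_admissible (children k x).
  rewrite -[children k x]cats0 /ordered_admissible -/(generators S 1) generators1.
  exact: (pexp1 [::] [::]).
have [u [u' [su xu uu _]]] := lub_OA NT v1 b1 os ox.
have [a [c [uE _ zc]]] := pexp_cat_inv su.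
have [b [d [cE zb _]]] := @pexp_cat_inv _ _ [:: z] _ _ zc.
exists b => // w wb; have : w \in u' by rewrite -uu uE cE !mem_cat wb orbT.
by move=> /(pexp_desc xu) [_ /mem_children [h ->] hw]; exists h.
Qed.

(** The endomorphism moving the generator to [u], that is, the tree below the
    generator to the tree below [u]. *)
Definition shift (u : U) : U -> U := free_hom (fun _ : 'I_1 => u).

Lemma hom_shift u : hom (shift u). Proof. exact: hom_free_hom. Qed.

Lemma shift_gen u : shift u x = u. Proof. exact: free_hom_gen. Qed.

Lemma hom1_eq (f g : U -> U) : hom f -> hom g -> f x = g x -> f =1 g.
Proof. by move=> hf hg fg; apply: hom_gen_eq => // k; rewrite (ord1 k). Qed.

Lemma desc_shift (u v : U) : descendant x v -> descendant u (shift u v).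
Proof. by move=> /(desc_hom (hom_shift u)); rewrite shift_gen. Qed.

Lemma refine (u z : U) k : descendant u z ->
  exists2 t, pexp [:: z] t &
    forall w, w \in t -> exists h : 'I_(arity k), descendant (alpha h u) w.
Proof.
rewrite -{1}(shift_gen u) => /(desc_im (hom_shift u)) [z' xz ->].
have [t zt tP] := refine_generator k xz.
exists (map (shift u) t); first exact: (pexp_map (hom_shift u) zt).
move=> _ /mapP [w /tP [h hw] ->]; exists h.
have [sa _] := hom_shift u.
by rewrite -[X in alpha h X](shift_gen u) -sa; exact: desc_hom (hom_shift u) hw.
Qed.

(** A boundary point of U_1, given by the set of nodes above it: upward closed,
    directed, and passing through a child of each of its nodes for every
    colour. *)
Definition ideal_point (p : set U) : Prop :=
  [/\ p x, forall u, p u -> descendant x u,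
      forall u (i : 'I_(ncolours O)) (j : 'I_(arity i)),
        descendant x u -> p (alpha j u) -> p u,
      forall u i, p u -> exists j : 'I_(arity i), p (alpha j u) &
      forall u v, p u -> p v -> exists w, [/\ p w, descendant u w & descendant v w]].

Lemma ideal_point_up p u v : ideal_point p -> descendant x u -> descendant u v -> p v -> p u.
Proof.
move=> [_ _ up _ _] xu; elim=> // w i j uw IH pw; apply/IH/(up _ i j) => //.
exact: desc_trans uw.
Qed.

Lemma down_pexp (p : set U) s t :
  (forall u i, p u -> exists j : 'I_(arity i), p (alpha j u)) ->
  pexp s t -> (exists2 u, u \in s & p u) -> exists2 w, w \in t & p w.
Proof.
move=> down st su; elim: st => // s1 s2 y i _ [u].
rewrite mem_cat inE => /or3P [us|/eqP ->|us] pu.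
- by exists u; rewrite // mem_cat us.
- have [j pj] := down _ i pu.
  by exists (alpha j y) => //; rewrite !mem_cat -/(children i y) alpha_children orbT.
- by exists u; rewrite // !mem_cat us !orbT.
Qed.

(** Finite subsets have a common descendant: the finite intersection property of
    the corresponding cones. *)
Definition centred (F : set U) : Prop :=
  (forall u, F u -> descendant x u) /\
  forall l : seq U, (forall u, u \in l -> F u) ->
    exists2 w, descendant x w & forall u, u \in l -> descendant u w.

Lemma maximal_centred : exists M, centred M /\
  forall F : set U, centred F -> (M `<=` F)%classic -> (F `<=` M)%classic.
Proof.
have [|M [cM maxM]] := @Zorn_bigcup U centred.
  move=> C CP totC; split; first by move=> u [F CF Fu]; have [H _] := CP _ CF; exact: H.
  move=> l lC.
  have [->|[F CF Fl]] : l = [::] \/ exists2 F, C F & forall u, u \in l -> F u.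
  - elim: l lC => [|u l IH] lC; first by left.
    have [F CF Fu] := lC u (mem_head _ _); right.
    have [|l0|[F' CF' F'l]] := IH.
    + by move=> v vl; apply: lC; rewrite inE vl orbT.
    + by exists F => // v; rewrite l0 inE => /eqP ->.
    + have [FF'|F'F] := totC _ _ CF CF'.
        by exists F' => // v; rewrite inE => /orP [/eqP ->|/F'l //]; exact: FF'.
      by exists F => // v; rewrite inE => /orP [/eqP ->//|/F'l]; exact: F'F.
  - by exists x => //; exact: desc_refl.
  - have [_ H] := CP _ CF; exact: H.
exists M; split=> // F cF MF u Fu; apply: contrapT => Mu.
by apply: (maxM F) => //; split=> // FM; exact/Mu/FM.
Qed.

(** A maximal centred family is a point.  If no child of [u] for colour [i] could
    be added, finitely many members would have no common descendant with any of
    these children, although they have one together with [u], and that one can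
    be refined below the children.  Directedness comes from a common expansion
    of sequences through the two given nodes. *)
Lemma exists_point : exists p, ideal_point p.
Proof.
have [M [[Mx cM] maxM]] := maximal_centred; exists M.
(* Maximality: whatever is compatible with the family belongs to it. *)
have add u : descendant x u ->
    (forall l : seq U, (forall v, v \in l -> M v) ->
      exists2 w, descendant x w & (forall v, v \in l -> descendant v w) /\ descendant u w) ->
    M u.
  move=> xu H; apply: (maxM (M `|` [set u])%classic) => /=; last by right.
    split=> [v [/Mx//|->//]|l lM].
    have [|w xw [lw uw]] := H [seq v <- l | v != u].
      by move=> v; rewrite mem_filter => /andP [vu /lM [//|/eqP]]; rewrite (negbTE vu).
    exists w => // v vl; have [->//|vu] := eqVneq v u.
    by apply: lw; rewrite mem_filter vu.
  by move=> v; left.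
have Mdown u i : M u -> exists j : 'I_(arity i), M (alpha j u).
  move=> Mu; apply: contrapT => /forallNP noj.
  have /choice [l lP] : forall j : 'I_(arity i), exists l : seq U,
      (forall v, v \in l -> M v) /\
      forall w, descendant x w -> (forall v, v \in l -> descendant v w) ->
        ~ descendant (alpha j u) w.
    move=> j; apply: contrapT => /forallNP H; apply: (noj j); apply: add.
      exact/desc_alpha/Mx.
    move=> l lM; apply: contrapT => /forall2NP Hw; apply: (H l); split=> // w xw lw uw.
    by case: (Hw w) => //; apply.
  have [v|w xw lw] := cM (u :: flatten [seq l j | j <- enum 'I_(arity i)]).
    rewrite inE => /orP [/eqP ->//|/flattenP [_ /mapP [j _ ->] vl]].
    by have [H _] := lP j; exact: H.
  have uw : descendant u w by apply: lw; rewrite mem_head.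
  have [t wt tP] := refine i uw.
  have [w' w't] : exists w', w' \in t.
    have := pexp_size wt; case: (t) => // w' t' _; exists w'; exact: mem_head.
  have [h hw'] := tP _ w't; have [_ H] := lP h.
  have [a aw ww'] := pexp_desc wt w't; move: aw ww'; rewrite mem_seq1 => /eqP -> ww'.
  apply: (H w') => //; first exact: desc_trans ww'.
  move=> v vl; apply: desc_trans ww'; apply: lw; rewrite inE; apply/orP; right.
  by apply/flattenP; exists (l h) => //; rewrite map_f ?mem_enum.
have Mgen : M x.
  apply: add => [|l /cM [w xw lw]]; first exact: desc_refl.
  by exists w.
have Mup u (i : 'I_(ncolours O)) (j : 'I_(arity i)) : descendant x u -> M (alpha j u) -> M u.
  move=> xu Mj; apply: add => // l lM.
  have [v|w xw lw] := cM (alpha j u :: l).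
    by rewrite inE => /orP [/eqP ->//|/lM].
  exists w => //; split; first by move=> v vl; apply: lw; rewrite inE vl orbT.
  apply: (@desc_trans _ _ _ (alpha j u)); first exact/desc_alpha/desc_refl.
  by apply: lw; rewrite mem_head.
split=> // u v Mu Mv.
have [s1 [s2 os]] := desc_pexp (Mx _ Mu); have [s1' [s2' os']] := desc_pexp (Mx _ Mv).
have [t [t' [st st' tt' _]]] := lub_OA NT v1 b1 os os'.
have [|w wt Mw] := down_pexp Mdown (pexp_trans os st).
  by exists x => //; rewrite -/(generators S 1) generators1 mem_head.
have below a r1 r2 r : ordered_admissible (r1 ++ a :: r2) ->
    pexp (r1 ++ a :: r2) r -> w \in r -> M a -> descendant a w.
  move=> or rr wr Ma; have [a' a'r a'w] := pexp_desc rr wr.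
  have [->//|aa'] := eqVneq a a'.
  have [v0|z xz zl] := cM [:: a; w].
    by rewrite !inE => /orP [/eqP ->|/eqP ->].
  have az : descendant a z by apply: zl; rewrite mem_head.
  have a'z : descendant a' z.
    by apply: desc_trans a'w _; apply: zl; rewrite !inE eqxx orbT.
  have ar : a \in r1 ++ a :: r2 by rewrite mem_cat mem_head orbT.
  by have := desc_disjoint NT MU (basis_OA NT v1 or) ar a'r aa' az a'z; rewrite eqxx.
exists w; split=> //; first exact: (below _ _ _ _ os st).
by apply: (below _ _ _ _ os' st') => //; rewrite -tt'.
Qed.

(** The point [q] moved into the cone of the letter: all ancestors of the nodes
    of [q] moved there. *)
Definition prepend (i : 'I_(ncolours O)) (j : 'I_(arity i)) (q : set U) : set U :=
  fun u => descendant x u /\ exists2 v, q v & descendant u (shift (alpha j x) v).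

(** The map sending the generator to the lambda of constant copies of itself undoes
    all letters of colour [i]. *)
Lemma shift_retract (i : 'I_(ncolours O)) (j : 'I_(arity i)) :
  cancel (shift (alpha j x)) (shift (lambda (fun _ : 'I_(arity i) => x))).
Proof.
move=> u; apply: (hom1_eq (hom_comp (hom_shift _) (hom_shift _)) (hom_id U)).
rewrite /= shift_gen; have [sa _] := hom_shift (lambda (fun _ : 'I_(arity i) => x)).
by rewrite sa shift_gen; have [_ -> _] := MU.
Qed.

Lemma desc_unshift (i : 'I_(ncolours O)) (j : 'I_(arity i)) u v :
  descendant (shift (alpha j x) u) (shift (alpha j x) v) -> descendant u v.
Proof.
move=> /(desc_hom (hom_shift (lambda (fun _ : 'I_(arity i) => x)))).
by rewrite !shift_retract.
Qed.

Lemma desc_child (i : 'I_(ncolours O)) (j : 'I_(arity i)) u :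
  descendant u (alpha j u).
Proof. exact/desc_alpha/desc_refl. Qed.

Lemma ideal_point_prepend (i : 'I_(ncolours O)) (j : 'I_(arity i)) q :
  ideal_point q -> ideal_point (prepend j q).
Proof.
move=> pq; have [qx qd qup qdown qdir] := pq.
have xs v : q v -> descendant x (shift (alpha j x) v).
  by move=> /qd /(desc_shift (alpha j x)); apply: desc_trans; exact: desc_child.
split.
- by split; [exact: desc_refl | exists x => //; rewrite shift_gen; exact: desc_child].
- by move=> u [].
- move=> u k h xu [_ [v qv uv]]; split=> //; exists v => //.
  by apply: desc_trans uv; exact: desc_child.
- move=> u k [xu [v qv uv]]; have [t vt tP] := refine k uv.
  have [t' vt' tE] := @pexp_map_im _ _ _ _ [:: v] _ (hom_shift (alpha j x)) vt.
  have [|w wt qw] := down_pexp qdown vt'; first by exists v; rewrite ?mem_head.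
  have [|h hw] := tP (shift (alpha j x) w); first by rewrite tE map_f.
  exists h; split; first exact: desc_alpha.
  by exists w.
- move=> u u' [xu [v qv uv]] [xu' [v' qv' uv']].
  have [w [qw vw vw']] := qdir _ _ qv qv'.
  exists (shift (alpha j x) w); split.
  + by split; [exact: xs | exists w => //; exact: desc_refl].
  + by apply: desc_trans uv _; exact: desc_hom (hom_shift _) vw.
  + by apply: desc_trans uv' _; exact: desc_hom (hom_shift _) vw'.
Qed.

Lemma prepend_shift (i : 'I_(ncolours O)) (j : 'I_(arity i)) q u : ideal_point q ->
  descendant x u -> prepend j q (shift (alpha j x) u) -> q u.
Proof. by move=> pq xu [_ [v qv /desc_unshift uv]]; exact: ideal_point_up uv qv. Qed.

Lemma shift_prepend (i : 'I_(ncolours O)) (j : 'I_(arity i)) q u : ideal_point q ->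
  q u -> prepend j q (shift (alpha j x) u).
Proof.
move=> [_ qd _ _ _] qu; split; last by exists u => //; exact: desc_refl.
by apply: desc_trans (desc_shift _ (qd _ qu)); exact: desc_child.
Qed.

Lemma basis_children i : basis S (children i x).
Proof.
rewrite -[children i x]cats0; apply: (@basis_step _ S _ [::] [::]) => //.
by rewrite /= -generators1; exact: basis_gen.
Qed.

Lemma children_disjoint (i : 'I_(ncolours O)) (j j' : 'I_(arity i)) w :
  descendant (alpha j x) w -> descendant (alpha j' x) w -> j = j'.
Proof.
move=> jw j'w; have bx := basis_children i; have [ux _ _] := bx.
have nthE (k : 'I_(arity i)) : nth x (children i x) k = alpha k x.
  by rewrite (nth_map j) ?size_enum_ord // nth_ord_enum.
have [E|ne] := eqVneq (alpha j x) (alpha j' x).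
  apply/val_inj/eqP; rewrite -(nth_uniq x _ _ ux) ?size_children ?ltn_ord //.
  by rewrite !nthE E.
have := desc_disjoint NT MU bx (alpha_children x j) (alpha_children x j') ne jw j'w.
by rewrite eqxx.
Qed.

Lemma prepend_inj (i : 'I_(ncolours O)) (j j' : 'I_(arity i)) q q' :
  ideal_point q -> ideal_point q' -> prepend j q = prepend j' q' -> j = j' /\ q = q'.
Proof.
move=> pq pq' E.
have jj' : j = j'.
  have [qx _ _ _ _] := pq; have [qx' _ _ _ _] := pq'.
  have [_ _ _ _ dir] := ideal_point_prepend j' pq'.
  have Ej := shift_prepend j pq qx; rewrite E in Ej.
  have [w [_ jw j'w]] := dir _ _ Ej (shift_prepend j' pq' qx').
  by move: jw j'w; rewrite !shift_gen; exact: children_disjoint.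
split=> //; subst j'; have [_ qd _ _ _] := pq; have [_ qd' _ _ _] := pq'.
apply/seteqP; split=> u qu.
  by apply: (@prepend_shift _ j) => //; [exact: qd | rewrite -E; exact: shift_prepend].
by apply: (@prepend_shift _ j) => //; [exact: qd' | rewrite E; exact: shift_prepend].
Qed.

Lemma prepend_surj i p : ideal_point p ->
  exists (j : 'I_(arity i)) q, ideal_point q /\ p = prepend j q.
Proof.
move=> pp; have [px pd pup pdown pdir] := pp; have [j pj] := pdown _ i px.
pose q : set U := fun u => descendant x u /\ p (shift (alpha j x) u).
have [sa _] := hom_shift (alpha j x).
have below u : p u -> exists w, q w /\ descendant u (shift (alpha j x) w).
  move=> pu; have [w [pw uw jw]] := pdir _ _ pu pj.
  rewrite -(shift_gen (alpha j x)) in jw.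
  have [w' xw' wE] := desc_im (hom_shift (alpha j x)) jw; subst w.
  by exists w'.
have pq : ideal_point q.
  split.
  - by split; [exact: desc_refl | rewrite shift_gen].
  - by move=> u [].
  - move=> u k h xu [xhu]; rewrite sa => /pup H; split=> //; apply: H.
    by apply: desc_trans (desc_shift _ xu); exact: desc_child.
  - move=> u k [xu /(pdown _ k) [h ph]]; exists h; split; first exact: desc_alpha.
    by rewrite sa.
  - move=> u v [xu pu] [xv pv]; have [w [pw uw vw]] := pdir _ _ pu pv.
    have [w' [qw' ww']] := below _ pw; exists w'; split=> //.
      exact: desc_unshift (desc_trans uw ww').
    exact: desc_unshift (desc_trans vw ww').
exists j, q; split=> //; apply/seteqP; split=> u.
  by move=> pu; split; [exact: pd | have [w [qw uw]] := below _ pu; exists w].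
by move=> [xu [v [_ pv] uv]]; exact: ideal_point_up uv pv.
Qed.

Lemma prepend2 (i i' : 'I_(ncolours O)) (j : 'I_(arity i)) (k : 'I_(arity i')) q u :
  ideal_point q -> prepend j (prepend k q) u <->
  descendant x u /\ exists2 v, q v & descendant u (shift (alpha k (alpha j x)) v).
Proof.
move=> [_ qd _ _ _].
have sE : shift (alpha j x) \o shift (alpha k x) =1 shift (alpha k (alpha j x)).
  apply: hom1_eq; [exact: hom_comp (hom_shift _) (hom_shift _)|exact: hom_shift|].
  have [sa _] := hom_shift (alpha j x).
  by rewrite /= !shift_gen sa shift_gen.
split=> [[xu [v [xv [w qw vw]] uv]]|[xu [v qv uv]]]; split=> //.
  by exists w => //; rewrite -sE; apply: desc_trans uv _; exact: desc_hom (hom_shift _) vw.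
exists (shift (alpha k x) v); last by have := sE v => /= ->.
split; last by exists v => //; exact: desc_refl.
by apply: desc_trans (desc_shift _ (qd _ qv)); exact: desc_child.
Qed.

Definition ideal_point_type := {p : set U | `[< ideal_point p >]}.

HB.instance Definition _ := SubChoice.on ideal_point_type.

Definition prepend_point (i : 'I_(ncolours O)) (j : 'I_(arity i)) (q : ideal_point_type) :
    ideal_point_type :=
  exist _ (prepend j (val q)) (asboolT (ideal_point_prepend j (asboolW (valP q)))).

Lemma prepend_point_laws (i i' : 'I_(ncolours O)) (lt : (i < i')%N) b :
  S lt = Some b -> forall q nu,
  prepend_point (tag nu) (prepend_point (tagged nu) q) =
  prepend_point (tag (phi b nu)) (prepend_point (tagged (phi b nu)) q).
Proof.
move=> Sb q nu; apply: val_inj => /=; have pq := asboolW (valP q).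
have [_ _ M3] := MU.
by apply/seteqP; split=> u; rewrite !prepend2 // (M3 _ _ _ _ Sb).
Qed.

Lemma prepend_point_surj i p :
  exists (j : 'I_(arity i)) q, p = prepend_point j q.
Proof.
have [j [q [pq pE]]] := prepend_surj i (asboolW (valP p)).
by exists j, (exist _ q (asboolT pq)); apply: val_inj.
Qed.

Lemma prepend_point_inj (i : 'I_(ncolours O)) (j j' : 'I_(arity i)) q q' :
  prepend_point j q = prepend_point j' q' -> j = j' /\ q = q'.
Proof.
move=> /(congr1 val) /(prepend_inj (asboolW (valP q)) (asboolW (valP q'))) [-> E].
by split=> //; apply: val_inj.
Qed.

(** The sets with at most one boundary point already separate the two copies and
    carry a charge. *)
Theorem pexp_order_unique (V : omega_algebra O) (s t t' : seq V) :
  order_preserving S -> models S V -> basis S s ->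
  pexp s t -> pexp s t' -> t =i t' -> t = t'.
Proof.
move=> ordS MV bs st st' tt'.
pose A := finite_sets prepend_point_surj.
have MA : models S A := models_finite_sets prepend_point_surj prepend_point_inj prepend_point_laws.
have chD := @parity_finite_sets _ _ _ prepend_point_surj.
have [p pp] := exists_point; pose p0 : ideal_point_type := exist _ p (asboolT pp).
apply: (order_unique_of_charge ordS MA MA (charge := fun F : A => odd #|` F|%fset) chD NT MV bs st st' tt').
  by exists fset0, [fset p0]%fset; rewrite cardfs0 cardfs1.
by exists (fset0 : A), ([fset p0]%fset : A) => /fsetP /(_ p0); rewrite !inE eqxx.
Qed.

End Points.

(** * Cyclic orders and rotations *)

Section CyclicSequences.
Variables (O : signature) (A : omega_algebra O).
Implicit Types s t : seq A.

Lemma rot_rot_ex (T : Type) (s : seq T) m n : exists k, rot m (rot n s) = rot k s.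
Proof.
have [ns|ns] := leqP n (size s); last by exists m; rewrite (rot_oversize (ltnW ns)).
have [ms|ms] := leqP m (size s); last first.
  by exists n; rewrite rot_oversize // size_rot ltnW.
by rewrite rot_add_mod //; eexists.
Qed.

Lemma rot_back_ex (T : Type) (s t : seq T) n : s = rot n t -> exists k, t = rot k s.
Proof. by move=> ->; exists (size (rot n t) - n); rewrite -/(rotr n _) rotK. Qed.

(** Cutting the sequence at [n], every entry has an index in one of the two
    pieces, and the claim becomes an inequality between indices. *)
Lemma cyclic_order_rot n s x y z : uniq s -> x \in s -> y \in s -> z \in s ->
  cyclic_order (rot n s) x y z = cyclic_order s x y z.
Proof.
rewrite -{1 2 3 4 6}(cat_take_drop n s) /rot.
move: (take n s) (drop n s) => s1 s2; rewrite cat_uniq => /and3P [_ /hasPn dis _].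
have dis' w : w \in s2 -> w \in s1 = false by move/dis/negbTE.
have idx w : w \in s1 ++ s2 -> (index w s1 < size s1 /\ index w (s2 ++ s1) = size s2 + index w s1
      /\ index w (s1 ++ s2) = index w s1) \/
    (index w s2 < size s2 /\ index w (s2 ++ s1) = index w s2
      /\ index w (s1 ++ s2) = size s1 + index w s2).
  rewrite mem_cat !index_cat !index_mem; case w1: (w \in s1); case w2: (w \in s2) => //= _.
  - by rewrite (dis' _ w2) in w1.
  - by left.
  - by right.
move=> /idx Hx /idx Hy /idx Hz; rewrite /cyclic_order.
by case: Hx => -[? [-> ->]]; case: Hy => -[? [-> ->]]; case: Hz => -[? [-> ->]]; lia.
Qed.

Lemma cyclic_order_map (g : A -> A) s x y z : injective g ->
  cyclic_order (map g s) (g x) (g y) (g z) = cyclic_order s x y z.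
Proof. by move=> gI; rewrite /cyclic_order !index_map. Qed.

(** Rotate [t] so as to start with the first entry of [s]; the cyclic order seen
    from that entry is then the linear order of both sequences. *)
Lemma cyclic_order_eq_rot s t : uniq s -> uniq t -> s =i t ->
  {in s & &, forall x y z, cyclic_order t x y z = cyclic_order s x y z} ->
  exists n, s = rot n t.
Proof.
case: s => [|x s] us ut st ct.
  by exists 0; case: t st {ut ct} => // y t /(_ y); rewrite mem_head.
have xt : x \in t by rewrite -st mem_head.
exists (index x t).
have tE : rot (index x t) t = x :: behead (rot (index x t) t).
  rewrite /rot (drop_nth x) ?index_mem // nth_index //=.
set t' := rot _ _ in tE *.
have tt' : t' =i t by exact: mem_rot.
have ut' : uniq t' by rewrite rot_uniq.
have ct' y z w : y \in x :: s -> z \in x :: s -> w \in x :: s ->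
    cyclic_order t' y z w = cyclic_order (x :: s) y z w.
  by move=> ys zs ws; rewrite cyclic_order_rot -?st // ct.
apply: eq_of_index => // [y|y z ys zs lt]; first by rewrite st tt'.
have zx : index x t' = 0 by rewrite tE /= eqxx.
have zx0 : index x (x :: s) = 0 by rewrite /= eqxx.
have [zx'|xz] := eqVneq z x.
  subst z; rewrite zx lt0n; apply/eqP => y0.
  have yt' : y \in t' by rewrite tt' -(st y).
  have : nth x t' (index y t') = nth x t' (index x t') by rewrite y0 zx.
  have xt' : x \in t' by rewrite tt'.
  rewrite !nth_index // => xy; by rewrite xy ltnn in lt.
have z0 : index z (x :: s) != 0 by rewrite /= (eq_sym x) (negbTE xz).
have := ct' x z y (mem_head _ _) zs ys; rewrite /cyclic_order zx zx0.
move: lt z0; clear; lia.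
Qed.

End CyclicSequences.

(** * The group of automorphisms preserving the cyclic order *)

Section CyclicBases.
Variables (O : signature) (S : laws O).
Hypotheses (Hv : forall m, 1 <= m -> valid S m) (ordS : order_preserving S)
  (Hb : forall m, 1 <= m -> bounded S m).

Let NT : nontrivial S := valid_nontrivial (Hv (isT : 1 <= 2)).
Let MU m : models S (cantor S m) := models_cantor S m.

Lemma pexp_unique (V : omega_algebra O) (s t t' : seq V) : models S V ->
  basis S s -> pexp s t -> pexp s t' -> t =i t' -> t = t'.
Proof. exact: pexp_order_unique NT (Hv (leqnn 1)) (Hb (leqnn 1)) _ _ _ _ ordS. Qed.

Section Fixed.
Variables (m : nat) (m0 : 0 < m).
Local Notation U := (cantor S m).
Implicit Types s t u : seq U.

Lemma OA_basis s : ordered_admissible s -> basis S s.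
Proof. exact: basis_OA NT (Hv m0). Qed.

Lemma OA_unique s t : ordered_admissible s -> ordered_admissible t -> s =i t -> s = t.
Proof. by move=> os ot; apply: pexp_unique os ot; [exact: MU | exact/basis_gen/Hv]. Qed.

Lemma OA_lub s t : ordered_admissible s -> ordered_admissible t ->
  exists u, [/\ ordered_admissible u, pexp s u, pexp t u &
    is_lub [set` s]%classic [set` t]%classic [set` u]%classic].
Proof.
move=> os ot; have [u [u' [su tu' uu' lu]]] := lub_OA NT (Hv m0) (Hb m0) os ot.
have uE : u = u' by apply: OA_unique uu'; [exact: pexp_trans su | exact: pexp_trans tu'].
by exists u; split=> //; [exact: pexp_trans su | rewrite uE].
Qed.

Lemma OA_size s : ordered_admissible s -> m <= size s.
Proof.
by move/pexp_size; rewrite size_map size_enum_ord.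
Qed.

(** Rotating an ordered admissible sequence does not change its cyclic order, and
    rotations are stable under planar expansion ([cyc_pexp]). *)
Definition cyc_adm s := exists n t, ordered_admissible t /\ s = rot n t.

Lemma OA_cyc s : ordered_admissible s -> cyc_adm s.
Proof. by move=> os; exists 0, s; rewrite rot0. Qed.

Lemma cyc_rot n s : cyc_adm s -> cyc_adm (rot n s).
Proof.
move=> [k [t [ot ->]]]; have [k' ->] := rot_rot_ex t n k.
by exists k', t.
Qed.

Lemma cyc_basis s : cyc_adm s -> basis S s.
Proof. by move=> [n [t [ot ->]]]; apply: basis_rot; exact: OA_basis. Qed.

Lemma cyc_size s : cyc_adm s -> 0 < size s.
Proof.
by move=> [n [t [/OA_size mt ->]]]; rewrite size_rot; exact: leq_trans mt.
Qed.

Lemma pexp_rot (V : omega_algebra O) n (s t : seq V) : pexp s t ->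
  exists k, pexp (rot n s) (rot k t).
Proof.
rewrite -{1}(cat_take_drop n s) => /pexp_cat_inv [t1 [t2 [-> p1 p2]]].
by exists (size t1); rewrite rot_size_cat; exact: pexp_cat.
Qed.

Lemma pexp_rot_inv (V : omega_algebra O) n (s t : seq V) : pexp (rot n s) t ->
  exists k, pexp s (rot k t).
Proof.
by move=> /(pexp_rot (size (rot n s) - n)); rewrite -/(rotr n _) rotK.
Qed.

Lemma cyc_pexp s t : cyc_adm s -> pexp s t -> cyc_adm t.
Proof.
move=> [n [u [ou ->]]] /pexp_rot_inv [k ut].
have [k' ->] := rot_back_ex (erefl (rot k t)).
exists k', (rot k t); split=> //; exact: pexp_trans ut.
Qed.

Lemma cyc_refine s t : cyc_adm s -> cyc_adm t ->
  exists u j k, [/\ ordered_admissible u, pexp s (rot j u) & pexp t (rot k u)].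
Proof.
move=> [n [s' [os ->]]] [n' [t' [ot ->]]].
have [u [ou su tu _]] := OA_lub os ot.
have [j sj] := pexp_rot n su; have [k tk] := pexp_rot n' tu.
by exists u, j, k.
Qed.

Definition cyc_aut (g : automorphism U) := exists s, cyc_adm s /\ cyc_adm (map g s).

Lemma cyc_aut_pexp (g : automorphism U) s t : cyc_adm s -> cyc_adm (map g s) -> pexp s t ->
  cyc_adm t /\ cyc_adm (map g t).
Proof.
move=> cs cg st; split; first exact: cyc_pexp st.
by apply: cyc_pexp cg _; exact: pexp_map (hom_aut g) st.
Qed.

Lemma cyc_aut1 : cyc_aut 1%g.
Proof.
exists (generators S m); have og : cyc_adm (generators S m) by apply: OA_cyc; exact: ord_start.
by split=> //; rewrite map_id.
Qed.

Lemma map_autK (g : automorphism U) s : map (g^-1)%g (map g s) = s.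
Proof. by apply: mapK => z; exact: (aut_funK g). Qed.

Lemma map_autVK (g : automorphism U) s : map g (map (g^-1)%g s) = s.
Proof. by apply: mapK => z; exact: (aut_invK g). Qed.

Lemma map_autM (g h : automorphism U) s : map (g * h)%g s = map h (map g s).
Proof. by rewrite -map_comp. Qed.

Lemma cyc_autV g : cyc_aut g -> cyc_aut (g^-1)%g.
Proof. by move=> [s [cs cg]]; exists (map g s); rewrite map_autK. Qed.

(** Refine the target of [g] and the source of [h] to a common sequence and
    transport it to both ends. *)
Lemma cyc_autM g h : cyc_aut g -> cyc_aut h -> cyc_aut (g * h)%g.
Proof.
move=> [s [cs cg]] [t [ct ch]].
have [u [j [k [ou gu tu]]]] := cyc_refine cg ct.
exists (map (g^-1)%g (rot j u)); split.
  by apply: cyc_pexp cs _; rewrite -(map_autK g s); exact: pexp_map (hom_aut _) gu.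
have [_ chu] := cyc_aut_pexp ct ch tu.
rewrite map_autM map_autVK map_rot; apply: cyc_rot.
have [k' ->] := rot_back_ex (erefl (rot k u)); rewrite map_rot.
exact: cyc_rot.
Qed.

(** A bijection preserving the cyclic order is a rotation of sequences. *)
Lemma thompson_T_cyc (g : automorphism U) : @thompson_T O S m g <-> cyc_aut g.
Proof.
have gI := can_inj (aut_funK g).
split=> [[V [W [oV oW [_ _ [gV gI' gW]] cVW]]]|[s [[n [V [oV sE]]] [n' [W [oW gE]]]]]].
  exists V; split; first exact: OA_cyc.
  have [uV _ _] := OA_basis oV; have [uW _ _] := OA_basis oW.
  have EVW : map g V =i W.
    move=> z; apply/mapP/idP => [[y yV ->]|]; first exact: gV.
    by move=> /gW [y yV <-]; exists y.
  have [||k ->] := cyclic_order_eq_rot _ uW EVW.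
  - by rewrite map_inj_uniq.
  - move=> _ _ _ /mapP [x xV ->] /mapP [y yV ->] /mapP [z zV ->].
    by rewrite cVW // cyclic_order_map.
  - exact/cyc_rot/OA_cyc.
rewrite {}sE map_rot in gE.
have [k gVE] := rot_back_ex (esym gE); have [k' gVE'] := rot_rot_ex W k n'.
rewrite gVE' in gVE.
have [uW _ _] := OA_basis oW.
have EVW : map g V =i W by move=> z; rewrite gVE mem_rot.
exists V, W; split=> //.
- split; [exact: (admissible_OA NT (Hv m0)) | exact: (admissible_OA NT (Hv m0)) |].
  split=> [z zV|z y _ _ /gI //|z zW] /=.
    by rewrite /= -EVW map_f.
  by move: zW; rewrite /= -EVW => /mapP [y yV ->]; exists y.
- move=> x y z xV yV zV; rewrite -(cyclic_order_rot k') -?EVW ?map_f // -gVE.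
  exact: cyclic_order_map.
Qed.

End Fixed.

(** For [m = 0], where there is nothing to rotate, the whole automorphism group is
    taken. *)
Lemma thompson_T_group : exists T : forall m, groupClosed (automorphism (cantor S m)),
  forall m, 1 <= m -> forall g, g \in T m <-> cyc_aut g.
Proof.
have H m : exists T : groupClosed (automorphism (cantor S m)),
    1 <= m -> forall g, g \in T <-> cyc_aut g.
  pose p : {pred automorphism (cantor S m)} := fun g => (m == 0) || `[< cyc_aut g >].
  have pP g : 0 < m -> (g \in p) <-> cyc_aut g.
    by rewrite unfold_in lt0n => /negbTE ->; split=> /asboolP.
  have pM : mulg_closed p.
    move=> g h; rewrite !unfold_in; case: (posnP m) => // mp /=.
    by move=> /asboolP cg /asboolP ch; apply/asboolP; exact: cyc_autM.
  have p1 : (1%g \in p).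
    by rewrite unfold_in; case: (posnP m) => // mp; apply/asboolP; exact: cyc_aut1.
  have pV : invg_closed p.
    move=> g; rewrite !unfold_in; case: (posnP m) => // mp /asboolP cg.
    by apply/asboolP; exact: cyc_autV.
  pose mM := isMulClosed.Build _ p pM.
  pose m1 := isMul1Closed.Build _ p p1.
  pose mV := isInvClosed.Build _ p pV.
  pose T : groupClosed _ := HB.pack p mM m1 mV.
  by exists T => mp g; exact: pP.
by exists (fun m => sval (cid (H m))) => m m0; exact: (svalP (cid (H m))).
Qed.

End CyclicBases.

(** * Repeated sequences and expansions by blocks *)

Section RotationsOfPowers.
Variable T : eqType.
Implicit Types s t : seq T.

Lemma nth_rot x0 s n i : n <= size s -> i < size s ->
  nth x0 (rot n s) i = nth x0 s ((n + i) %% size s).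
Proof.
move=> ns si; rewrite /rot nth_cat size_drop; case: ltnP => lt.
  by rewrite nth_drop modn_small //; lia.
rewrite nth_take; last by lia.
congr nth; have -> : n + i = (i - (size s - n)) + size s by lia.
by rewrite modnDr modn_small //; lia.
Qed.

Lemma size_flatten_nseq p t : size (flatten (nseq p t)) = p * size t.
Proof. by rewrite size_flatten /shape map_nseq sumn_nseq mulnC. Qed.

Lemma nth_flatten_nseq x0 p t i : i < p * size t ->
  nth x0 (flatten (nseq p t)) i = nth x0 t (i %% size t).
Proof.
elim: p i => [//|p IH] i; rewrite mulSn /= nth_cat => lt.
have [it|it] := ltnP i (size t); first by rewrite modn_small.
by rewrite IH; [rewrite -{2}(subnK it) modnDr | lia].
Qed.

Lemma rot_flatten_nseq p t : rot (size t) (flatten (nseq p t)) = flatten (nseq p t).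
Proof.
case: p => [//|p]; rewrite /= rot_size_cat -[RHS]/(flatten (nseq p.+1 t)).
by rewrite -addn1 nseqD flatten_cat /= cats0.
Qed.

Lemma take_rot_flatten p t n : 0 < p -> n <= p * size t ->
  take (size t) (rot n (flatten (nseq p t))) = rot (n %% size t) t.
Proof.
move=> p0 np; have [t0|t0] := posnP (size t).
  by rewrite t0 take0; case: (t) t0.
have lt : size t <= p * size t by rewrite leq_pmull.
have nt : n %% size t < size t by rewrite ltn_mod.
have [x0 _] : exists x, x \in t by case: (t) t0 => // x ? _; exists x; rewrite mem_head.
have szE : size (take (size t) (rot n (flatten (nseq p t)))) = size t.
  by rewrite size_takel // size_rot size_flatten_nseq.
apply: (@eq_from_nth _ x0); rewrite szE ?size_rot // => i it.
rewrite nth_take // !nth_rot ?size_flatten_nseq //; try lia.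
rewrite nth_flatten_nseq ?ltn_mod ?muln_gt0 ?p0 // modn_dvdm ?dvdn_mull //.
by rewrite modnDml.
Qed.

Lemma rot_uniq_eq0 t n : uniq t -> n < size t -> rot n t = t -> n = 0.
Proof.
move=> ut nt E; have t0 : 0 < size t by lia.
have [x0 _] : exists x, x \in t by case: (t) t0 => // x ? _; exists x; rewrite mem_head.
have := congr1 (nth x0 ^~ 0) E; rewrite nth_rot ?(ltnW nt) // addn0 modn_small // => /eqP.
by rewrite nth_uniq // => /eqP.
Qed.

End RotationsOfPowers.

Section Blocks.
Variables (O : signature) (S : laws O) (V : omega_algebra O).
Implicit Types ss us : seq (seq V).

Definition pexp_blocks ss us := size us = size ss /\
  forall a, a < size ss -> pexp (nth [::] ss a) (nth [::] us a).

Lemma pexp_blocks_cons s ss u us :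
  pexp_blocks (s :: ss) (u :: us) <-> pexp s u /\ pexp_blocks ss us.
Proof.
split=> [[[sz] H]|[su [sz H]]].
  by split; [exact: (H 0) | split=> // a; exact: (H a.+1)].
split; first by rewrite /= sz.
by case=> [|a] //=; exact: H.
Qed.

Lemma pexp_flatten ss us : pexp_blocks ss us -> pexp (flatten ss) (flatten us).
Proof.
elim: ss us => [|s ss IH] [|u us]; try by case.
  by move=> _; exact: ord_start.
by move=> /pexp_blocks_cons [su /IH]; exact: pexp_cat.
Qed.

Lemma pexp_flatten_inv ss u : pexp (flatten ss) u ->
  exists2 us, pexp_blocks ss us & u = flatten us.
Proof.
elim: ss u => [|s ss IH] u /=; first by move=> /pexp_nil ->; exists [::].
move=> /pexp_cat_inv [u1 [u2 [-> p1 /IH [us b ->]]]].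
by exists (u1 :: us) => //; exact/pexp_blocks_cons.
Qed.

(** An entry in which two decompositions overlap would descend from entries of
    two distinct blocks. *)
Lemma blocks_unique ss us us' :
  uniq (flatten ss) ->
  (forall x y z w, x \in flatten ss -> y \in flatten ss -> x != y ->
    descendant x z -> descendant y w -> z != w) ->
  pexp_blocks ss us -> pexp_blocks ss us' -> flatten us = flatten us' -> us = us'.
Proof.
elim: ss us us' => [|s ss IH] [|u us] [|u' us']; try by move=> _ _ [+ _] [+ _].
have flE (r : seq V) rr : flatten (r :: rr) = r ++ flatten rr by [].
rewrite !flE cat_uniq => /and3P [us0 dis uss] D.
move=> /pexp_blocks_cons [su bu] /pexp_blocks_cons [su' bu'] E.
have no_overlap a b c : pexp s a -> pexp (flatten ss) b ->
    {subset c <= a} -> {subset c <= b} -> c = [::].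
  case: c => // z c sa sb ca cb.
  have [x xs xz] := pexp_desc sa (ca z (mem_head _ _)).
  have [y ys yz] := pexp_desc sb (cb z (mem_head _ _)).
  have xy : x != y by apply/eqP => xy; move/hasPn: dis => /(_ y ys) /=; rewrite -xy xs.
  have xss : x \in s ++ flatten ss by rewrite mem_cat xs.
  have yss : y \in s ++ flatten ss by rewrite mem_cat ys orbT.
  by have := D _ _ _ _ xss yss xy xz yz; rewrite eqxx.
have [uu' FF'] : u = u' /\ flatten us = flatten us'.
  have [c [[E1 E2]|[E1 E2]]] : exists c, (u' = u ++ c /\ flatten us = c ++ flatten us') \/
      (u = u' ++ c /\ flatten us' = c ++ flatten us).
    elim: (u) (u') E => [|x u1 IHu] [|x' u1'] /= E.
    - by exists [::]; left.
    - by exists (x' :: u1'); left.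
    - by exists (x :: u1); right.
    - by case: E => <- /IHu [c [[-> E2]|[-> E2]]]; exists c; [left|right].
  - have c0 : c = [::].
      apply: (no_overlap _ _ _ su' (pexp_flatten bu)) => z zc.
        by rewrite E1 mem_cat zc orbT.
      by rewrite E2 mem_cat zc.
    by rewrite E1 E2 c0 cats0.
  - have c0 : c = [::].
      apply: (no_overlap _ _ _ su (pexp_flatten bu')) => z zc.
        by rewrite E1 mem_cat zc orbT.
      by rewrite E2 mem_cat zc.
    by rewrite E1 E2 c0 cats0.
rewrite uu'; congr cons; apply: IH bu bu' FF' => // x y z w xs ys.
by apply: D; rewrite mem_cat (xs, ys) orbT.
Qed.

End Blocks.

(** * Cyclic groups of rotations and their quotient algebra *)

Section Orbits.
Variables (O : signature) (V : omega_algebra O) (k : V -> V).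
Implicit Types v w : seq V.

(** The sequence v, k v, ..., k^(p-1) v; k rotates it when k^p = 1. *)
Definition orbits p v := flatten [seq map (iter a k) v | a <- iota 0 p].

Lemma orbitsSl p v : orbits p.+1 v = v ++ map k (orbits p v).
Proof.
rewrite /orbits /= map_id; congr (_ ++ _).
rewrite map_flatten -[1]add1n iotaDl -!map_comp; congr flatten.
by apply: eq_map => a /=; rewrite -map_comp.
Qed.

Lemma orbitsSr p v : orbits p.+1 v = orbits p v ++ map (iter p k) v.
Proof. by rewrite /orbits -addn1 iotaD map_cat flatten_cat /= cats0. Qed.

Lemma size_orbits p v : size (orbits p v) = p * size v.
Proof. by elim: p => // p IH; rewrite orbitsSr size_cat IH size_map; lia. Qed.

Lemma map_orbits p v : 0 < p -> (forall z, iter p k z = z) ->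
  map k (orbits p v) = rot (size v) (orbits p v).
Proof.
case: p => // p _ kp; rewrite orbitsSl rot_size_cat -orbitsSl orbitsSr map_cat.
congr (_ ++ _); rewrite -map_comp -[RHS]map_id; apply: eq_map => z.
by rewrite -[RHS]kp.
Qed.

Lemma map_iter_orbits p v a : 0 < p -> (forall z, iter p k z = z) -> a <= p ->
  map (iter a k) (orbits p v) = rot (a * size v) (orbits p v).
Proof.
move=> p0 kp; elim: a => [|a IH] ap; first by rewrite rot0 map_id.
rewrite (eq_map (g := k \o iter a k)) // map_comp IH ?(ltnW ap) // map_rot.
rewrite map_orbits // mulSn addnC -rotD // size_orbits addnC -mulSn leq_mul2r ap orbT //.
Qed.

Lemma take_orbits p v : 0 < p -> take (size v) (orbits p v) = v.
Proof. by case: p => // p _; rewrite orbitsSl take_size_cat. Qed.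

Lemma orbits_blocks p v us : size us = p ->
  (forall a, a.+1 < p -> nth [::] us a.+1 = map k (nth [::] us a)) ->
  nth [::] us 0 = v -> flatten us = orbits p v.
Proof.
move=> sz step us0; congr flatten; apply: (@eq_from_nth _ [::]); rewrite ?size_map ?size_iota sz //.
move=> a ap; rewrite (nth_map 0) ?size_iota // nth_iota // add0n.
elim: a ap => [|a IH] ap; first by rewrite map_id.
by rewrite step // IH ?(ltnW ap) // -map_comp.
Qed.

End Orbits.

Section Core.
Variables (O : signature) (S : laws O).
Hypotheses (Hv : forall m, 1 <= m -> valid S m) (ordS : order_preserving S)
  (Hb : forall m, 1 <= m -> bounded S m).

Let NT : nontrivial S := valid_nontrivial (Hv (isT : 1 <= 2)).
Let MU m : models S (cantor S m) := models_cantor S m.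

Variables (r : nat) (r0 : 0 < r).
Local Notation U := (cantor S r).
Variables (k : automorphism U) (p : nat) (v : seq U).
Hypotheses (p0 : 0 < p) (kp : forall z, iter p k z = z)
  (osv : ordered_admissible (orbits k p v)).

Let s := orbits k p v.
Let l := size v.
Let X := generators S l.
Local Notation L := (cantor S l).

Let bs : basis S s. Proof. exact: OA_basis osv. Qed.
Let hk : hom k := hom_aut k.

Lemma hom_iter a : hom (iter a k).
Proof. by elim: a => [|a IH]; [exact: hom_id | exact: hom_comp IH]. Qed.

Lemma orbits_size_gt0 : 0 < l.
Proof.
have := OA_size osv; rewrite size_orbits -/l => H.
by case: (posnP l) H => // ->; rewrite muln0; lia.
Qed.
Let l0 := orbits_size_gt0.

Lemma size_X : size X = l. Proof. by rewrite size_map size_enum_ord. Qed.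

Lemma pexp_orbits w w' : pexp w w' -> pexp (orbits k p w) (orbits k p w').
Proof.
move=> ww'; elim: p => [|q IH]; first exact: ord_start.
rewrite !orbitsSr; apply: pexp_cat => //; exact: pexp_map (hom_iter q) ww'.
Qed.

(** The quotient map by the group generated by [k]: all [p] copies of [v] are sent
    to the generators. *)
Lemma exists_projection : exists2 pi : U -> L, hom pi &
  map pi s = flatten (nseq p X).
Proof.
apply: (basis_hom (MU l) bs).
  by rewrite size_orbits muln_gt0 p0.
by rewrite size_flatten_nseq size_orbits size_X.
Qed.

Lemma exists_section : exists2 io : L -> U, hom io & map io X = v.
Proof.
apply: (basis_hom (MU r)); [exact/basis_gen/Hv/l0 | by rewrite size_X |].
by rewrite size_X.
Qed.

Section Projection.
Variables (pi : U -> L) (io : L -> U).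
Hypotheses (hpi : hom pi) (hio : hom io).
Hypotheses (pis : map pi s = flatten (nseq p X)) (ioX : map io X = v).

Lemma pi_k z : pi (k z) = pi z.
Proof.
apply: (basis_hom_eq (f := pi \o k) (g := pi) (MU l) bs (hom_comp hpi hk) hpi).
rewrite map_comp map_orbits // map_rot -/s pis; have := rot_flatten_nseq p X.
by rewrite size_X.
Qed.

Lemma pi_iter a z : pi (iter a k z) = pi z.
Proof. by elim: a => //= a IH; rewrite pi_k. Qed.

Lemma pi_v : map pi v = X.
Proof.
rewrite -(take_orbits k v p0) map_take -/s pis; case: (p) p0 => // q _ /=.
by rewrite take_size_cat ?size_X.
Qed.

Lemma pi_io : cancel io pi.
Proof.
apply: (basis_hom_eq (f := pi \o io) (g := id) (MU l) _ (hom_comp hpi hio) (hom_id L)).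
  exact/basis_gen/Hv/l0.
by rewrite map_comp ioX pi_v map_id.
Qed.

Lemma pexp_v_lift w : pexp v w -> w = map io (map pi w).
Proof.
by rewrite -{1}ioX => /(pexp_map_im hio) [w' _ ->]; rewrite (mapK pi_io).
Qed.

Lemma pexp_v_OA w : pexp v w -> ordered_admissible (map pi w).
Proof. by move/(pexp_map hpi); rewrite pi_v. Qed.

Lemma OA_pexp_v t : ordered_admissible t -> pexp v (map io t).
Proof. by move/(pexp_map hio); rewrite -/(generators S l) -/X ioX. Qed.

Lemma orbits_cyc w : pexp v w -> cyc_adm (orbits k p w).
Proof.
by move=> vw; exact: cyc_pexp (OA_cyc osv) (pexp_orbits vw).
Qed.

Lemma OA_refine_seq (ts : seq (seq L)) : (forall t, t \in ts -> ordered_admissible t) ->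
  exists2 u, ordered_admissible u & forall t, t \in ts -> pexp t u.
Proof.
elim: ts => [|t ts IH] ots; first by exists X => //; exact: ord_start.
have [u ou tu] : exists2 u, ordered_admissible u & forall t, t \in ts -> pexp t u.
  by apply: IH => t' t'ts; apply: ots; rewrite inE t'ts orbT.
have [u' [ou' uu' tu' _]] := OA_lub Hv ordS Hb l0 ou (ots t (mem_head _ _)).
exists u' => // t'; rewrite inE => /orP [/eqP -> //|/tu t'u].
exact: pexp_trans uu'.
Qed.

Lemma nth_orbits_blocks w a : a < p ->
  nth [::] [seq map (iter a k) w | a <- iota 0 p] a = map (iter a k) w.
Proof. by move=> ap; rewrite (nth_map 0) ?size_iota // nth_iota. Qed.

Lemma size_orbits_blocks w : size [seq map (iter a k) w | a <- iota 0 p] = p.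
Proof. by rewrite size_map size_iota. Qed.

(** Expand to a sequence above all k^a v, project each block to U_l, refine the
    projections to a common sequence and lift it back to every block. *)
Lemma orbits_cofinal z : cyc_adm z ->
  exists w c, pexp v w /\ pexp z (rot c (orbits k p w)).
Proof.
move=> [n [t [ot ->]]].
have [u [ou tu su _]] := OA_lub Hv ordS Hb r0 ot osv.
have [us [szu bu] uE] := pexp_flatten_inv su.
rewrite size_orbits_blocks in szu bu.
have bu' a : a < p -> pexp (map (iter a k) v) (nth [::] us a).
  by move=> ap; rewrite -[X in pexp X](nth_orbits_blocks v ap); exact: bu.
have oa a : a < p -> ordered_admissible (map pi (nth [::] us a)).
  move=> ap; have := pexp_map hpi (bu' a ap).
  by rewrite -map_comp (eq_map (g := pi)) ?pi_v // => z' /=; rewrite pi_iter.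
have [tau otau taus] : exists2 tau, ordered_admissible tau &
    forall t, t \in [seq map pi u | u <- us] -> pexp t tau.
  apply: OA_refine_seq => t' /mapP [u' /(nthP [::]) [a]].
  by rewrite szu => ap <- ->; exact: oa.
have vw := OA_pexp_v otau.
have uw : pexp u (orbits k p (map io tau)).
  rewrite uE; apply: pexp_flatten; split; first by rewrite size_orbits_blocks szu.
  rewrite szu => a ap; rewrite nth_orbits_blocks // -map_comp.
  have hki := hom_comp (hom_iter a) hio.
  have := bu' a ap; rewrite -ioX -map_comp => /(pexp_map_im hki) [t' _ t'E].
  have t'pi : t' = map pi (nth [::] us a).
    rewrite t'E -map_comp -[LHS]map_id; apply: eq_map => y /=.
    by rewrite pi_iter pi_io.
  rewrite t'E t'pi; apply: pexp_map hki _; apply: taus.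
  by apply/mapP; exists (nth [::] us a) => //; rewrite mem_nth // szu.
have [c zc] := pexp_rot n (pexp_trans tu uw).
by exists (map io tau), c.
Qed.

(** Moving every block to the next one gives another expansion of the same basis
    with the same entries, hence by uniqueness of the order the same
    sequence. *)
Lemma orbits_invariant u : pexp s u -> map k u =i u ->
  exists2 w, pexp v w & u = orbits k p w.
Proof.
move=> su ku.
have [us [szu bu] uE] := pexp_flatten_inv su.
rewrite size_orbits_blocks in szu bu.
have bu' a : a < p -> pexp (map (iter a k) v) (nth [::] us a).
  by move=> ap; rewrite -[X in pexp X](nth_orbits_blocks v ap); exact: bu.
(* The predecessor of a block in the cyclic order. *)
pose pr a := if a is a'.+1 then a' else p.-1.
pose us' := [seq map k (nth [::] us (pr a)) | a <- iota 0 p].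
have prp a : a < p -> pr a < p by case: a => /=; lia.
have b' : pexp_blocks [seq map (iter a k) v | a <- iota 0 p] us'.
  split; rewrite size_orbits_blocks; first by rewrite size_map size_iota.
  move=> a ap; rewrite nth_orbits_blocks // (nth_map 0) ?size_iota // nth_iota // add0n.
  have := pexp_map hk (bu' _ (prp _ ap)); rewrite -map_comp.
  case: a ap => [|a] ap //=; rewrite (eq_map (g := iter p k)) ?(eq_map kp) //.
  by move=> z /=; rewrite -iterS prednK.
have uu' : u = flatten us'.
  apply: (pexp_unique Hv ordS Hb (MU r) bs su (pexp_flatten b')) => z.
  rewrite -ku uE map_flatten; apply/flattenP/flattenP => -[y].
    case/mapP=> y' /(nthP [::]) [a]; rewrite szu => ap <- -> zy.
    exists (map k (nth [::] us a)) => //; apply/mapP.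
    have [ap'|ap'] := leqP p a.+1.
      by exists 0; rewrite ?mem_iota ?p0 //=; congr (map k (nth _ _ _)); lia.
    by exists a.+1; rewrite ?mem_iota.
  case/mapP=> a; rewrite mem_iota => /andP [_ ap] -> zy.
  exists (map k (nth [::] us (pr a))) => //; apply/map_f/mem_nth.
  by rewrite szu; exact: prp.
have usE : us = us'.
  have [ubs _ _] := bs.
  apply: (blocks_unique ubs _ _ b'); [|by split; rewrite size_orbits_blocks|by rewrite -uE].
  by move=> x y z w; exact: desc_disjoint NT (MU r) bs.
exists (nth [::] us 0).
  by have := bu' 0 p0; rewrite map_id.
rewrite uE; apply: orbits_blocks => // a ap.
by rewrite {1}usE (nth_map 0) ?size_iota // nth_iota.
Qed.

(** Conjugation by [g] and by its inverse carries [k] into its own powers. *)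
Definition normalises (g : automorphism U) :=
  (exists a, forall z, g (k z) = iter a k (g z)) /\
  (exists a, forall z, (g^-1)%g (k z) = iter a k ((g^-1)%g z)).

(** The graph of the homomorphism from the normaliser to the automorphisms of
    U_l. *)
Definition induces (g : automorphism U) (h : automorphism L) :=
  forall z, h (pi z) = pi (g z).

Lemma mem_map_iter_orbits a w : map (iter a k) (orbits k p w) =i orbits k p w.
Proof.
elim: a => [|a IH] z; first by rewrite map_id.
rewrite (eq_map (g := iter a k \o k)); last by move=> y /=; rewrite -iterSr.
by rewrite map_comp map_orbits // map_rot mem_rot IH.
Qed.

(** The image under [g] of an expansion by orbits can be refined to an expansion by
    orbits; pulled back, it remains invariant under [k] because [g] normalises,
    so [orbits_invariant] applies to it. *)
Lemma normalises_form g : cyc_aut g -> normalises g -> exists w w' c,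
  [/\ pexp v w, pexp v w', map g (orbits k p w) = rot c (orbits k p w')
    & c <= p * size w'].
Proof.
move=> [z [cz cgz]] [[a ga] _].
have [w0 [c0 [vw0 zw0]]] := orbits_cofinal cz.
have [_ cg0] := cyc_aut_pexp cz cgz zw0.
have cgt : cyc_adm (map g (orbits k p w0)).
  have [n ->] := rot_back_ex (erefl (rot c0 (orbits k p w0))).
  by rewrite map_rot; exact: cyc_rot.
have [w' [c [vw' gw']]] := orbits_cofinal cgt.
pose u := map (g^-1)%g (rot c (orbits k p w')).
have w0u : pexp (orbits k p w0) u.
  by rewrite -(map_autK g (orbits k p w0)); exact: pexp_map (hom_aut _) gw'.
have [|w vw uE] := orbits_invariant (pexp_trans (pexp_orbits vw0) w0u).
  have -> : map k u = map (g^-1)%g (map (iter a k) (rot c (orbits k p w'))).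
    rewrite -!map_comp; apply: eq_map => y /=.
    by rewrite -[in RHS](aut_invK g y) -ga; exact: (esym (aut_funK g (k ((g^-1)%g y)))).
  have E : map (iter a k) (rot c (orbits k p w')) =i rot c (orbits k p w').
    by move=> y; rewrite map_rot !mem_rot mem_map_iter_orbits.
  by move=> y; apply/mapP/mapP => -[y' y'm ->]; exists y'; rewrite // ?E // -E.
exists w, w', (minn c (size (orbits k p w'))); split=> //.
  by rewrite -uE map_autVK [LHS]rot_minn.
by rewrite size_orbits geq_minr.
Qed.

Lemma pi_orbits w : map pi (orbits k p w) = flatten (nseq p (map pi w)).
Proof.
elim: (p) => // q IH; rewrite orbitsSr map_cat IH -map_comp.
rewrite (eq_map (g := pi)) => [|z /=]; last by rewrite pi_iter.
by rewrite -addn1 nseqD flatten_cat /= cats0.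
Qed.

(** Project the first block of the equality between [p]-fold repetitions. *)
Lemma induces_form g h w w' c : induces g h -> c <= p * size w' ->
  map g (orbits k p w) = rot c (orbits k p w') ->
  map h (map pi w) = rot (c %% size w') (map pi w').
Proof.
move=> gh cw' gE.
have sw : size w = size w'.
  have /eqP := congr1 size gE; rewrite size_rot size_map !size_orbits.
  by rewrite eqn_pmul2l // => /eqP.
have <- : take (size w') (map h (map pi (orbits k p w))) = map h (map pi w).
  by rewrite -!map_take -sw take_orbits.
have -> : map h (map pi (orbits k p w)) = map pi (map g (orbits k p w)).
  by rewrite -!map_comp; apply: eq_map => z /=.
rewrite gE map_rot pi_orbits -(size_map pi w') take_rot_flatten //.
by rewrite size_map.
Qed.

Lemma mem_orbits w z : z \in orbits k p w -> exists a y, y \in w /\ z = iter a k y.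
Proof. by case/flattenP => _ /mapP [a _ ->] /mapP [y yw ->]; exists a, y. Qed.

Lemma io_pi z : z \in v -> io (pi z) = z.
Proof. by rewrite -ioX => /mapP [y _ ->]; rewrite pi_io. Qed.

Lemma pi_normalises (g : automorphism U) a z :
  (exists a, forall z, g (k z) = iter a k (g z)) -> pi (g (iter a k z)) = pi (g z).
Proof.
by move=> [b gb]; elim: a => //= a IH; rewrite gb pi_iter IH.
Qed.

Lemma descend_hom (g : automorphism U) :
  (exists a, forall z, g (k z) = iter a k (g z)) ->
  forall z, pi (g (io (pi z))) = pi (g z).
Proof.
move=> ng; have [_ _ gen] := bs.
apply: (gen L (pi \o g \o io \o pi) (pi \o g) (MU l)).
- exact: hom_comp (hom_comp (hom_comp hpi (hom_aut g)) hio) hpi.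
- exact: hom_comp hpi (hom_aut g).
move=> _ /mem_orbits [a [y [yv ->]]] /=.
by rewrite pi_iter io_pi // pi_normalises.
Qed.

Lemma normalises_descends g : cyc_aut g -> normalises g ->
  exists2 h, cyc_aut h & induces g h.
Proof.
move=> cg ng; have [ng1 ng2] := ng.
have fK (f f' : automorphism U) : (forall z, f' (f z) = z) ->
    (exists a, forall z, f' (k z) = iter a k (f' z)) ->
    cancel (pi \o f \o io) (pi \o f' \o io).
  by move=> ff' nf' y /=; rewrite (descend_hom nf') ff' pi_io.
have K1 : cancel (pi \o g \o io) (pi \o (g^-1)%g \o io).
  by apply: fK => // z; exact: (aut_funK g).
have K2 : cancel (pi \o (g^-1)%g \o io) (pi \o g \o io).
  by apply: fK => // z; exact: (aut_invK g).
have hg := hom_comp (hom_comp hpi (hom_aut g)) hio.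
pose h := Automorphism K1 K2 hg.
have gh : induces g h by move=> z; exact: descend_hom.
exists h => //; have [w [w' [c [vw vw' gE cw']]]] := normalises_form cg ng.
exists (map pi w); split; first exact/OA_cyc/pexp_v_OA.
by rewrite (induces_form gh cw' gE); apply/cyc_rot/OA_cyc/pexp_v_OA.
Qed.

(** If the induced map is trivial, the two sequences of [normalises_form] have the
    same projection and so coincide; the rotation between them is by a multiple
    of the block size, which is how powers of [k] act. *)
Lemma normalises_kernel g h : cyc_aut g -> normalises g -> induces g h ->
  h = 1%g <-> exists a, forall z, g z = iter a k z.
Proof.
move=> cg ng gh; split=> [h1|[a gE]]; last first.
  apply: automorphism_eq => y; rewrite -[in LHS](pi_io y) gh gE pi_iter pi_io.
  by [].
have [w [w' [c [vw vw' gE cw']]]] := normalises_form cg ng.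
have := induces_form gh cw' gE; rewrite h1 map_id => E.
have [ow ow'] := (pexp_v_OA vw, pexp_v_OA vw').
have ww'pi : map pi w = map pi w'.
  by apply: (OA_unique Hv ordS Hb l0 ow ow') => z; rewrite E mem_rot.
have ww' : w = w' by rewrite (pexp_v_lift vw) ww'pi -pexp_v_lift.
have w0 : 0 < size w'.
  by have := OA_size ow'; rewrite size_map; exact: leq_trans.
have c0 : c %% size w' = 0.
  have [uw _ _] := OA_basis Hv l0 ow'.
  apply: rot_uniq_eq0 uw _ _; rewrite ?size_map ?ltn_mod //.
  by rewrite -E ww'pi.
exists (c %/ size w').
have cE : c = c %/ size w' * size w' by rewrite {1}(divn_eq c (size w')) c0 addn0.
have bw := cyc_basis Hv r0 (orbits_cyc vw).
suff : g =1 iter (c %/ size w') k by [].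
apply: (basis_hom_eq (MU r) bw (hom_aut g) (hom_iter _)).
rewrite gE -ww' {1}cE -ww' map_iter_orbits // ww'.
by rewrite -(leq_pmul2r w0) -cE.
Qed.

(** Lift both sequences to all blocks; the resulting automorphism commutes with
    [k] since both are rotations of the same sequence. *)
Lemma normalises_lift h : cyc_aut h -> exists g, [/\ cyc_aut g, normalises g & induces g h].
Proof.
move=> [_ [[n [t [ot ->]]] [n' [t' [ot' hE]]]]].
have [c [ct' {}hE]] : exists c, c < size t' /\ map h t = rot c t'.
  rewrite map_rot in hE; have [n1 E] := rot_back_ex (esym hE).
  have [n2 E'] := rot_rot_ex t' n1 n'; rewrite {}E' in E.
  have [lt|ge] := ltnP n2 (size t'); first by exists n2.
  exists 0; split; first exact: leq_trans (OA_size ot').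
  by rewrite E rot_oversize // rot0.
have [vw vw'] := (OA_pexp_v ot, OA_pexp_v ot').
have [cw cw'] := (orbits_cyc vw, cyc_rot c (orbits_cyc vw')).
have tt' : size t = size t' by rewrite -(size_map h) hE size_rot.
set w := map io t in vw cw; set w' := map io t' in vw' cw'.
have sz : size (orbits k p w) = size (rot c (orbits k p w')).
  by rewrite size_rot !size_orbits !size_map tt'.
have [bw bw'] := (cyc_basis Hv r0 cw, cyc_basis Hv r0 cw').
have [g gE] := basis_aut (MU r) bw bw' (cyc_size r0 cw) sz.
have gk : forall z, g (k z) = k (g z).
  apply: (basis_hom_eq (f := g \o k) (g := k \o g) (MU r) bw).
  - exact: hom_comp (hom_aut g) hk.
  - exact: hom_comp hk (hom_aut g).
  rewrite (map_comp g k) (map_comp k g) gE map_orbits // !map_rot gE map_orbits //.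
  by rewrite /w /w' !size_map tt' rot_rot.
have gVk : forall z, (g^-1)%g (k z) = k ((g^-1)%g z).
  move=> z; rewrite -{1}(aut_invK g z) -gk; exact: (aut_funK g).
exists g; split.
- by exists (orbits k p w); rewrite gE.
- by split; exists 1.
have [_ _ gen] := bw.
apply: (gen L (h \o pi) (pi \o g) (MU l)).
- exact: hom_comp (hom_aut h) hpi.
- exact: hom_comp hpi (hom_aut g).
move=> _ /mem_orbits [a [y [yw ->]]] /=; rewrite pi_iter pi_normalises; last by exists 1.
move: y yw; apply/(@eq_in_map _ _ (h \o pi) (pi \o g)).
rewrite (map_comp h) /w (mapK pi_io) hE (map_comp pi).
have -> : map g (map io t) = take (size t') (rot c (orbits k p w')).
  by rewrite -gE -map_take -tt' -(size_map io t) -/w take_orbits.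
rewrite map_take map_rot pi_orbits /w' (mapK pi_io) take_rot_flatten //; last first.
  by apply: leq_trans (ltnW ct') _; rewrite leq_pmull.
by rewrite modn_small.
Qed.

End Projection.
End Core.

(** * Isomorphisms defined by graphs of homomorphisms *)

Lemma inj_surj_bij (X Y : Type) (f : X -> Y) :
  injective f -> (forall y, exists x, f x = y) -> bijective f.
Proof.
move=> fI fS; have [g gE] := choice fS.
by exists g => // x; apply: fI.
Qed.

Section GroupIsomorphisms.
Local Open Scope group_scope.

Lemma isomorphic_sym (G H : groupType) : isomorphic G H -> isomorphic H G.
Proof.
move=> [f [[g fK gK] fM]]; exists g; split; first by exists f.
by move=> x y; rewrite -[in LHS](gK x) -[in LHS](gK y) -fM fK.
Qed.

Lemma isomorphic_trans (G H L : groupType) :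
  isomorphic G H -> isomorphic H L -> isomorphic G L.
Proof.
move=> [f [bf fM]] [g [bg gM]]; exists (g \o f); split; first exact: bij_comp.
by move=> x y /=; rewrite fM gM.
Qed.

Section Graph.
Variables (G H : groupType) (R : G -> H -> Prop).
Hypotheses (Rtot : forall x, exists y, R x y) (Rsurj : forall y, exists x, R x y).
Hypothesis Rfun : forall x y y', R x y -> R x y' -> y = y'.
Hypothesis RM : forall x x' y y', R x y -> R x' y' -> R (x * x') (y * y').

Lemma graph_morphism : exists f : G -> H,
  [/\ {morph f : x y / x * y}, forall y, exists x, f x = y & forall x, R x (f x)].
Proof.
have [f fR] := choice Rtot; exists f; split=> // [x y|y].
  by apply: Rfun (fR _) _; exact: RM.
by have [x xy] := Rsurj y; exists x; exact: Rfun (fR x) xy.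
Qed.

Lemma graph_isomorphic : (forall x y, R x y -> y = 1 -> x = 1) -> isomorphic G H.
Proof.
move=> ker; have [f [fM fS fR]] := graph_morphism; exists f; split=> //.
apply: inj_surj_bij => // x y fxy.
suff : x * y^-1 = 1 by move=> E; rewrite -(mulgVK y x) E mul1g.
apply: ker (fR _) _.
have f1 : f 1 = 1 by apply: (mulgI (f 1)); rewrite -fM !mulg1.
by rewrite fM fxy -fM mulgV f1.
Qed.
End Graph.

(** Working with graphs avoids choosing the image of an element before knowing that
    it lies in the target group. *)
Lemma weyl_graph_isomorphic (G H : groupType) (K : groupClosed G) (R : NK K -> H -> Prop) :
  (forall x, exists y, R x y) -> (forall y, exists x, R x y) ->
  (forall x y y', R x y -> R x y' -> y = y') ->
  (forall x x' y y', R x y -> R x' y' -> R (x * x') (y * y')) ->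
  (forall x y, R x y -> y = 1 <-> val x \in K) ->
  isomorphic (weyl K) H.
Proof.
move=> Rtot Rsurj Rfun RM ker.
have [f [fM fS fR]] := graph_morphism Rtot Rsurj Rfun RM.
have f1 : f 1 = 1 by apply: (mulgI (f 1)); rewrite -fM !mulg1.
have fE x y : (f x = f y) <-> val (x^-1 * y) \in K.
  rewrite -(ker _ _ (fR _)) fM; have fV : f x^-1 = (f x)^-1.
    by apply: (mulgI (f x)); rewrite -fM !mulgV f1.
  rewrite fV; split=> [->|E]; first by rewrite mulVg.
  by rewrite -[LHS]mulg1 -E mulVKg.
have fpi x : f (repr (\pi_(weyl K) x)%qT) = f x.
  by apply/esym/fE; exact: coset_repr.
exists (fun a : weyl K => f (repr a)); split.
  apply: inj_surj_bij => [a b /fE ab|y].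
    by rewrite -(reprK a) -(reprK b); apply/coset_eqP.
  by have [x <-] := fS y; exists (\pi_(weyl K) x)%qT; exact: fpi.
move=> a b; have [x ->] := weylP a; have [y ->] := weylP b.
rewrite -[_ * _]/(weyl_mul _ _) cosetM !fpi.
exact: fM.
Qed.

End GroupIsomorphisms.

(** * Weyl groups *)

Section Quotients.
Variables (O : signature) (S : laws O).
Hypotheses (Hv : forall m, 1 <= m -> valid S m) (ordS : order_preserving S)
  (Hb : forall m, 1 <= m -> bounded S m).

Let NT : nontrivial S := valid_nontrivial (Hv (isT : 1 <= 2)).
Let MU m : models S (cantor S m) := models_cantor S m.

Variable T : forall m, groupClosed (automorphism (cantor S m)).
Hypothesis TP : forall m, 1 <= m -> forall g, g \in T m <-> cyc_aut g.
Local Notation TT m := (subgroup_type (T m)).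

Lemma cyc_val m (m0 : 0 < m) (x : TT m) : cyc_aut (val x).
Proof. by apply/(TP m0); exact: (valP x). Qed.

Lemma val_TT m (m0 : 0 < m) (g : automorphism (cantor S m)) : cyc_aut g ->
  exists x : TT m, val x = g.
Proof. by move=> /(TP m0) gT; exists (exist _ g gT). Qed.

Section Fixed.
Variables (r : nat) (r0 : 0 < r).
Local Notation U := (cantor S r).

Lemma orbits_aut_cyc (k : automorphism U) p v : 0 < p -> (forall z, iter p k z = z) ->
  ordered_admissible (orbits k p v) -> cyc_aut k.
Proof.
move=> p0 kp osv; exists (orbits k p v); split; first exact: OA_cyc.
by rewrite map_orbits //; apply/cyc_rot/OA_cyc.
Qed.

Lemma val_mul (x y : TT r) z : val (x * y)%g z = val y (val x z).
Proof. by rewrite gmulfM. Qed.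

Lemma valVK (x : TT r) z : val (x^-1)%g (val x z) = z.
Proof. by rewrite -val_mul mulgV. Qed.

Lemma valKV (x : TT r) z : val x (val (x^-1)%g z) = z.
Proof. by rewrite -val_mul mulVg. Qed.

Lemma val_inv (x : TT r) : val (x^-1)%g = (val x)^-1%g.
Proof. by rewrite gmulfV. Qed.

Lemma conj_val (x y : TT r) z : val (y ^ x)%g (val x z) = val x (val y z).
Proof. by rewrite /conjg !val_mul valVK. Qed.

Lemma conj_iter (x y : TT r) (k k' : automorphism U) a :
  (forall z, val x (k z) = k' (val x z)) ->
  (forall z, val y z = iter a k z) <-> (forall z, val (y ^ x)%g z = iter a k' z).
Proof.
move=> xk; have xka z : val x (iter a k z) = iter a k' (val x z).
  by elim: a => //= a IH; rewrite xk IH.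
split=> H z.
  by rewrite -(valKV x z) conj_val H xka.
apply: (can_inj (aut_funK (val x))); rewrite xka -H.
by symmetry; exact: conj_val.
Qed.

Section Cyclic.
Variables (k : automorphism U) (p : nat) (v : seq U).
Hypotheses (p0 : 0 < p) (kp : forall z, iter p k z = z)
  (osv : ordered_admissible (orbits k p v)).
Variable (K : groupClosed (TT r)).
Hypothesis KP : forall x : TT r, x \in K <-> exists a, forall z, val x z = iter a k z.

Lemma iter_normalises (g : automorphism U) b :
  (exists a, forall z, g (k z) = iter a k (g z)) ->
  exists a, forall z, g (iter b k z) = iter a k (g z).
Proof.
move=> [a ga]; exists (b * a); elim: b => //= b IH z.
by rewrite ga IH mulSn iterD.
Qed.

Lemma normaliser_normalises (x : TT r) :
  x \in normaliser K <-> normalises k (val x).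
Proof.
have [kG kGE] := val_TT r0 (orbits_aut_cyc p0 kp osv).
have kK : kG \in K by apply/KP; exists 1 => z; rewrite kGE.
have half (y : TT r) : y \in normaliser K ->
    exists a, forall z, val y (k z) = iter a k (val y z).
  move=> /normaliserP /(_ kG); rewrite kK => /KP [a aE].
  by exists a => z; rewrite -aE conj_val kGE.
split=> [xN|[xk xVk]].
  split; first exact: half.
  by rewrite -val_inv; apply: half; rewrite gpredV.
have conjK (x' y : TT r) : (exists a, forall z, val x' (k z) = iter a k (val x' z)) ->
    y \in K -> (y ^ x')%g \in K.
  move=> /iter_normalises xk' /KP [b bE]; have [a aE] := xk' b.
  by apply/KP; exists a => z; rewrite -(valKV x' z) conj_val bE aE.
apply/normaliserP => y; apply/idP/idP; last exact: conjK.
move=> /(conjK (x^-1)%g); rewrite -conjgM mulgV conjg1; apply.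
by rewrite val_inv.
Qed.

Theorem weyl_orbits : isomorphic (weyl K) (TT (size v)).
Proof.
have l0 := orbits_size_gt0 r0 p0 osv.
have [pi hpi pis] := exists_projection Hv r0 p0 osv.
have [io hio ioX] := exists_section Hv r0 p0 osv.
pose R (x : NK K) (h : TT (size v)) := induces pi (val (val x)) (val h).
have nK (x : NK K) : normalises k (val (val x)) by apply/normaliser_normalises; exact: (valP x).
have io_pi' := pi_io Hv r0 p0 osv hpi hio pis ioX.
have induces_mul (g g' : automorphism U) (h h' : automorphism (cantor S (size v))) :
    induces pi g h -> induces pi g' h' -> induces pi (g * g')%g (h * h')%g.
  by move=> gh gh' z /=; rewrite gh gh'.
have ind_fun (g : automorphism U) (h h' : automorphism (cantor S (size v))) : induces pi g h -> induces pi g h' -> h = h'.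
  by move=> gh gh'; apply: automorphism_eq => y; rewrite -(io_pi' y) gh gh'.
apply: (@weyl_graph_isomorphic _ _ K R).
- move=> x; have [h ch gh] := normalises_descends Hv ordS Hb r0 p0 kp osv hpi hio pis ioX (cyc_val r0 (val x)) (nK x).
  by have [h' h'E] := val_TT l0 ch; exists h'; rewrite /R h'E.
- move=> h; have [g [cg ng gh]] := normalises_lift Hv r0 p0 kp osv hpi hio pis ioX (cyc_val l0 h).
  have [x xE] := val_TT r0 cg; rewrite -xE in ng gh.
  by exists (exist _ x ((normaliser_normalises x).2 ng)).
- by move=> x h h' xh xh'; apply: val_inj; exact: ind_fun xh xh'.
- by move=> x x' h h' xh xh'; rewrite /R !gmulfM; exact: induces_mul.
- move=> x h xh; rewrite KP.
  rewrite -(normalises_kernel Hv ordS Hb r0 p0 kp osv hpi hio pis ioX (cyc_val r0 (val x)) (nK x) xh).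
  by split=> [->//|h1]; apply: val_inj.
Qed.

End Cyclic.

(** The case of the trivial group of rotations: U_r is its own quotient, presented
    with the generators [v]. *)
Theorem T_expansion (v : seq U) : ordered_admissible v ->
  isomorphic (TT r) (TT (size v)).
Proof.
move=> ov; pose k : automorphism U := 1%g.
have orbv : orbits k 1 v = v by rewrite orbitsSr /orbits /= map_id.
have ov' : ordered_admissible (orbits k 1 v) by rewrite orbv.
have p0 : 0 < 1 by [].
have kp : forall z, iter 1 k z = z by [].
have l0 := orbits_size_gt0 r0 p0 ov'.
have iterk a z : iter a k z = z by elim: a.
have [pi hpi pis] := exists_projection Hv r0 p0 ov'.
have [io hio ioX] := exists_section Hv r0 p0 ov'.
have nk (g : automorphism U) : normalises k g by split; exists 0.
have io_pi' := pi_io Hv r0 p0 ov' hpi hio pis ioX.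
apply: (@graph_isomorphic _ _ (fun x h => induces pi (val x) (val h))).
- move=> x; have [h ch gh] := normalises_descends Hv ordS Hb r0 p0 kp ov' hpi hio pis ioX (cyc_val r0 x) (nk _).
  by have [h' h'E] := val_TT l0 ch; exists h'; rewrite h'E.
- move=> h; have [g [cg ng gh]] := normalises_lift Hv r0 p0 kp ov' hpi hio pis ioX (cyc_val l0 h).
  by have [x xE] := val_TT r0 cg; rewrite -xE in gh; exists x.
- move=> x h h' xh xh'; apply/val_inj/automorphism_eq => y.
  by rewrite -(io_pi' y) xh xh'.
- by move=> x x' h h' xh xh' z; rewrite !gmulfM /= xh xh'.
- move=> x h xh h1; have := normalises_kernel Hv ordS Hb r0 p0 kp ov' hpi hio pis ioX (cyc_val r0 x) (nk _) xh.
  rewrite h1 => -[/(_ erefl) [a aE] _]; apply/val_inj/automorphism_eq => z.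
  by rewrite aE iterk.
Qed.

End Fixed.
End Quotients.

(** * Sizes of expansions *)

Section Sizes.
Variable (O : signature).

(** The numbers by which the size of a nonempty sequence can increase. *)
Definition growth (n : nat) := exists c : 'I_(ncolours O) -> nat,
  n = \sum_i c i * (arity i).-1.

Lemma growthD m n : growth m -> growth n -> growth (m + n).
Proof.
move=> [c ->] [c' ->]; exists (fun i => c i + c' i).
by rewrite -big_split; apply: eq_bigr => i _; rewrite mulnDl.
Qed.

Lemma growthM k n : growth n -> growth (k * n).
Proof.
move=> [c ->]; exists (fun i => k * c i); rewrite big_distrr.
by apply: eq_bigr => i _ /=; rewrite mulnA.
Qed.

Lemma growth0 : growth 0.
Proof. by exists (fun=> 0); rewrite big1. Qed.

Lemma growth_arity (i : 'I_(ncolours O)) : growth (arity i).-1.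
Proof.
exists (fun i' => (i' == i : nat)); rewrite (bigD1 i) //= eqxx mul1n big1 ?addn0 //.
by move=> i' /negbTE ->.
Qed.

(** Bezout without subtraction: the gcd is a difference of two growths. *)
Lemma growth_gcd : exists m n, [/\ growth m, growth n & m = sig_gcd O + n].
Proof.
rewrite /sig_gcd; elim/big_ind: _ => [|g h [m [n [gm gn mE]]] [m' [n' [gm' gn' mE']]]|i _].
- by exists 0, 0; split=> //; exact: growth0.
- have [g0|g0] := posnP g; first by exists m', n'; rewrite g0 gcd0n.
  case: (egcdnP h g0) => km kn kE _.
  exists (km * m + kn * n'), (kn * m' + km * n); split.
  + by apply: growthD; exact: growthM.
  + by apply: growthD; exact: growthM.
  + by rewrite mE mE' !mulnDr kE; lia.
- by exists (arity i).-1, 0; rewrite addn0; split=> //; [exact: growth_arity | exact: growth0].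
Qed.

Lemma growth_common_le l l' : l <= l' -> l = l' %[mod sig_gcd O] ->
  exists m n, [/\ growth m, growth n & l + m = l' + n].
Proof.
have [x [y [gx gy xE]]] := growth_gcd.
move=> le /esym/eqP; rewrite eqn_mod_dvd // => /dvdnP [q qE].
exists (q * x), (q * y); split; [exact: growthM | exact: growthM |].
by rewrite xE mulnDr -qE; lia.
Qed.

Lemma growth_common l l' : l = l' %[mod sig_gcd O] ->
  exists m n, [/\ growth m, growth n & l + m = l' + n].
Proof.
move=> E; have [le|/ltnW le] := leqP l l'; first exact: growth_common_le.
by have [m [n [gm gn mE]]] := growth_common_le le (esym E); exists n, m.
Qed.

Lemma pexp_growth (V : omega_algebra O) (s : seq V) n : 0 < size s -> growth n ->
  exists2 t, pexp s t & size t = size s + n.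
Proof.
move=> s0 [c ->]; move: s s0; elim/big_ind: _ => [|x y IHx IHy|i _] s s0.
- by exists s; rewrite ?addn0 //; exact: ord_start.
- have [t st tE] := IHx s s0; have [|u tu uE] := IHy t; first by rewrite tE ltn_addr.
  by exists u; [exact: pexp_trans tu | rewrite uE tE addnA].
- elim: (c i) => [|k [t st tE]]; first by exists s; rewrite ?addn0 //; exact: ord_start.
  case: t st tE => [|y t] st tE; first by move: s0 tE; case: (size s).
  exists (children i y ++ t); first by apply: pexp_trans st _; exact: (pexp1 [::]).
  rewrite size_cat size_children mulSn; move: tE => /=.
  move: (k * _) => x.
  by have := arity_gt1 i; lia.
Qed.

Lemma pexp_size_mod (V : omega_algebra O) (s t : seq V) : pexp s t ->
  size t = size s %[mod sig_gcd O].
Proof.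
elim=> // t1 t2 y i _ <-; rewrite !size_cat size_children /=.
have d_i : sig_gcd O %| (arity i).-1 by apply: biggcdn_inf (dvdnn _).
have -> : size t1 + (arity i + size t2) = size t1 + (size t2).+1 + (arity i).-1.
  by have := arity_gt1 i; lia.
by rewrite -modnDmr (eqP d_i) addn0.
Qed.

End Sizes.

(** * Finite subgroups are generated by rotations *)

Section FiniteSubgroups.
Variables (O : signature) (S : laws O).
Hypotheses (Hv : forall m, 1 <= m -> valid S m) (ordS : order_preserving S)
  (Hb : forall m, 1 <= m -> bounded S m).

Let NT : nontrivial S := valid_nontrivial (Hv (isT : 1 <= 2)).
Let MU m : models S (cantor S m) := models_cantor S m.

(** The action of [k] carries each block of length [l] to the next one. *)
Lemma rotation_orbits (V : omega_algebra O) (k : automorphism V) p l (s : seq V) :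
  models S V -> basis S s -> 0 < p -> p * l = size s -> map k s = rot l s ->
  [/\ forall z, iter p k z = z, s = orbits k p (take l s) &
    forall a, a <= p -> map (iter a k) s = rot (a * l) s].
Proof.
move=> MV bs p0 pE kE.
have kiter a : a <= p -> map (iter a k) s = rot (a * l) s.
  elim: a => [|a IH] ap; first by rewrite rot0 map_id.
  rewrite (eq_map (g := k \o iter a k)) // map_comp IH ?(ltnW ap) // map_rot kE.
  by rewrite rot_rot -rotD ?mulSn // -mulSn -pE leq_mul2r ap orbT.
split=> //.
  suff : iter p k =1 id by [].
  apply: (basis_hom_eq MV bs _ (hom_id V)); last by rewrite kiter // pE rot_size map_id.
  by elim: (p) => [|a IH]; [exact: hom_id | exact: hom_comp (hom_aut k) IH].
have : forall a, a <= p -> take (a * l) s = orbits k a (take l s).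
  elim=> [|a IH] ap; first by rewrite take0.
  have le : a.+1 * l <= size s by rewrite -pE leq_mul2r ap orbT.
  rewrite orbitsSr -IH ?(ltnW ap) // mulSn addnC takeD map_take kiter ?(ltnW ap) //.
  congr (_ ++ _); rewrite /rot takel_cat // size_drop.
  by rewrite mulSn in le; lia.
by move=> /(_ p (leqnn p)); rewrite pE take_size.
Qed.

Section Fixed.
Variables (r : nat) (r0 : 0 < r).
Local Notation U := (cantor S r).
Implicit Types s t u w : seq U.

Lemma OA_least s t : ordered_admissible s -> ordered_admissible t ->
  exists u, [/\ ordered_admissible u, pexp s u, pexp t u &
    forall u', ordered_admissible u' -> pexp s u' -> pexp t u' -> pexp u u'].
Proof.
move=> os ot; have [u [ou su tu [_ _ _ lu]]] := OA_lub Hv ordS Hb r0 os ot.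
exists u; split=> // u' ou' su' tu'.
have [bs bt bu] := And3 (OA_basis Hv r0 os) (OA_basis Hv r0 ot) (OA_basis Hv r0 ou).
have /(adm_le_pexp (MU r) NT bu) [u'' uu'' E] : adm_le [set` u]%classic [set` u']%classic.
  apply: lu; first exact: (admissible_OA NT (Hv r0)).
    exact: (pexp_adm_le (MU r) NT bs).
  exact: (pexp_adm_le (MU r) NT bt).
suff <- : u'' = u' by [].
apply: (OA_unique Hv ordS Hb r0) => //; first exact: pexp_trans uu''.
move=> z; have : [set` u']%classic z = [set` u'']%classic z by rewrite E.
by move=> /= zE; apply/idP/idP; rewrite zE.
Qed.

Lemma OA_least_seq (ts : seq (seq U)) : (forall t, t \in ts -> ordered_admissible t) ->
  exists u, [/\ ordered_admissible u, forall t, t \in ts -> pexp t u &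
    forall u', ordered_admissible u' -> (forall t, t \in ts -> pexp t u') -> pexp u u'].
Proof.
elim: ts => [|t ts IH] ots.
  by exists (generators S r); split=> //; exact: ord_start.
have [t' t'ts|u [ou tu lu]] := IH; first by apply: ots; rewrite inE t'ts orbT.
have [w [ow uw tw lw]] := OA_least ou (ots t (mem_head _ _)).
exists w; split=> // [t'|w' ow' tw'].
  by rewrite inE => /orP [/eqP -> //|/tu t'u]; exact: pexp_trans uw.
apply: lw => //; last by apply: tw'; rewrite mem_head.
by apply: lu => // t' t'ts; apply: tw'; rewrite inE t'ts orbT.
Qed.

Variable gs : seq (automorphism U).
Hypotheses (gs1 : 1%g \in gs) (gsM : forall g h, g \in gs -> h \in gs -> (g * h)%g \in gs)
  (gsV : forall g, g \in gs -> (g^-1)%g \in gs) (gsT : forall g, g \in gs -> cyc_aut g).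

(** Finitely many elements of the group are all defined by a single source
    sequence, by successive common refinement. *)
Lemma finite_domain : exists2 s, ordered_admissible s &
  forall g, g \in gs -> cyc_adm (map g s).
Proof.
have : forall hs : seq (automorphism U), (forall g, g \in hs -> cyc_aut g) ->
    exists2 s, ordered_admissible s & forall g, g \in hs -> cyc_adm (map g s).
  elim=> [|h hs IH] hsT; first by exists (generators S r) => //; exact: ord_start.
  have [g ghs|s os sP] := IH; first by apply: hsT; rewrite inE ghs orbT.
  have [t [ct cht]] := hsT h (mem_head _ _).
  have [u [j [k [ou su tu]]]] := cyc_refine Hv ordS Hb r0 (OA_cyc os) ct.
  have back (g : automorphism U) n : cyc_adm (map g (rot n u)) -> cyc_adm (map g u).
    by have [n' E] := rot_back_ex (erefl (rot n u)); rewrite {2}E [X in _ -> cyc_adm X]map_rot; exact: cyc_rot.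
  exists u => // g; rewrite inE => /orP [/eqP ->|/sP cg].
    by have [_ /back] := cyc_aut_pexp ct cht tu.
  by have [_ /back] := cyc_aut_pexp (OA_cyc os) cg su.
exact.
Qed.

Lemma pexp_rot_OA n s t : ordered_admissible s -> ordered_admissible t ->
  pexp s (rot n t) -> pexp s t.
Proof.
move=> os ot st; suff <- : rot n t = t by [].
apply: (OA_unique Hv ordS Hb r0) => //; first exact: pexp_trans st.
by move=> z; rewrite mem_rot.
Qed.

(** The least common expansion of the translates of [s] is carried by each group
    element to a common expansion of the same translates; it is below its own
    image, which has the same size, so it is fixed up to rotation. *)
Lemma invariant_basis : exists2 t, ordered_admissible t &
  forall g, g \in gs -> exists n, map g t = rot n t.
Proof.
have [s os sP] := finite_domain.
have /choice [W WP] : forall g, exists w, g \in gs ->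
    ordered_admissible w /\ exists n, map g s = rot n w.
  move=> g; case: (boolP (g \in gs)) => [/sP [n [w [ow wE]]]|_]; last by exists s.
  by exists w => _; split=> //; exists n.
have [t [ot Wt lt]] : exists u, [/\ ordered_admissible u,
    forall t, t \in map W gs -> pexp t u &
    forall u', ordered_admissible u' -> (forall t, t \in map W gs -> pexp t u') -> pexp u u'].
  by apply: OA_least_seq => _ /mapP [g gg ->]; case: (WP g gg).
have {}Wt g : g \in gs -> pexp (W g) t by move=> gg; apply: Wt; rewrite map_f.
have {}lt u' : ordered_admissible u' -> (forall g, g \in gs -> pexp (W g) u') -> pexp t u'.
  by move=> ou' H; apply: lt => // _ /mapP [g gg ->]; exact: H.
have st : pexp s t.
  have [oW [n sE]] := WP _ gs1; suff -> : s = W 1%g by exact: Wt.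
  apply: (OA_unique Hv ordS Hb r0) => // z.
  by rewrite -[in RHS](mem_rot n) -sE map_id.
exists t => // g gg.
have [n [t' [ot' gE]]] : cyc_adm (map g t).
  by apply: cyc_pexp (sP g gg) _; exact: pexp_map (hom_aut g) st.
suff tt' : pexp t t'.
  have sz : size t = size t' by have := congr1 size gE; rewrite size_rot size_map.
  by exists n; rewrite gE -(pexp_size_eq tt' sz).
apply: lt => // h hg; pose h' := (h * g^-1)%g.
have h'g : h' \in gs by apply: gsM => //; exact: gsV.
have [oW [n1 hE]] := WP h hg; have [oW' [n2 h'E]] := WP h' h'g.
have hsE : map h s = map g (map h' s).
  rewrite -!map_comp; apply: eq_map => z /=.
  by symmetry; exact: (aut_invK g).
rewrite hE h'E map_rot in hsE.
have [n3 WE] := rot_back_ex hsE.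
have [n4 E4] := rot_rot_ex (W h) n3 n1; rewrite E4 in WE.
have := pexp_map (hom_aut g) (Wt h' h'g); rewrite WE gE => /pexp_rot_inv [n5].
have [n6 ->] := rot_rot_ex t' n5 n; exact: pexp_rot_OA.
Qed.

(** The rotation amounts form a subgroup of the cyclic group, so they are the
    multiples of the least positive one. *)
Lemma invariant_orbits : exists (k : automorphism U) p v,
  [/\ 0 < p, forall z, iter p k z = z, ordered_admissible (orbits k p v) &
    forall g, g \in gs <-> exists a, forall z, g z = iter a k z].
Proof.
have [t ot tP] := invariant_basis.
have bt := OA_basis Hv r0 ot; have [ut _ _] := bt.
have t0 : 0 < size t by exact: leq_trans r0 (OA_size ot).
pose Q n := (0 < n) && has (fun g : automorphism U => map g t == rot n t) gs.
have exQ : exists n, Q n.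
  exists (size t); rewrite /Q t0; apply/hasP; exists 1%g => //.
  by rewrite rot_size map_id.
case: (ex_minnP exQ) => l /andP [l0 /hasP [k kg /eqP kE]] lmin.
have lt : l <= size t.
  apply: lmin; rewrite /Q t0; apply/hasP; exists 1%g => //.
  by rewrite rot_size map_id.
have gsX a : exists2 h, h \in gs & forall z, h z = iter a k z.
  elim: a => [|a [h hg hE]]; first by exists 1%g.
  by exists (h * k)%g; [exact: gsM | move=> z /=; rewrite hE].
have kiter a : a * l <= size t -> map (iter a k) t = rot (a * l) t.
  elim: a => [|a IH] le; first by rewrite rot0 map_id.
  have le' : a * l <= size t by apply: leq_trans le; rewrite leq_mul2r leqnSn orbT.
  rewrite (eq_map (g := k \o iter a k)) // map_comp IH // map_rot kE.
  by rewrite rot_rot -rotD ?mulSn //; rewrite -mulSn.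
have dv g n : g \in gs -> n <= size t -> map g t = rot n t -> l %| n.
  move=> gg nt gE; rewrite /dvdn; apply: contraT; rewrite -lt0n => b0.
  have : l <= n %% l.
    apply: lmin; rewrite /Q b0; have [h hg hE] := gsX (n %/ l).
    apply/hasP; exists (g * h^-1)%g; first by apply: gsM => //; exact: gsV.
    have le : n %/ l * l <= size t by apply: leq_trans nt; exact: leq_trunc_div.
    rewrite map_autM gE {1}(divn_eq n l) addnC rotD; last first.
      by rewrite addnC -divn_eq.
    rewrite -kiter // -(eq_map hE) -map_rot map_autK //.
  by rewrite leqNgt ltn_mod l0.
have lsz : l %| size t.
  by apply: (dv 1%g) => //; rewrite rot_size map_id.
pose p := size t %/ l; have pE : p * l = size t by rewrite divnK.
have p0 : 0 < p by rewrite divn_gt0.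
have [kp torb _] := rotation_orbits (MU r) bt p0 pE kE.
exists k, p, (take l t); split=> //; first by rewrite -torb.
move=> g; split=> [gg|[a aE]]; last first.
  have [h hg hE] := gsX a; suff -> : g = h by [].
  by apply: automorphism_eq => z; rewrite aE hE.
have [n gE] := tP g gg; rewrite rot_minn in gE.
have ldv := dv g _ gg (geq_minr _ _) gE.
have [h hg hE] := gsX (minn n (size t) %/ l); exists (minn n (size t) %/ l) => z.
rewrite -hE; suff -> : g = h by [].
apply: (basis_aut_eq (MU r) bt); rewrite gE (eq_map hE) kiter divnK //.
exact: geq_minr.
Qed.

End Fixed.
End FiniteSubgroups.

(** * Invariance of the finiteness property under group isomorphism *)

Section Restriction.
Import GRing.Theory.
Local Open Scope ring_scope.

Definition restriction (R R' : nzRingType) (psi : R' -> R) (M : lmodType R) : Type := M.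

Section Instance.
Variables (R R' : nzRingType) (psi : {rmorphism R' -> R}) (M : lmodType R).
Local Notation N := (restriction psi M).

HB.instance Definition _ := GRing.Zmodule.on N.

Definition restriction_scale (a : R') (m : N) : N := psi a *: (m : M).

Lemma restriction_scaleA a b m :
  restriction_scale a (restriction_scale b m) = restriction_scale (a * b) m.
Proof. by rewrite /restriction_scale scalerA rmorphM. Qed.
Lemma restriction_scale1 : left_id 1 restriction_scale.
Proof. by move=> m; rewrite /restriction_scale rmorph1 scale1r. Qed.
Lemma restriction_scaleDr : right_distributive restriction_scale +%R.
Proof. by move=> a u v; rewrite /restriction_scale scalerDr. Qed.
Lemma restriction_scaleDl m : {morph restriction_scale^~ m : a b / a + b}.
Proof. by move=> a b; rewrite /restriction_scale rmorphD scalerDl. Qed.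

HB.instance Definition _ := GRing.Zmodule_isLmodule.Build R' N
  restriction_scaleA restriction_scale1 restriction_scaleDr restriction_scaleDl.

End Instance.

Lemma linear_of_fun (R : nzRingType) (M N : lmodType R) (f : M -> N) :
  (forall a x y, f (a *: x + y) = a *: f x + f y) ->
  exists g : {linear M -> N}, g =1 f.
Proof.
move=> fl; pose m := GRing.isLinear.Build R M N *:%R f fl.
pose g : {linear M -> N} := HB.pack f m.
by exists g.
Qed.

Lemma restrictionE (R R' : nzRingType) (psi : {rmorphism R' -> R}) (M : lmodType R)
  (a : R') (x : restriction psi M) : a *: x = psi a *: (x : M).
Proof. by []. Qed.

Section Transfer.
Variables (R R' : nzRingType) (psi : {rmorphism R -> R'}) (psi' : {rmorphism R' -> R}).
Hypotheses (psiK : cancel psi psi') (psi'K : cancel psi' psi).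

Lemma restriction_fg (P : lmodType R) :
  finitely_generated P -> finitely_generated (restriction psi' P).
Proof.
move=> [n [e eP]]; exists n, e => m; have [c cE] := eP m.
exists (psi \o c); rewrite [LHS]cE; apply: eq_bigr => i _.
by rewrite restrictionE /= psiK.
Qed.

(** A lifting problem over [R'] restricts along [psi] to one over [R], and its
    solution is linear over [R'] since [psi] and [psi'] are mutually inverse. *)
Lemma restriction_projective (P : lmodType R) :
  projective P -> projective (restriction psi' P).
Proof.
move=> prP A B f g fs.
have [f1 f1E] : exists f1 : {linear restriction psi A -> restriction psi B}, f1 =1 f.
  by apply: linear_of_fun => a x y; rewrite !restrictionE linearP.
have [g1 g1E] : exists g1 : {linear P -> restriction psi B}, g1 =1 g.
  apply: linear_of_fun => a x y; rewrite restrictionE -linearP.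
  by rewrite restrictionE psiK.
have [|h hE] := prP _ _ f1 g1.
  by move=> b _; have [a _ ab] := fs b I; exists a => //; rewrite f1E.
have [h1 h1E] : exists h1 : {linear restriction psi' P -> A}, h1 =1 h.
  apply: linear_of_fun => a x y; rewrite restrictionE.
  by rewrite (linearP h) restrictionE psi'K.
by exists h1 => x; rewrite h1E -f1E hE g1E.
Qed.

End Transfer.
End Restriction.

Section GroupRingMap.
Local Open Scope fset_scope.
Import GRing.Theory.
Local Open Scope ring_scope.

Definition group_ring_map (G H : groupType) (f : G -> H) (z : group_ring G) : group_ring H :=
  \sum_(k <- msupp z) << z@_k *g f k >>.

Section Fixed.
Variables (G H : groupType) (f : G -> H).
Local Notation F := (group_ring_map f).

Lemma group_ring_mapw (d : {fset G}) (z : group_ring G) : msupp z `<=` d ->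
  F z = \sum_(k <- d) << z@_k *g f k >>.
Proof.
move=> le; rewrite /group_ring_map (big_fset_incl _ le) // => x _ /mcoeff_outdom ->.
by rewrite monalgU0.
Qed.

Lemma group_ring_mapU c k : F << c *g k >> = << c *g f k >>.
Proof. by rewrite (group_ring_mapw msuppU_le) big_seq_fset1 mcoeffUU. Qed.

Lemma group_ring_map0 : F 0 = 0.
Proof. by rewrite /group_ring_map msupp0 big_seq_fset0. Qed.

Lemma group_ring_mapD z1 z2 : F (z1 + z2) = F z1 + F z2.
Proof.
rewrite (group_ring_mapw (msuppD_le _ _)) (group_ring_mapw (fsubsetUl _ (msupp z2))).
rewrite (group_ring_mapw (fsubsetUr (msupp z1) _)) -big_split /=.
by apply: eq_bigr => k _; rewrite mcoeffD monalgUD.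
Qed.

Lemma group_ring_map_augmentation z : augmentation (F z) = augmentation z.
Proof.
rewrite /group_ring_map (big_morph _ (@augmentationD H) (@augmentation0 H)).
by apply: eq_bigr => k _; rewrite augmentationU.
Qed.

Hypothesis fM : {morph f : x y / (x * y)%g}.

Lemma group_ring_mapM z1 z2 : F (z1 * z2) = F z1 * F z2.
Proof.
rewrite [F z1]/group_ring_map mulr_suml.
rewrite (big_morph _ group_ring_mapD group_ring_map0).
apply: eq_bigr => k1 _; rewrite (big_morph _ group_ring_mapD group_ring_map0).
rewrite [F z2]/group_ring_map mulr_sumr; apply: eq_bigr => k2 _.
by rewrite group_ring_mapU [RHS]zg_mulUU fM.
Qed.

Lemma group_ring_map1 : F 1 = 1.
Proof.
rewrite [LHS]group_ring_mapU; congr << _ *g _ >>.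
by apply: (mulgI (f 1%g)); rewrite -fM !mulg1.
Qed.

Lemma group_ring_morphism : exists F' : {rmorphism group_ring G -> group_ring H}, F' =1 F.
Proof.
have FB : {morph F : x y / x - y}.
  move=> x y; apply/eqP; rewrite eq_sym subr_eq -group_ring_mapD subrK //.
pose mA := GRing.isZmodMorphism.Build _ _ F FB.
pose mM := GRing.isMonoidMorphism.Build _ _ F (group_ring_map1, group_ring_mapM).
pose F' : {rmorphism group_ring G -> group_ring H} := HB.pack F mA mM.
by exists F'.
Qed.

End Fixed.

Lemma group_ring_mapK (G H : groupType) (f : G -> H) (g : H -> G) : cancel f g ->
  cancel (group_ring_map f) (group_ring_map g).
Proof.
move=> fK z; rewrite [in RHS](monalgE z) [group_ring_map f z]/group_ring_map.
rewrite (big_morph _ (group_ring_mapD g) (group_ring_map0 g)).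
by apply: eq_bigr => k _; rewrite group_ring_mapU fK.
Qed.

Lemma FPinfty_isomorphic (G H : groupType) : isomorphic G H -> FPinfty G -> FPinfty H.
Proof.
move=> [f [[f' fK f'K] fM]] [P [d [eps [Pfg epsS d0 dn]]]].
have f'M : {morph f' : x y / (x * y)%g} by move=> x y; rewrite -[in LHS](f'K x) -[in LHS](f'K y) -fM fK.
have [psi psiE] := group_ring_morphism fM.
have [psi' psi'E] := group_ring_morphism f'M.
have psiK : cancel psi psi' by move=> z; rewrite psi'E psiE group_ring_mapK.
have psi'K : cancel psi' psi by move=> z; rewrite psiE psi'E group_ring_mapK.
have lind n : exists d' : {linear restriction psi' (P n.+1) -> restriction psi' (P n)}, d' =1 d n.
  by apply: linear_of_fun => a x y; rewrite !restrictionE linearP.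
have [eps' eps'E] : exists eps' : {linear restriction psi' (P 0%N) -> trivial_module H}, eps' =1 eps.
  apply: linear_of_fun => a x y; rewrite restrictionE linearP.
  congr (_ + _); change (augmentation (psi' a) * eps x = augmentation a * eps x).
  by rewrite psi'E group_ring_map_augmentation.
exists (fun n => restriction psi' (P n)), (fun n => sval (cid (lind n))), eps'.
have d'E n : sval (cid (lind n)) =1 d n := svalP (cid (lind n)).
split.
- by move=> n; have [fg pr] := Pfg n; split; [exact: restriction_fg psiK _ fg | exact: restriction_projective].
- by move=> m _; have [x _ xm] := epsS m I; exists x => //; rewrite eps'E.
- have -> : eps' = eps :> (P 0%N -> int) by exact: funext eps'E.
  have -> : sval (cid (lind 0%N)) = d 0%N :> (P 1%N -> P 0%N) by exact: funext (d'E _).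
  exact: d0.
- move=> n; have -> : sval (cid (lind n)) = d n :> (P n.+1 -> P n) by exact: funext (d'E _).
  have -> : sval (cid (lind n.+1)) = d n.+1 :> (P n.+2 -> P n.+1) by exact: funext (d'E _).
  exact: dn.
Qed.

End GroupRingMap.

(** * Conjugacy classes and the main equivalence *)

Lemma conj_class_conj (G : groupType) (K L : groupClosed G) (x : G) :
  (forall y, y \in K <-> (y ^ x)%g \in L) -> conj_class K = conj_class L.
Proof.
move=> KL; apply/seteqP; split=> _ [w _ <-].
  exists (x^-1 * w)%g => //; apply/seteqP; split=> _ [y yK <-].
    exists (y ^ x^-1)%g; last by rewrite -conjgM.
    by apply/KL; rewrite -conjgM mulVg conjg1.
  exists (y ^ x)%g; first exact/KL.
  by rewrite -conjgM mulVKg.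
exists (x * w)%g => //; apply/seteqP; split=> _ [y yK <-].
  by exists (y ^ x)%g; [exact/KL | rewrite -conjgM].
exists (y ^ x^-1)%g; last by rewrite -conjgM mulKg.
by apply/KL; rewrite -conjgM mulVg conjg1.
Qed.

Section Main.
Variables (O : signature) (S : laws O).
Hypotheses (Hv : forall m, 1 <= m -> valid S m) (ordS : order_preserving S)
  (Hb : forall m, 1 <= m -> bounded S m).

Let NT : nontrivial S := valid_nontrivial (Hv (isT : 1 <= 2)).
Let MU m : models S (cantor S m) := models_cantor S m.

Variable T : forall m, groupClosed (automorphism (cantor S m)).
Hypothesis TP : forall m, 1 <= m -> forall g, g \in T m <-> cyc_aut g.
Local Notation TT m := (subgroup_type (T m)).
Local Notation d := (sig_gcd O).

Lemma T_congruent l l' : 0 < l -> 0 < l' -> l = l' %[mod d] ->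
  isomorphic (TT l) (TT l').
Proof.
move=> l0 l0' /growth_common [m [n [gm gn E]]].
have T_add q x : 0 < q -> growth O x -> isomorphic (TT q) (TT (q + x)).
  move=> q0 gx; have sz : size (generators S q) = q by rewrite size_map size_enum_ord.
  have [|t ot tE] := @pexp_growth _ _ (generators S q) x _ gx; first by rewrite sz.
  rewrite sz in tE; rewrite -tE; exact: (T_expansion Hv ordS Hb TP q0).
apply: isomorphic_trans (T_add _ _ l0 gm) _; rewrite E.
exact/isomorphic_sym/T_add.
Qed.

Section Fixed.
Variables (r : nat) (r0 : 0 < r).
Local Notation U := (cantor S r).

(** [K] is generated by [k], which rotates [p] blocks starting with [v]. *)
Definition orbit_form (K : groupClosed (TT r)) (k : automorphism U) p v :=
  [/\ 0 < p, forall z, iter p k z = z, ordered_admissible (orbits k p v) &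
    forall x : TT r, x \in K <-> exists a, forall z, val x z = iter a k z].

Lemma finite_orbit_form (K : groupClosed (TT r)) : finite_set [set` K]%classic ->
  exists k p v, orbit_form K k p v.
Proof.
move=> /finite_seqP [ks KE].
have memK x : (x \in K) = (x \in ks).
  by apply/idP/idP => xK; have := xK; rewrite -?[is_true (x \in K)]/([set` K]%classic x) ?KE //;
    rewrite -[is_true (x \in ks)]/([set` ks]%classic x) -KE.
have memg g : g \in map val ks <-> exists2 x : TT r, x \in K & val x = g.
  split=> [/mapP [x xks ->]|[x xK <-]]; first by exists x; rewrite ?memK.
  by rewrite map_f // -memK.
have [||||k [p [v [p0 kp ov gP]]]] := @invariant_orbits _ _ Hv ordS Hb r r0 (map val ks).
- by apply/memg; exists 1%g => //; exact: gpred1.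
- move=> g h /memg [x xK <-] /memg [y yK <-]; apply/memg; exists (x * y)%g.
    exact: gpredM.
  exact: gmulfM.
- move=> g /memg [x xK <-]; apply/memg; exists (x^-1)%g; first by rewrite gpredV.
  exact: gmulfV.
- by move=> g /memg [x _ <-]; exact: (cyc_val TP r0).
exists k, p, v; split=> // x; rewrite -gP memg.
by split=> [xK|[y yK /val_inj <- //]]; exists x.
Qed.

(** Powers of [k] below [p] are distinct because they rotate a basis by distinct
    amounts. *)
Lemma orbit_form_card (K : groupClosed (TT r)) k p v : orbit_form K k p v ->
  exists f : 'I_p -> subgroup_type K, bijective f.
Proof.
move=> [p0 kp ov KP].
have [kG kGE] := val_TT TP r0 (orbits_aut_cyc p0 kp ov).
have iterG a : exists x : TT r, forall z, val x z = iter a k z.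
  elim: a => [|a [x xE]]; first by exists 1%g.
  by exists (x * kG)%g => z; rewrite val_mul xE kGE.
have /choice [f fE] : forall a : 'I_p, exists x : subgroup_type K,
    forall z, val (val x) z = iter a k z.
  move=> a; have [x xE] := iterG a.
  have xK : x \in K by apply/KP; exists a.
  by exists (exist _ x xK).
have iter_mod a z : iter a k z = iter (a %% p) k z.
  rewrite {1}(divn_eq a p) addnC iterD; congr iter.
  by elim: (a %/ p) => //= q IH; rewrite mulSn iterD IH kp.
exists f; apply: inj_surj_bij => [a b fab|x]; last first.
  have [a aE] := (KP (val x)).1 (valP x).
  exists (Ordinal (ltn_pmod a p0)); apply/val_inj/val_inj/automorphism_eq => z.
  by rewrite fE aE [RHS]iter_mod.
have l0 := orbits_size_gt0 r0 p0 ov.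
have [uo _ _] := OA_basis Hv r0 ov.
have E z : iter a k z = iter b k z by rewrite -!fE fab.
wlog ab : a b E {fab} / a <= b.
  move=> H; have [ab|/ltnW ba] := leqP a b; first exact: H.
  by apply/esym/H.
have kI : injective (iter a k).
  by elim: (nat_of_ord a) => // n IH x y /= /(can_inj (aut_funK k)); exact: IH.
have idk z : iter (b - a) k z = z.
  by apply: kI; rewrite -iterD subnKC.
have bp := ltn_ord b.
have : (b - a) * size v = 0.
  apply: (rot_uniq_eq0 uo); first by rewrite size_orbits ltn_mul2r l0; lia.
  rewrite -map_iter_orbits //; last by lia.
  by rewrite (eq_map idk) map_id.
move/eqP; rewrite muln_eq0 (gtn_eqF l0) orbF subn_eq0 => ba.
by apply/val_inj/eqP; rewrite eqn_leq ab.
Qed.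

(** Expanding [v] and [v'] inside their orbits to equal size leaves the groups
    unchanged, and the automorphism matching the two sequences conjugates one
    generator to the other. *)
Lemma orbit_form_conj (K L : groupClosed (TT r)) k k' p v v' :
  orbit_form K k p v -> orbit_form L k' p v' -> size v = size v' %[mod d] ->
  conj_class K = conj_class L.
Proof.
move=> [p0 kp ov KP] [_ kp' ov' LP] /growth_common [m [n [gm gn E]]].
have [w vw wE] := pexp_growth (orbits_size_gt0 r0 p0 ov) gm.
have [w' vw' wE'] := pexp_growth (orbits_size_gt0 r0 p0 ov') gn.
have cw := orbits_cyc ov vw; have cw' := orbits_cyc ov' vw'.
have sz : size (orbits k p w) = size (orbits k' p w').
  by rewrite !size_orbits wE wE' E.
have bw := cyc_basis Hv r0 cw.
have [g gE] := basis_aut (MU r) bw (cyc_basis Hv r0 cw') (cyc_size r0 cw) sz.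
have gk : forall z, g (k z) = k' (g z).
  apply: (basis_hom_eq (f := g \o k) (g := k' \o g) (MU r) bw).
  - exact: hom_comp (hom_aut g) (hom_aut k).
  - exact: hom_comp (hom_aut k') (hom_aut g).
  rewrite (map_comp g k) (map_comp k' g) gE !map_orbits // map_rot gE.
  by rewrite wE wE' E.
have [x xE] : exists x : TT r, val x = g.
  by apply: (val_TT TP r0); exists (orbits k p w); rewrite gE.
apply: (@conj_class_conj _ _ _ x) => y; rewrite KP LP.
have xk z : val x (k z) = k' (val x z) by rewrite xE.
by split=> -[a aE]; exists a; apply/(conj_iter y a xk).
Qed.

(** A group isomorphic to [K] is finite with the same order [p], so its class
    depends only on the residue of its number of orbits. *)
Lemma finitely_many_classes (K : groupClosed (TT r)) : 0 < d -> finite_set [set` K]%classic ->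
  finite_set [set conj_class L | L in
    [set L : groupClosed (TT r) | isomorphic (subgroup_type L) (subgroup_type K)]]%classic.
Proof.
move=> d0 fK; have [k [p [v fo]]] := finite_orbit_form fK.
have [f bf] := orbit_form_card fo.
pose C c : set (set (set (TT r))) := fun X => exists L k' v',
  [/\ X = conj_class L, orbit_form L k' p v' & size v' %% d = c].
have finC c : finite_set (C c).
  have [[X CX]|noX] := pselect (exists X, C c X); last first.
    suff -> : C c = set0 by [].
    by apply/seteqP; split=> // X CX; case: noX; exists X.
  apply: (@sub_finite_set _ _ [set X]%classic) => // Y [L [k1 [v1 [-> o1 c1]]]] /=.
  have [L' [k2 [v2 [-> o2 c2]]]] := CX.
  by apply: (orbit_form_conj o1 o2); rewrite c1 c2.
apply: (@sub_finite_set _ _ (\bigcup_(c in `I_d) C c)%classic); last exact: bigcup_finite.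
move=> _ [L /= [h [bh _]] <-].
have [h' hK h'K] := bh; have bh' : bijective h' by exists h.
have bg := bij_comp bh' bf.
have fL : finite_set [set` L]%classic.
  apply: (@sub_finite_set _ _ ((fun a => val (h' (f a))) @` [set: 'I_p])%classic).
    move=> x xL; have [g gK g'K] := bg.
    by exists (g (exist _ x xL)) => //; rewrite -[h' _]/((h' \o f) _) g'K.
  exact/finite_image/finite_finset.
have [k' [p' [v' fo']]] := finite_orbit_form fL.
have pp' : p' = p.
  have [f' bf'] := orbit_form_card fo'.
  by have [g gK g'K] := bg; have /bij_eq_card := bij_comp (Bijective g'K gK) bf'; rewrite !card_ord.
subst p'; exists (size v' %% d); first by rewrite /= ltn_mod.
by exists L, k', v'.
Qed.

(** Bezout gives [p] with p l = r modulo d, and suitable expansions make the two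
    sides equal; the group is generated by the rotation of a sequence of that
    length by a [p]-th of a turn. *)
Lemma exists_orbit_form l : 0 < d -> 0 < l -> gcdn l d %| r ->
  exists (K : groupClosed (TT r)) k p v,
    [/\ orbit_form K k p v, 0 < size v & size v = l %[mod d]].
Proof.
move=> d0 l0 ldr.
have [p p0 plr] : exists2 p, 0 < p & p * l = r %[mod d].
  have [q qE] := dvdnP ldr.
  have := egcdnP d l0; case=> km kn kE _.
  exists (q * km); last by rewrite -mulnA kE mulnDr -qE mulnA modnMDl.
  rewrite muln_gt0; apply/andP; split; first by case: (q) qE r0 => [->|].
  have g0 : 0 < gcdn l d by rewrite gcdn_gt0 l0.
  by case: (km) kE => //; lia.
have [m [n [gm gn E]]] := growth_common (esym plr).
have szX : size (generators S r) = r by rewrite size_map size_enum_ord.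
(* As r + m = p l + n, growing by (p - 1) n more makes the size p (l + n). *)
have [||s os sE] := @pexp_growth _ _ (generators S r) (m + p.-1 * n).
- by rewrite szX.
- by apply: growthD => //; exact: growthM.
have {}sE : size s = p * (l + n).
  by rewrite sE szX addnA E; case: (p) p0 => //= p' _; lia.
pose l' := l + n; have bs := OA_basis Hv r0 os.
have s0 : 0 < size s by rewrite sE muln_gt0 p0; lia.
have [|k kE] := basis_aut (MU r) bs (basis_rot l' bs) s0; first by rewrite size_rot.
have [kp sorb _] := rotation_orbits (MU r) bs p0 (esym sE) kE.
have ov : ordered_admissible (orbits k p (take l' s)) by rewrite -sorb.
have [kG kGE] := val_TT TP r0 (orbits_aut_cyc p0 kp ov).
have kpa a z : iter (p * a) k z = z.
  by elim: a => [|a IH]; rewrite ?muln0 // mulnS iterD IH kp.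
pose P : {pred TT r} := fun x => `[< exists a, forall z, val x z = iter a k z >].
have PE x : x \in P <-> exists a, forall z, val x z = iter a k z.
  by rewrite unfold_in; split=> /asboolP.
have PM : mulg_closed P.
  move=> x y /PE [a aE] /PE [b bE]; apply/PE; exists (b + a) => z.
  by rewrite val_mul bE aE iterD.
have P1 : 1%g \in P by apply/PE; exists 0.
have PV : invg_closed P.
  move=> x /PE [a aE]; apply/PE; exists (p.-1 * a) => z.
  apply: (can_inj (aut_funK (val x))); rewrite [LHS]valKV aE -iterD.
  by rewrite -mulSn prednK.
pose mM := isMulClosed.Build _ P PM.
pose m1 := isMul1Closed.Build _ P P1.
pose mV := isInvClosed.Build _ P PV.
pose K : groupClosed (TT r) := HB.pack P mM m1 mV.
exists K, k, p, (take l' s); have l's : l' <= size s by rewrite sE leq_pmull.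
rewrite (size_takel l's); split=> //; first by rewrite /l' addn_gt0 l0.
have [c nE] : exists c, n = c * d.
  apply/dvdnP; have [c ->] := gn; apply: dvdn_sum => i _.
  by apply: dvdn_mull; exact: biggcdn_inf (dvdnn _).
by rewrite /l' nE addnC modnMDl.
Qed.

End Fixed.

Theorem quasi_FPinfty_T r : 1 <= r <= d ->
  quasi_FPinfty (TT r) <->
  forall l, 1 <= l <= d -> gcdn l d %| r -> FPinfty (TT l).
Proof.
move=> /andP [r0 rd]; have d0 : 0 < d by exact: leq_trans rd.
split=> [qF l /andP [l0 _] ldr|F K fK].
  have [K [k [p [v [fo v0 vl]]]]] := exists_orbit_form r0 d0 l0 ldr.
  have fK : finite_set [set` K]%classic.
    have [f [g gK g'K]] := orbit_form_card r0 fo.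
    apply: (@sub_finite_set _ _ ((fun a => val (f a)) @` [set: 'I_p])%classic).
      by move=> x xK; exists (g (exist _ x xK)); rewrite // g'K.
    exact/finite_image/finite_finset.
  have [_ FW] := qF K fK; have [p0 kp ov KP] := fo.
  have := weyl_orbits Hv ordS Hb TP r0 p0 kp ov KP => iso.
  apply: FPinfty_isomorphic FW; apply: isomorphic_trans iso _.
  exact: T_congruent.
split; first exact: finitely_many_classes.
have [k [p [v fo]]] := finite_orbit_form r0 fK; have [p0 kp ov KP] := fo.
have v0 := orbits_size_gt0 r0 p0 ov.
(* The representative of the residue of [size v] in the interval from 1 to d. *)
pose l := if size v %% d == 0 then d else size v %% d.
have lv : l = size v %[mod d].
  by rewrite /l; case: eqP => [->|_]; rewrite ?modnn // modn_mod.
have l1 : 1 <= l <= d.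
  rewrite /l; case: eqP => [_|/eqP]; first by rewrite d0 leqnn.
  by rewrite lt0n => ->; rewrite ltnW // ltn_mod.
have [l0 _] := andP l1.
have lr : gcdn l d %| r.
  rewrite -gcdn_modl lv gcdn_modl.
  have sz : p * size v = r %[mod d].
    by rewrite -(size_orbits k p v) (pexp_size_mod ov) size_map size_enum_ord.
  rewrite /dvdn -(modn_dvdm r (dvdn_gcdr (size v) d)) -sz modn_dvdm ?dvdn_gcdr //.
  by rewrite -/(dvdn _ _) dvdn_mull // dvdn_gcdl.
apply: FPinfty_isomorphic (F l l1 lr); apply: isomorphic_sym.
apply: isomorphic_trans (weyl_orbits Hv ordS Hb TP r0 p0 kp ov KP) _.
exact: T_congruent.
Qed.

End Main.

Theorem theorem7p1 (O : signature) (S : laws O) (r : nat) :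
  (forall m, 1 <= m -> valid S m) ->
  order_preserving S ->
  (forall m, 1 <= m -> bounded S m) ->
  1 <= r <= sig_gcd O ->
  exists T : forall m, groupClosed (automorphism (cantor S m)),
    (forall m, 1 <= m -> [set` T m]%classic = @thompson_T O S m) /\
    (quasi_FPinfty (subgroup_type (T r)) <->
     forall l, 1 <= l <= sig_gcd O -> gcdn l (sig_gcd O) %| r ->
       FPinfty (subgroup_type (T l))).
Proof.
move=> Hv ordS Hb rd; have [T TP] := thompson_T_group Hv ordS Hb.
exists T; split; last exact (quasi_FPinfty_T Hv ordS Hb TP rd).
move=> m m0; apply/seteqP; split=> g.
  by move=> /(TP m m0) /(thompson_T_cyc Hv m0).
by move=> /(thompson_T_cyc Hv m0) /(TP m m0).
Qed.
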